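(* Let $\Sigma$ (a $d\times d_1$ matrix function) and $b$ be Borel measurable on $\mathbb{R}^d$, $A=\Sigma\Sigma^t$. Suppose there is a nonnegative Borel function $\Lambda$ on $\mathbb{R}^d$ such that $q(x,y)\le(\Lambda(x)+\Lambda(y))|x-y|^2$ for all $x,y\in\mathbb{R}^d$, and $q(x,y)<2r(x,y)$ for all $x\neq y$. Then there exists at most one probability solution $\mu$ to $L^*\mu=0$ satisfying $$\int_{\mathbb{R}^d}\Bigl(\frac{\|\Sigma(x)\|^2}{1+|x|^2}+\frac{|b(x)|}{1+|x|}+\Lambda(x)\Bigr)\mu(dx)<\infty.$$
   Context: For a symmetric nonnegative definite matrix $A(x)=(a^{ij}(x))$ and a vector field $b(x)=(b^i(x))$ with Borel measurable entries, $Lf(x)=\mathrm{trace}(A(x)D^2f(x))+\langle b(x),\nabla f(x)\rangle$. A probability solution to $L^*\mu=0$ is a Borel probability measure $\mu$ on $\mathbb{R}^d$ such that all $a^{ij}$ and $b^i$ are $\mu$-integrable on every compact set and $\int_{\mathbb{R}^d}Lf\,d\mu=0$ for every $f\in C_0^\infty(\mathbb{R}^d)$. Here $A(x)=\Sigma(x)\Sigma(x)^t$ with $\Sigma(x)$ a $d\times d_1$ matrix, and $$q(x,y)=\langle x-y,b(x)-b(y)\rangle+\mathrm{trace}\bigl((\Sigma(x)-\Sigma(y))(\Sigma(x)-\Sigma(y))^t\bigr),$$ and for $x\ne y$, $$r(x,y)=\Bigl|\bigl(\Sigma(x)-\Sigma(y)\bigr)^t\frac{x-y}{|x-y|}\Bigr|^2.$$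 *)

(* Defs.v *)
From HB Require Import structures.
From mathcomp Require Import all_boot all_order all_algebra.
From mathcomp Require Import all_classical all_reals all_analysis.
Set Implicit Arguments. Unset Strict Implicit. Unset Printing Implicit Defensive.
Import Order.TTheory GRing.Theory Num.Theory.
Import numFieldNormedType.Exports.
Local Open Scope classical_set_scope.
Local Open Scope ring_scope.

Section Defs.
Variables (R : realType) (d d1 : nat).

Definition Rd := g_sigma_algebraType (@open 'rV[R]_d).

Definition dotv n (u v : 'rV[R]_n) : R := \sum_(i < n) u 0 i * v 0 i.
Definition enorm n (u : 'rV[R]_n) : R := Num.sqrt (dotv u u).

Definition hsnorm (S : 'M[R]_(d, d1)) : R := Num.sqrt (\tr (S *m S^T)).

Definition pderiv (i : 'I_d) (f : 'rV[R]_d -> R) : 'rV[R]_d -> R :=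
  fun x => 'D_(delta_mx 0 i) f x.

Definition iter_pderiv (s : seq 'I_d) (f : 'rV[R]_d -> R) : 'rV[R]_d -> R :=
  foldr pderiv f s.

Definition smooth (f : 'rV[R]_d -> R) : Prop :=
  forall s : seq 'I_d,
    continuous (iter_pderiv s f) /\
    forall (i : 'I_d) (x : 'rV[R]_d),
      derivable (iter_pderiv s f) x (delta_mx 0 i).

Definition test_fun (f : 'rV[R]_d -> R) : Prop :=
  smooth f /\ compact (closure [set x | f x != 0]).

Definition diffA (Sig : 'rV[R]_d -> 'M[R]_(d, d1)) (x : 'rV[R]_d) : 'M[R]_d :=
  Sig x *m (Sig x)^T.

Definition Lop (Sig : 'rV[R]_d -> 'M[R]_(d, d1)) (b : 'rV[R]_d -> 'rV[R]_d)
  (f : 'rV[R]_d -> R) (x : 'rV[R]_d) : R :=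
  \sum_(i < d) \sum_(j < d) diffA Sig x i j * pderiv i (pderiv j f) x
  + \sum_(i < d) b x 0 i * pderiv i f x.

Definition prob_solution (Sig : 'rV[R]_d -> 'M[R]_(d, d1))
  (b : 'rV[R]_d -> 'rV[R]_d) (mu : probability Rd R) : Prop :=
  (forall K : set Rd, compact (K : set 'rV[R]_d) ->
     (forall i j : 'I_d, mu.-integrable K (fun x => (diffA Sig x i j)%:E)) /\
     (forall i : 'I_d, mu.-integrable K (fun x => (b x 0 i)%:E))) /\
  (forall f : 'rV[R]_d -> R, test_fun f ->
     (\int[mu]_x (Lop Sig b f x)%:E = 0)%E).

Definition qfun (Sig : 'rV[R]_d -> 'M[R]_(d, d1)) (b : 'rV[R]_d -> 'rV[R]_d)
  (x y : 'rV[R]_d) : R :=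
  dotv (x - y) (b x - b y) + \tr ((Sig x - Sig y) *m (Sig x - Sig y)^T).

Definition rfun (Sig : 'rV[R]_d -> 'M[R]_(d, d1)) (x y : 'rV[R]_d) : R :=
  enorm ((enorm (x - y))^-1 *: ((x - y) *m (Sig x - Sig y))) ^+ 2.

End Defs.

(* Main.v *)
Require Import Defs.
From HB Require Import structures.
From mathcomp Require Import all_boot all_order all_algebra.
From mathcomp Require Import all_classical all_reals all_analysis.
From mathcomp Require Import measurable_realfun zify ring lra.
Import Order.TTheory GRing.Theory Num.Theory.
Import numFieldNormedType.Exports.
Local Open Scope classical_set_scope.
Local Open Scope ring_scope.
Set Implicit Arguments.
Unset Strict Implicit.
Unset Printing Implicit Defensive.

(** Two solutions mu and nu are compared through a cost function on pairs of
    points with values in [-1, 0], whose generator along the synchronous coupling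
    (the same noise for both points) is bounded above by a small multiple of the
    weights of x and y, and by a fixed negative number when x and y stay in a
    compact set and apart.  The first bound uses q <= (Lambda + Lambda) |x - y|^2
    for x close to y and q < 2 r everywhere; the second one uses the compactness
    of the far pairs in a Lusin set on which the coefficients are continuous.

    No diffusion is constructed.  Both measures are reduced to finitely many cells
    on which the coefficients are almost constant.  The points are smeared over a
    fine lattice by a smooth partition of unity, an optimal coupling for the cost
    on the lattice is chosen, and both marginals are moved by one short step of
    the diffusion.  Stationarity, tested on lattice combinations of smooth bumps,
    says that the step hardly changes the marginals, so optimality prevents the
    step from decreasing the cost: the mean of the generator under the coupling
    is almost nonnegative.  Hence the coupling charges few far pairs, which gives
    mu F <= nu U + small when U contains a neighbourhood of F of fixed size.
    Regularity of Borel measures then yields mu <= nu, and equality by symmetry. *)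

(** * Couplings on finite sets *)

Section Coupling.
Variable R : realType.

(** The inequality q < 2 r is strict but not uniform: close to the diagonal only its weak form and
    the Lambda bound are left. This dictates the cost. The squared distance rho enters through a
    squared logarithm divided by [ln (1 + rho0 / eps)]: as [eps] tends to 0, the gain from l (q - 2
    r) where rho >= rho0 stays of order one, while the terms in q alone and in Lambda carry a factor
    tending to 0. The Lyapunov terms and a truncation give the cost compact support, because
    stationarity is known only against compactly supported functions. Optimality compares the
    marginals at all lattice points at once, which produces test functions whose 0-1 coefficients
    may jump from each lattice point to the next. Their derivatives are nevertheless bounded in
    terms of the smearing width [dl] alone, since the sums over the mesh telescope. Hence the time
    step [s], and after it the mesh width [h], can be chosen last; [h] has to be small against
    [s ^ 2], because each move is rounded to the mesh. *)

Definition coupling (I J : finType) (p : I -> R) (q : J -> R) (g : I -> J -> R) :=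
  [/\ forall i j, 0 <= g i j,
      forall i, \sum_j g i j = p i & forall j, \sum_i g i j = q j].

Lemma coupling_le (I J : finType) (p : I -> R) (q : J -> R) g i j :
  coupling p q g -> g i j <= p i /\ g i j <= q j.
Proof.
case=> g0 gp gq; split.
  by rewrite -gp (bigD1 j) //= lerDl sumr_ge0.
by rewrite -gq (bigD1 i) //= lerDl sumr_ge0.
Qed.

Lemma coupling_prod (I J : finType) (p : I -> R) (q : J -> R) :
  (forall i, 0 <= p i) -> (forall j, 0 <= q j) -> \sum_i p i = \sum_j q j ->
  coupling p q (fun i j => p i * q j / \sum_i p i).
Proof.
move=> p0 q0 e.
(* Division by 0 gives 0, so total mass 0 is treated apart: all entries vanish. *)
have [s0|s0] := eqVneq (\sum_i p i) 0.
  have pz i : p i = 0 by apply: (psumr_eq0P (P := xpredT) _ s0) => // ? _.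
  have qz j : q j = 0.
    by apply: (psumr_eq0P (P := xpredT) (F := q)) => //; rewrite -e.
  split=> [i j|i|j]; first by rewrite pz !mul0r.
    by rewrite big1 ?pz // => j _; rewrite !mul0r.
  by rewrite big1 ?qz // => i _; rewrite pz !mul0r.
split=> [i j|i|j].
- by rewrite divr_ge0 ?mulr_ge0 ?sumr_ge0.
- by rewrite -mulr_suml -mulr_sumr -e mulfK.
- by rewrite -mulr_suml -mulr_suml mulrAC mulfV // mul1r.
Qed.

(** Scaling down the rows and columns of [g'] that exceed [p] and [q] leaves a sub-coupling, and the
    missing mass is filled in by a product. As [c <= 0], the filling only lowers the cost; as
    [-1 <= c], the scaling raises it by at most the removed mass, counted only where [c] can be
    nonzero. *)
Lemma coupling_trim (I : finType) (A : pred I) (p q p' q' : I -> R)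
    (c g' : I -> I -> R) :
  (forall i, 0 <= p i) -> (forall i, 0 <= q i) -> \sum_i p i = \sum_i q i ->
  coupling p' q' g' -> (forall i j, -1 <= c i j <= 0) ->
  (forall i j, ~~ (A i && A j) -> c i j = 0) ->
  exists2 g, coupling p q g &
    \sum_i \sum_j c i j * g i j <= \sum_i \sum_j c i j * g' i j +
     (\sum_(i | A i) Num.max 0 (p' i - p i) + \sum_(i | A i) Num.max 0 (q' i - q i)).
Proof.
move=> p0 q0 epq [g0 gp gq] cb cA.
have p'0 i : 0 <= p' i by rewrite -gp sumr_ge0.
have q'0 i : 0 <= q' i by rewrite -gq sumr_ge0.
(* Factor that brings [r'] down to [r]; the first branch also covers [r' i = 0]. *)
pose la (r r' : I -> R) i := if r' i <= r i then 1 else r i / r' i.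
have laP r r' i : 0 <= r i -> 0 <= r' i ->
    [/\ 0 <= la r r' i, la r r' i <= 1, r' i * la r r' i <= r i &
        r' i * (1 - la r r' i) = Num.max 0 (r' i - r i)].
  move=> r0 r'0; rewrite /la; have [le|lt] := leP (r' i) (r i).
    by rewrite ler01 lexx mulr1 le subrr mulr0 max_l // subr_le0.
  have r'p : 0 < r' i by apply: le_lt_trans lt.
  rewrite divr_ge0 // ler_pdivrMr // mul1r (ltW lt) mulrC divfK ?gt_eqF // lexx.
  rewrite mulrBr mulr1 [r' i * _]mulrC divfK ?gt_eqF // max_r // subr_ge0; exact: ltW.
pose g1 i j := g' i j * (la p p' i * la q q' j).
have g10 i j : 0 <= g1 i j.
  have [a _ _ _] := laP p p' i (p0 i) (p'0 i).
  have [b _ _ _] := laP q q' j (q0 j) (q'0 j).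
  by rewrite /g1 !mulr_ge0.
have g1r i : \sum_j g1 i j <= p i.
  have [a0 a1 a2 _] := laP p p' i (p0 i) (p'0 i).
  apply: le_trans a2; rewrite -gp mulr_suml; apply: ler_sum => j _.
  have [b0 b1 _ _] := laP q q' j (q0 j) (q'0 j).
  by rewrite /g1 ler_wpM2l // ler_piMr.
have g1c j : \sum_i g1 i j <= q j.
  have [a0 a1 a2 _] := laP q q' j (q0 j) (q'0 j).
  apply: le_trans a2; rewrite -gq mulr_suml; apply: ler_sum => i _.
  have [b0 b1 _ _] := laP p p' i (p0 i) (p'0 i).
  by rewrite /g1 ler_wpM2l // ler_piMl.
pose rp i := p i - \sum_j g1 i j.
pose rq j := q j - \sum_i g1 i j.
have rp0 i : 0 <= rp i by rewrite subr_ge0.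
have rq0 i : 0 <= rq i by rewrite subr_ge0.
have erpq : \sum_i rp i = \sum_j rq j.
  by rewrite /rp /rq !sumrB epq; congr (_ - _); rewrite exchange_big.
pose h i j := rp i * rq j / \sum_k rp k.
have [h0 hr hc] : coupling rp rq h by exact: coupling_prod.
exists (fun i j => g1 i j + h i j).
  split=> [i j|i|j]; first exact: addr_ge0.
    by rewrite big_split /= hr /rp addrC subrK.
  by rewrite big_split /= hc /rq addrC subrK.
have cell i j : c i j * (g1 i j + h i j) <= c i j * g' i j +
    ((A i)%:R * (g' i j * (1 - la p p' i)) + (A j)%:R * (g' i j * (1 - la q q' j))).
  have [a0 a1 _ _] := laP p p' i (p0 i) (p'0 i).
  have [b0 b1 _ _] := laP q q' j (q0 j) (q'0 j).
  have [AA|nA] := boolP (A i && A j); last first.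
    rewrite cA // !mul0r add0r addr_ge0 // mulr_ge0 // mulr_ge0 // subr_ge0 //.
  case/andP: AA => -> ->; rewrite !mul1r.
  have := cb i j; have := g0 i j; have := h0 i j.
  rewrite /g1; move: (c i j) (g' i j) (h i j) => x y z z0 y0 /andP[x1 x2].
  move: (la p p' i) (la q q' j) a0 a1 b0 b1 => s t s0 s1 t0 t1.
  have xz : x * z <= 0 by nra.
  have st : 0 <= s * t <= 1 by apply/andP; split; nra.
  have st' : 1 - s * t <= (1 - s) + (1 - t) by nra.
  have yst : 0 <= y * (1 - s * t) by apply: mulr_ge0 => //; lra.
  have : - x * (y * (1 - s * t)) <= 1 * (y * (1 - s * t)) by apply: ler_wpM2r => //; lra.
  have : y * (1 - s * t) <= y * ((1 - s) + (1 - t)) by apply: ler_wpM2l.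
  lra.
apply: (le_trans (ler_sum _ (fun i _ => ler_sum _ (fun j _ => cell i j)))).
under eq_bigr do rewrite big_split big_split /=.
rewrite !big_split /= lerD2l; apply: lerD.
  rewrite le_eqVlt; apply/orP; left; apply/eqP.
  rewrite [RHS]big_mkcond /=; apply: eq_bigr => i _.
  have [_ _ _ <-] := laP p p' i (p0 i) (p'0 i).
  by rewrite -mulr_sumr -mulr_suml gp; case: (A i); rewrite ?mul1r ?mul0r.
rewrite exchange_big /= le_eqVlt; apply/orP; left; apply/eqP.
rewrite [RHS]big_mkcond /=; apply: eq_bigr => i _.
have [_ _ _ <-] := laP q q' i (q0 i) (q'0 i).
by rewrite -mulr_sumr -mulr_suml gq; case: (A i); rewrite ?mul1r ?mul0r.
Qed.

Lemma sum_fiber (I J : finType) (f : J -> I) (F : J -> R) (G : I -> R) :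
  \sum_a G a * (\sum_(z | f z == a) F z) = \sum_z G (f z) * F z.
Proof.
under eq_bigr do rewrite mulr_sumr big_mkcond /=.
rewrite exchange_big /=; apply: eq_bigr => z _.
by rewrite -big_mkcond /= (big_pred1 (f z)) // => a; rewrite /= eq_sym.
Qed.

Lemma sum_fiber1 (I J : finType) (f : J -> I) (F : J -> R) :
  \sum_a (\sum_(z | f z == a) F z) = \sum_z F z.
Proof.
have := sum_fiber f F (fun=> 1).
by under eq_bigr do rewrite mul1r; under [RHS]eq_bigr do rewrite mul1r.
Qed.

(** The mass [g a b] is spread over the two fibres as the product of the conditional laws of [mu]
    and [nu]. A fibre of mass 0 forces [g] to vanish there, which makes the division by 0
    harmless. *)
Lemma coupling_lift (I Z : finType) (f : Z -> I) (mu nu : Z -> R) (g : I -> I -> R) :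
  (forall z, 0 <= mu z) -> (forall z, 0 <= nu z) ->
  coupling (fun a => \sum_(z | f z == a) mu z) (fun a => \sum_(z | f z == a) nu z) g ->
  exists2 G, coupling mu nu G &
    forall c : I -> I -> R, \sum_z \sum_z' c (f z) (f z') * G z z' =
      \sum_a \sum_b c a b * g a b.
Proof.
move=> mu0 nu0; set p := (fun a => _); set q := (fun a => \sum_(z | f z == a) nu z).
move=> gC; have [g0 gp gq] := gC.
have p0 a : 0 <= p a by apply: sumr_ge0.
have q0 a : 0 <= q a by apply: sumr_ge0.
have gpK a b : g a b / p a * p a = g a b.
  have [e|n] := eqVneq (p a) 0; last by rewrite divfK.
  have [le _] := coupling_le a b gC; move: le; rewrite e => le.
  by apply/eqP; rewrite mulr0 eq_sym eq_le le g0.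
have gqK a b : g a b / q b * q b = g a b.
  have [e|n] := eqVneq (q b) 0; last by rewrite divfK.
  have [_ le] := coupling_le a b gC; move: le; rewrite e => le.
  by apply/eqP; rewrite mulr0 eq_sym eq_le le g0.
have muK z : p (f z) * (mu z / p (f z)) = mu z.
  have [e|n] := eqVneq (p (f z)) 0; last by rewrite mulrC divfK.
  rewrite e mul0r; apply/esym.
  by apply: (psumr_eq0P (P := fun z' => f z' == f z) _ e) => // ? _.
have nuK z : q (f z) * (nu z / q (f z)) = nu z.
  have [e|n] := eqVneq (q (f z)) 0; last by rewrite mulrC divfK.
  rewrite e mul0r; apply/esym.
  by apply: (psumr_eq0P (P := fun z' => f z' == f z) _ e) => // ? _.
pose G z z' := g (f z) (f z') * (mu z / p (f z)) * (nu z' / q (f z')).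
exists G.
  split=> [z z'|z|z'].
  - by rewrite /G !mulr_ge0 // ?invr_ge0.
  - rewrite -[RHS]muK -[X in _ = X * _]gp !mulr_suml -(sum_fiber1 f); apply: eq_bigr => b _.
    transitivity (g (f z) b * (mu z / p (f z)) / q b * q b).
      rewrite [X in _ = _ * X]/q mulr_sumr; apply: eq_bigr => z' /eqP <-.
      by rewrite /G; ring.
    by rewrite -[in RHS]gqK; ring.
  - rewrite -[RHS]nuK -[X in _ = X * _]gq !mulr_suml -(sum_fiber1 f); apply: eq_bigr => b _.
    transitivity (g b (f z') * (nu z' / q (f z')) / p b * p b).
      rewrite [X in _ = _ * X]/p mulr_sumr; apply: eq_bigr => z /eqP <-.
      by rewrite /G; ring.
    by rewrite -[in RHS]gpK; ring.
move=> c.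
transitivity (\sum_a \sum_b \sum_(z | f z == a) \sum_(z' | f z' == b) c a b * G z z').
  rewrite -(sum_fiber1 f); apply: eq_bigr => a _.
  rewrite [RHS]exchange_big /=; apply: eq_bigr => z /eqP <-.
  rewrite -(sum_fiber1 f); apply: eq_bigr => b _.
  by apply: eq_bigr => z' /eqP <-.
apply: eq_bigr => a _; apply: eq_bigr => b _.
transitivity (\sum_(z | f z == a) \sum_(z' | f z' == b)
     (c a b * g a b / p a / q b * mu z) * nu z').
  by apply: eq_bigr => z /eqP <-; apply: eq_bigr => z' /eqP <-; rewrite /G; ring.
under eq_bigr do rewrite -mulr_sumr -/(q b).
rewrite -mulr_suml -mulr_sumr -/(p a).
by rewrite -{2}gpK -{2}[g a b]gqK; ring.
Qed.

(* [G] lifts an almost optimal coupling for [c]: the moves [m] cannot decrease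
   its cost by more than the change of the marginals where [c] does not vanish. *)
Lemma coupling_drift (I Z E : finType) (A : pred I) (f : Z -> I) (mu nu : Z -> R)
    (theta : E -> R) (m : E -> Z -> I) (c : I -> I -> R) (s : R) :
  0 < s -> (forall z, 0 <= mu z) -> (forall z, 0 <= nu z) ->
  \sum_z mu z = \sum_z nu z ->
  (forall e, 0 <= theta e) -> \sum_e theta e = 1 ->
  (forall i j, -1 <= c i j <= 0) -> (forall i j, ~~ (A i && A j) -> c i j = 0) ->
  let err la := \sum_(a | A a) Num.max 0
     (\sum_e theta e * \sum_(z | m e z == a) la z - \sum_(z | f z == a) la z) in
  exists2 G, coupling mu nu G &
    - (err mu + err nu + s) <=
    \sum_z \sum_z' (\sum_e theta e * c (m e z) (m e z') - c (f z) (f z')) * G z z'.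
Proof.
move=> s0 mu0 nu0 emn t0 t1 cb cA err.
pose p a := \sum_(z | f z == a) mu z; pose q a := \sum_(z | f z == a) nu z.
have p0 a : 0 <= p a by apply: sumr_ge0.
have q0 a : 0 <= q a by apply: sumr_ge0.
have epq : \sum_a p a = \sum_a q a by rewrite !sum_fiber1.
pose V := [set \sum_a \sum_b c a b * g a b | g in coupling p q].
have V0 : V !=set0.
  by eexists; exists (fun i j => p i * q j / \sum_i p i) => //; exact: coupling_prod.
have Vlb : has_lbound V.
  exists (- \sum_a p a) => _ [g [g0 gp gq] <-].
  rewrite -sumrN; apply: ler_sum => a _; rewrite -gp -sumrN.
  by apply: ler_sum => b _; have := cb a b; have := g0 a b; nra.
(* The slack [s] pays for a coupling that only comes within [s] of the infimum. *)
have [_ [g gC <-] gs] := inf_adherent s0 (conj V0 Vlb).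
have [G GC Ge] := coupling_lift mu0 nu0 gC.
exists G => //; have [G0 Gp Gq] := GC.
(* Law of the pair after both points have made the move with the same random [e]. Its marginals
   differ from [p] and [q], so it is trimmed before being compared with the infimum. *)
pose g' a b := \sum_e theta e * \sum_(z | m e z == a) \sum_(z' | m e z' == b) G z z'.
have g'C : coupling (fun a => \sum_e theta e * \sum_(z | m e z == a) mu z)
                    (fun a => \sum_e theta e * \sum_(z | m e z == a) nu z) g'.
  split=> [a b|a|b].
  - by apply: sumr_ge0 => e _; rewrite mulr_ge0 //; apply: sumr_ge0 => z _; apply: sumr_ge0.
  - rewrite exchange_big /=; apply: eq_bigr => e _; rewrite -mulr_sumr; congr (_ * _).
    rewrite exchange_big /=; apply: eq_bigr => z _.
    by rewrite sum_fiber1.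
  - rewrite exchange_big /=; apply: eq_bigr => e _; rewrite -mulr_sumr; congr (_ * _).
    rewrite sum_fiber1 exchange_big /=; apply: eq_bigr => z _.
    exact: Gq.
have [g2 g2C le2] := coupling_trim p0 q0 epq g'C cb cA.
have infle : inf V <= \sum_a \sum_b c a b * g2 a b by apply: ge_inf => //; exists g2.
have eg' : \sum_a \sum_b c a b * g' a b =
    \sum_z \sum_z' (\sum_e theta e * c (m e z) (m e z')) * G z z'.
  transitivity (\sum_e theta e * \sum_z \sum_z' c (m e z) (m e z') * G z z').
    under eq_bigr do under eq_bigr do rewrite /g' mulr_sumr.
    under eq_bigr do rewrite exchange_big /=.
    rewrite exchange_big /=; apply: eq_bigr => e _.
    rewrite mulr_sumr -(sum_fiber1 (m e)); apply: eq_bigr => a _.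
    transitivity (\sum_b \sum_(z | m e z == a) \sum_(z' | m e z' == b)
       theta e * (c a b * G z z')).
      apply: eq_bigr => b _; rewrite mulrCA.
      rewrite mulr_sumr mulr_sumr; apply: eq_bigr => z _.
      by rewrite mulr_sumr mulr_sumr; apply: eq_bigr => z' _; ring.
    rewrite exchange_big /=; apply: eq_bigr => z /eqP <-.
    rewrite mulr_sumr -(sum_fiber1 (m e)); apply: eq_bigr => b _.
    by apply: eq_bigr => z' /eqP <-.
  under eq_bigr do rewrite mulr_sumr.
  rewrite exchange_big /=; apply: eq_bigr => z _.
  under eq_bigr do rewrite mulr_sumr.
  rewrite exchange_big /=; apply: eq_bigr => z' _.
  by rewrite mulr_suml; apply: eq_bigr => e _; ring.
have -> : \sum_z \sum_z' (\sum_e theta e * c (m e z) (m e z') - c (f z) (f z')) * G z z'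
   = \sum_a \sum_b c a b * g' a b - \sum_a \sum_b c a b * g a b.
  rewrite eg' -Ge -sumrB; apply: eq_bigr => z _; rewrite -sumrB; apply: eq_bigr => z' _.
  by rewrite mulrBl.
move: le2 infle gs; rewrite -/(err mu) -/(err nu); lra.
Qed.

End Coupling.

(** * A smooth step function *)

Section RealCalculus.
Variable R : realType.
Implicit Types (f df : R -> R) (s : R).

Lemma is_derive_continuous f (a : R) s : is_derive s 1 f a -> {for s, continuous f}.
Proof. by case=> d _; apply/differentiable_continuous/derivable1_diffP. Qed.

Lemma mean_value f df (a b : R) : a < b ->
  (forall s, a <= s <= b -> is_derive s 1 f (df s)) ->
  exists2 c, a < c < b & f b - f a = df c * (b - a).
Proof.
move=> ab d.
have [|| c] := @MVT R f df a b ab.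
- by move=> s; rewrite in_itv /= => /andP[h1 h2]; apply: d; rewrite !ltW.
- apply/continuous_in_subspaceT => s; rewrite inE /= in_itv /= => h.
  exact: (is_derive_continuous (d s h)).
by rewrite in_itv /=; exists c.
Qed.

Lemma near_dist_le (s0 e : R) : 0 < e -> \forall s \near s0, `|s0 - s| <= e.
Proof. by move=> e0; exact: (cvgr_dist_le id s0 (@cvg_id _ (nbhs s0))). Qed.

(** Serves at the points where two formulas are glued: a quadratic bound gives derivative 0 without
    reference to either formula. *)
Lemma is_derive_quad f s0 (C : R) : f s0 = 0 ->
  (\forall s \near s0, `|f s| <= C * (s - s0) ^+ 2) -> is_derive s0 1 f 0.
Proof.
move=> f0 fC; apply/is_derive1_caratheodory.
exists (fun z => if z == s0 then 0 else f z / (z - s0)); split; last by rewrite eqxx.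
  move=> z; case: eqP => [->|/eqP n]; first by rewrite !subrr mulr0.
  by rewrite f0 subr0 divfK // subr_eq0.
rewrite /prop_for /continuous_at eqxx; apply/cvgrPdist_le => e e0.
have ee : 0 < e / (`|C| + 1) by rewrite divr_gt0 // ltr_wpDl.
near=> z; case: eqP => [_|/eqP n]; first by rewrite subrr normr0 ltW.
rewrite sub0r normrN normrM normfV ler_pdivrMr ?normr_gt0 ?subr_eq0 //.
have h : `|f z| <= C * (z - s0) ^+ 2 by near: z.
apply: (le_trans h); rewrite -real_normK ?num_real // expr2 mulrA.
apply: ler_wpM2r => //.
have le1 : `|s0 - z| <= e / (`|C| + 1).
  by near: z; exact: near_dist_le.
rewrite distrC; apply: (le_trans (ler_norm _)); rewrite normrM normr_id.
apply: (@le_trans _ _ ((`|C| + 1) * (e / (`|C| + 1)))).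
  by rewrite ler_pM // lerDl.
by rewrite mulrCA mulfV ?mulr1 // gt_eqF // ltr_wpDl.
Unshelve. all: by end_near. Qed.

End RealCalculus.

(** * The function exp (-1 / (s (dl - s))) and its iterated derivatives *)

Section Bump.
Variables (R : realType) (dl : R).
Hypothesis dl0 : 0 < dl.
Implicit Types (p : {poly R}) (n : nat) (s : R).

Let W : {poly R} := 'X * (dl%:P - 'X).

(** The functions p W^-n exp (-1 / W) on the open interval from 0 to [dl], extended by 0. With the
    pair (p, n) as data the family is closed under differentiation. *)
Definition bump (pn : {poly R} * nat) s : R :=
  if 0 < W.[s] then pn.1.[s] * (W.[s]^-1) ^+ pn.2 * expR (- W.[s]^-1) else 0.

(** The derivative of p W^-n exp (-1 / W), brought to the common denominator W^(n + 2). *)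
Definition bump_next (pn : {poly R} * nat) : {poly R} * nat :=
  (pn.1^`() * W ^+ 2 - (pn.1 * W * W^`()) *+ pn.2 + pn.1 * W^`(), pn.2.+2).

Let WE s : W.[s] = s * (dl - s). Proof. by rewrite !hornerE. Qed.

Let bump_nextE pn s : (bump_next pn).1.[s] =
  pn.1^`().[s] * W.[s] ^+ 2 - pn.1.[s] * W.[s] * W^`().[s] *+ pn.2 + pn.1.[s] * W^`().[s].
Proof.
by rewrite /bump_next; move: W => w; rewrite !(hornerD, hornerN, hornerM, hornerMn, expr2).
Qed.

Lemma bump_supp pn s : s <= 0 \/ dl <= s -> bump pn s = 0.
Proof.
move=> h; rewrite /bump WE ifF //; apply/negbTE; rewrite -leNgt.
have := dl0; case: h => h h'; nra.
Qed.

Lemma bump_gt0 s : 0 < s < dl -> 0 < bump (1, 0%N) s.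
Proof.
move=> /andP[s1 s2]; rewrite /bump WE /= hornerC mul1r expr0 mul1r ifT ?expR_gt0 //.
by rewrite mulr_gt0 // subr_gt0.
Qed.

Lemma bump_ge0 s : 0 <= bump (1, 0%N) s.
Proof.
by rewrite /bump /=; case: ifP => // _; rewrite hornerC mul1r expr0 mul1r expR_ge0.
Qed.

(** One term of the exponential series is enough. Two powers of [w] are kept in reserve: they become
    the quadratic bound required at the ends of the support. *)
Lemma expR_inv_le n (w : R) : 0 < w -> w^-1 ^+ n * expR (- w^-1) <= (n.+2)`!%:R * w ^+ 2.
Proof.
move=> w0; rewrite expRN.
have h : w^-1 ^+ n.+2 / (n.+2)`!%:R <= expR w^-1.
  apply: le_trans (expR_ge1Dxn n.+1 _); last by rewrite invr_ge0 ltW.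
  by rewrite lerDr.
rewrite ler_pdivrMr ?expR_gt0 //.
apply: le_trans (ler_wpM2l _ h); last by rewrite mulr_ge0 // exprn_ge0 ?ltW.
have f0 : (n.+2)`!%:R != 0 :> R by rewrite pnatr_eq0 -lt0n fact_gt0.
rewrite !exprS !exprVn; set wn := w ^+ n.
have wn0 : wn != 0 by rewrite expf_neq0 // gt_eqF.
have -> : (n.+2)`!%:R * (w * (w * w ^+ 0)) * (w^-1 * (w^-1 * wn^-1) / (n.+2)`!%:R) = wn^-1.
  rewrite expr0; field.
  by rewrite f0 wn0 gt_eqF.
by [].
Qed.

Lemma bump_derive pn s : is_derive s 1 (bump pn) (bump (bump_next pn) s).
Proof.
case: pn => p n; have [Wp|Wn] := ltP 0 W.[s].
  pose g t : R := p.[t] * (W.[t]^-1) ^+ n * expR (- W.[t]^-1).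
  have near_g : \near s, g s = bump (p, n) s.
    have := @continuous_horner _ W s => /cvgr_gt /(_ _ Wp).
    by apply: filterS => t h; rewrite /bump /= h.
  apply: (near_eq_is_derive near_g).
  have W0 : W.[s] != 0 by rewrite gt_eqF.
  have dV := @is_deriveV _ (horner W) s _ 1 W0 (is_derive_poly W s).
  have dN := is_deriveN dV.
  have dE := @is_derive1_comp _ expR _ s _ _ (is_derive_expR _) dN.
  have dX := @is_deriveX _ _ _ n _ _ _ dV.
  have dP := is_derive_poly p s.
  have := is_deriveM (is_deriveM dP dX) dE.
  rewrite exprfctE !fctE => d; apply: (is_derive_eq d) => {d}.
  rewrite /bump Wp bump_nextE /GRing.scale /= -/(W.[s] ^+ 2).
  set a := p.[s]; set a' := p^`().[s]; set w := W.[s] in W0 *; set w' := W^`().[s].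
  set e := expR _; rewrite !exprS expr0.
  case: n {near_g dX} @g => [|m]; first by rewrite !mulr0n !expr0 /=; field.
  rewrite -[_ *+ m.+1]mulr_natl !exprS !exprVn /=; set wm := w ^+ m.
  have wm0 : wm != 0 by rewrite expf_neq0.
  by field; rewrite wm0.
have -> : bump (bump_next (p, n)) s = 0 by rewrite /bump ltNge Wn.
(* As W(s) <= 0, W(t) is at most (|dl - 2 s| + 1) |t - s| for t within 1 of s. The three factors of
   [K] come from the polynomial, from [expR_inv_le] and from the square of this linear bound. *)
pose K : R := (`|p.[s]| + 1) * (n.+2)`!%:R * (`|dl - 2 * s| + 1) ^+ 2.
apply: (@is_derive_quad _ _ _ K); first by rewrite /bump ltNge Wn.
near=> t.
have [Wt|Wt] := ltP 0 W.[t]; last first.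
  rewrite /bump ltNge Wt /= normr0 mulr_ge0 ?sqr_ge0 // /K.
  by rewrite !mulr_ge0 ?exprn_ge0 ?addr_ge0.
rewrite /bump Wt /= -mulrA normrM.
have h1 : `|p.[t]| <= `|p.[s]| + 1.
  have : `|p.[s] - p.[t]| <= 1.
    by near: t; apply: cvgr_dist_le => //; exact: continuous_horner.
  by move=> h; rewrite -lerBlDl; apply: le_trans (lerB_dist _ _) _; rewrite distrC.
have h2 : W.[t] <= (`|dl - 2 * s| + 1) * `|t - s|.
  have : `|s - t| <= 1 by near: t; exact: near_dist_le.
  rewrite distrC => h.
  have e : W.[t] - W.[s] = (t - s) * (dl - 2 * s - (t - s)) by rewrite !WE; ring.
  have : W.[t] <= `|(t - s) * (dl - 2 * s - (t - s))| by rewrite -e; have := ler_norm (W.[t] - W.[s]); lra.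
  move/le_trans; apply; rewrite normrM mulrC ler_wpM2r //.
  by apply: le_trans (ler_normB _ _) _; rewrite lerD2l.
rewrite [X in _ * X]ger0_norm; last by rewrite mulr_ge0 ?expR_ge0 ?exprn_ge0 ?invr_ge0 ?ltW.
apply: (@le_trans _ _ ((`|p.[s]| + 1) * ((n.+2)`!%:R * W.[t] ^+ 2))).
  apply: ler_pM => //; last exact: expR_inv_le.
  by rewrite mulr_ge0 ?expR_ge0 ?exprn_ge0 ?invr_ge0 ?ltW.
have -> : K * (t - s) ^+ 2 = (`|p.[s]| + 1) * ((n.+2)`!%:R *
    ((`|dl - 2 * s| + 1) * `|t - s|) ^+ 2).
  by rewrite exprMn real_normK ?num_real // /K; ring.
do 2![apply: ler_wpM2l => //].
by rewrite lerXn2r // ?nnegrE ?mulr_ge0 ?addr_ge0 ?normr_ge0 // ltW.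
Unshelve. all: by end_near. Qed.

(* The successive derivatives [G n] of a step function [G 0] from 0 to 1. *)
Lemma smooth_step : exists G : nat -> R -> R,
  [/\ forall n s, is_derive s 1 (G n) (G n.+1 s),
      forall s, s <= 0 -> G 0%N s = 0,
      forall s, dl <= s -> G 0%N s = 1,
      forall n s, s <= 0 \/ dl <= s -> G n.+1 s = 0 &
      forall s, 0 <= G 1%N s].
Proof.
pose th n := bump (iter n bump_next (1, 0%N)).
have thd n s : is_derive s 1 (th n) (th n.+1 s) by exact: bump_derive.
have thc n : continuous (th n) by move=> s; exact: is_derive_continuous (thd n s).
(* The base point -1 lies to the left of the support, so that 0 is an interior point for the
   fundamental theorem of calculus. *)
pose J s := (\int[lebesgue_measure]_(t in [set` `[-1, s]]) (th 0%N t))%R.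
have Jd s : -1 < s -> is_derive s 1 J (th 0%N s).
  move=> s1; have [||||] := @continuous_FTC1 R (th 0%N) (BLeft (-1)) s (s + 1).
  - by rewrite ltrDl.
  - apply: continuous_compact_integrable; first exact: segment_compact.
    exact/continuous_subspaceT/thc.
  - by rewrite lte_fin.
  - exact: thc.
  move=> d1 d2; apply: DeriveDef; first exact: d1.
  by rewrite -derive1E; exact: d2.
have J0 s : -1 < s -> s <= 0 -> J s = J 0.
  move=> s1; rewrite le_eqVlt => /orP[/eqP->//|s0].
  have [|c /andP[c1 c2] /eqP] := @mean_value _ J (th 0%N) s 0 s0.
    by move=> t /andP[t1 _]; apply: Jd; apply: lt_le_trans t1.
  by rewrite /th bump_supp ?mul0r ?subr_eq0 => [/eqP //|]; left; exact: ltW.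
pose Z := J dl - J 0.
have Z0 : 0 < Z.
  have [|c c1 e] := @mean_value _ J (th 0%N) 0 dl dl0.
    by move=> t /andP[t1 _]; apply: Jd; apply: lt_le_trans t1.
  by rewrite /Z e subr0 mulr_gt0 // bump_gt0.
have Jdl s : dl <= s -> J s = J dl.
  rewrite le_eqVlt => /orP[/eqP->//|s0].
  have [|c /andP[c1 c2] /eqP] := @mean_value _ J (th 0%N) dl s s0.
    by move=> t /andP[t1 _]; apply: Jd; have := dl0; lra.
  by rewrite /th bump_supp ?mul0r ?subr_eq0 => [/eqP //|]; right; exact: ltW.
(* Left of -1 the integral is replaced by 0, which agrees with [J s - J 0 = 0] between -1 and 0. *)
pose H s := if - 1 < s then (J s - J 0) / Z else 0.
pose G n := if n is m.+1 then fun s => th m s / Z else H.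
exists G; split.
- case=> [|n] s; last first.
    have := is_deriveM (thd n s) (is_derive_cst Z^-1 s 1).
    rewrite !fctE => d; apply: (is_derive_eq d).
    by rewrite /GRing.scale /= mulr0 add0r mulrC.
  have [s1|s1] := ltP (-1) s.
    pose F t := (J t - J 0) / Z.
    have d : is_derive s 1 F (th 0%N s / Z).
      have := is_deriveM (is_deriveB (Jd s s1) (is_derive_cst (J 0) s 1)) (is_derive_cst Z^-1 s 1).
      rewrite !fctE => d; apply: (is_derive_eq d).
      by rewrite /GRing.scale /= mulr0 add0r subr0 mulrC.
    apply: near_eq_is_derive d.
    near=> t; rewrite /F /G /H /= ifT //.
    by near: t; exact: (@cvgr_gt _ _ _ _ id s (@cvg_id _ (nbhs s))).
  have -> : G 1%N s = 0.
    by rewrite /G /= /th bump_supp ?mul0r //; left; apply: le_trans s1 _; rewrite lerN10.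
  apply: (@near_eq_is_derive _ _ _ (cst 0)) (is_derive_cst _ _ _).
  near=> t; rewrite /G /H /=; case: ifP => // h; rewrite J0 ?subrr ?mul0r //.
  have : t < 0; last exact: ltW.
  near: t; apply: (@cvgr_lt _ _ _ _ id s (@cvg_id _ (nbhs s))).
  by apply: le_lt_trans s1 _; rewrite ltrN10.
- move=> s s0; rewrite /G /H; case: ifP => // h; by rewrite J0 // subrr mul0r.
- move=> s s0; have s1 : -1 < s by have := dl0; lra.
  by rewrite /G /H s1 Jdl // mulfV // gt_eqF.
- by move=> n s h; rewrite /G /th bump_supp ?mul0r.
- by move=> s; rewrite /G divr_ge0 //; [exact: bump_ge0 | exact: ltW].
Unshelve. all: by end_near. Qed.

End Bump.

(** * Calculus along lines *)

Section LineCalculus.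
Variables (R : realType) (V : normedModType R).
Implicit Types (f g : V -> R) (x v : V).

(** All calculus in several variables is reduced to real functions of the line parameter; the same
    lemmas then serve the space and the space of pairs. *)
Lemma is_derive_line f x v (a : R) :
  is_derive x v f a <-> is_derive (0 : R) 1 (fun h : R => f (h *: v + x)) a.
Proof.
have e : (fun h : R => h^-1 *: ((f \o shift x) (h *: v) - f x)) =
   (fun h : R => h^-1 *: (((fun h : R => f (h *: v + x)) \o shift (0 : R)) (h *: 1) -
              f ((0 : R) *: v + x))).
  by rewrite funeqE => h /=; rewrite addr0 scale0r add0r [_%:A]mulr1.
split=> -[d <-]; apply: DeriveDef.
- exact: (derivable1P f x v).1.
- by rewrite /derive e.
- exact: (derivable1P f x v).2.
- by rewrite /derive e.
Qed.

Lemma is_derive_comp f (g : R -> R) x v (a b : R) :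
  is_derive x v f a -> is_derive (f x) 1 g b -> is_derive x v (g \o f) (b * a).
Proof.
move=> /is_derive_line fd gd; apply/is_derive_line.
apply: (@is_derive1_comp _ g (fun h : R => f (h *: v + x)) 0 b a _ fd).
by rewrite scale0r add0r.
Qed.

Lemma is_derive_along f f1 v : (forall y, is_derive y v f (f1 y)) ->
  forall x (t : R), is_derive t 1 (fun s : R => f (s *: v + x)) (f1 (t *: v + x)).
Proof.
move=> fd x t; have /is_derive_line d0 := fd (t *: v + x).
have sd := @is_derive_shift R t 1 (- t).
have d : is_derive (shift (- t) t) 1 (fun h : R => f (h *: v + (t *: v + x))) (f1 (t *: v + x)).
  by rewrite /= subrr.
have := is_derive1_comp d sd; rewrite mulr1 => D.
rewrite (_ : (fun s : R => _) = (fun h : R => f (h *: v + (t *: v + x))) \o shift (- t)) //.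
by apply/funext => s /=; rewrite addrA -scalerDl subrK.
Qed.

Lemma line_mean_value f f1 x v : (forall y, is_derive y v f (f1 y)) ->
  exists2 t : R, 0 < t < 1 & f (v + x) - f x = f1 (t *: v + x).
Proof.
move=> fd.
have [|t t01] := @mean_value R (fun t => f (t *: v + x)) (fun t => f1 (t *: v + x)) 0 1 ltr01.
  by move=> s _; exact: (is_derive_along fd).
by rewrite scale1r scale0r add0r subr0 mulr1; exists t.
Qed.

Lemma taylor1 f f1 x v (K : R) : (forall y, is_derive y v f (f1 y)) ->
  (forall t : R, 0 <= t <= 1 -> `|f1 (t *: v + x) - f1 x| <= K) ->
  `|f (v + x) - f x - f1 x| <= K.
Proof.
move=> fd fK; have [t /andP[t0 t1] ->] := line_mean_value x fd.
by apply: fK; rewrite !ltW.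
Qed.

(** The symmetric second difference cancels the first-order term, so that only the oscillation of
    the second derivative remains: the mean value theorem is applied to [F], and then to [g1]
    between [- t] and [t]. *)
Lemma taylor2 f f1 f2 x v (K : R) : (forall y, is_derive y v f (f1 y)) ->
  (forall y, is_derive y v f1 (f2 y)) ->
  (forall t : R, -1 <= t <= 1 -> `|f2 (t *: v + x) - f2 x| <= K) ->
  `|f (v + x) + f (- v + x) - 2 * f x - f2 x| <= 2 * K.
Proof.
move=> fd f1d fK.
pose g (t : R) := f (t *: v + x); pose g1 (t : R) := f1 (t *: v + x).
have gd (t : R) : is_derive t 1 g (g1 t) := is_derive_along fd x t.
have g1d (t : R) : is_derive t 1 g1 (f2 (t *: v + x)) := is_derive_along f1d x t.
pose F (t : R) := g t + g (- t) - t ^+ 2 * f2 x.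
pose F1 (t : R) := g1 t - g1 (- t) - 2 * t * f2 x.
have Fd (t : R) : is_derive t 1 F (F1 t).
  have nd : is_derive t 1 (fun s => g (- s)) (- g1 (- t)).
    have := @is_derive1_comp _ g (-%R) t _ _ (gd (- t)) (is_deriveNid _ _).
    by rewrite mulrN1.
  have sd : is_derive t 1 (fun s => s ^+ 2 * f2 x) (2 * t * f2 x).
    have := is_deriveM (is_deriveX 2 (is_derive_id t (1 : R))) (is_derive_cst (f2 x) t 1).
    rewrite !fctE => d; apply: (is_derive_eq d).
    by rewrite /GRing.scale /=; ring.
  exact: is_deriveB (is_deriveD (gd t) nd) sd.
have [t /andP[t0 t1]] := mean_value ltr01 (fun s (_ : 0 <= s <= 1) => Fd s).
have -> : F 1 - F 0 = f (v + x) + f (- v + x) - 2 * f x - f2 x.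
  by rewrite /F /g scale1r scaleN1r oppr0 scale0r add0r; ring.
rewrite subr0 mulr1 => ->.
have tt : - t < t by lra.
have [s /andP[s0 s1] e] := mean_value tt (fun s (_ : - t <= s <= t) => g1d s).
rewrite /F1 e.
have -> : f2 (s *: v + x) * (t - - t) - 2 * t * f2 x = 2 * t * (f2 (s *: v + x) - f2 x) by ring.
have := fK s; rewrite normrM ger0_norm; last by rewrite mulr_ge0 // ltW.
have -> : -1 <= s <= 1 by apply/andP; split; lra.
move=> /(_ isT) h; apply: ler_pM => //; first by rewrite mulr_ge0 // ltW.
lra.
Qed.

Lemma is_derive_bigprod (I : finType) (F : I -> V -> R) (dF : I -> R) x v :
  (forall i, is_derive x v (F i) (dF i)) ->
  is_derive x v (fun y => \prod_i F i y) (\sum_i \prod_j (if j == i then dF j else F j x)).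
Proof.
move=> Fd; suff: forall s : seq I, uniq s -> is_derive x v (fun y => \prod_(i <- s) F i y)
    (\sum_(i <- s) \prod_(j <- s) (if j == i then dF j else F j x)).
  by apply; exact: index_enum_uniq.
elim=> [_|a s ih /= /andP[ans us]].
  rewrite big_nil (_ : (fun y => _) = cst 1); first exact: is_derive_cst.
  by apply/funext => y; rewrite big_nil.
rewrite (_ : (fun y => _) = F a * (fun y => \prod_(i <- s) F i y)); last first.
  by apply/funext => y; rewrite big_cons.
apply: (is_derive_eq (is_deriveM (Fd a) (ih us))).
rewrite big_cons big_cons eqxx /GRing.scale /= addrC mulrC; congr (_ * _ + _).
  rewrite !big_seq; apply: eq_bigr => i js; rewrite ifF //.
  by apply: contraNF ans => /eqP <-.
rewrite mulr_sumr !big_seq; apply: eq_bigr => i js.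
by rewrite big_cons ifF //; apply: contraNF ans => /eqP ->.
Qed.

Lemma is_derive_bigsum (I : finType) (F : I -> V -> R) (dF : I -> R) x v :
  (forall i, is_derive x v (F i) (dF i)) ->
  is_derive x v (fun y => \sum_i F i y) (\sum_i dF i).
Proof.
move=> Fd; elim: (index_enum I) => [|a s ih].
  rewrite big_nil (_ : (fun y => _) = cst 0); first exact: is_derive_cst.
  by apply/funext => y; rewrite big_nil.
rewrite big_cons (_ : (fun y => _) = F a + (fun y => \sum_(i <- s) F i y)); last first.
  by apply/funext => y; rewrite big_cons.
exact: is_deriveD.
Qed.

End LineCalculus.

(** * Coordinates and the maximum norm of row vectors *)

Section RowNorm.
Variables (R : realType) (d : nat).
Implicit Types x y v : 'rV[R]_d.

Lemma coord_le x i : `|x 0 i| <= `|x|.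
Proof.
rewrite [X in _ <= X]/Num.norm /= mx_normrE.
by apply/bigmax_geP; right; exists (0, i).
Qed.

Lemma rv_norm_le x (c : R) : 0 <= c -> (forall i, `|x 0 i| <= c) -> `|x| <= c.
Proof.
move=> c0 h; rewrite [X in X <= _]/Num.norm /= mx_normrE.
by apply/bigmax_leP; split=> // -[i j] _ /=; rewrite ord1.
Qed.

Lemma is_derive_coord x v i (c : R) : is_derive x v (fun y => y 0 i - c) (v 0 i).
Proof.
apply/is_derive_line.
have := is_deriveD (is_deriveM (is_derive_id (0 : R) 1) (is_derive_cst (v 0 i) (0 : R) 1))
   (is_derive_cst (x 0 i - c) (0 : R) (1 : R)).
rewrite !fctE => D.
rewrite (_ : (fun h => _) = (fun h : R => h * v 0 i + (x 0 i - c))); last first.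
  by apply/funext => h; rewrite !mxE addrA.
by apply: (is_derive_eq D); rewrite /GRing.scale /=; ring.
Qed.

End RowNorm.

(** * Lattice test functions *)

Section Lattice.
Variables (R : realType) (d : nat) (dl : R) (G : nat -> R -> R).
Hypothesis dl0 : 0 < dl.
Hypothesis Gd : forall n (s : R), is_derive s 1 (G n) (G n.+1 s).
Hypothesis G_le0 : forall s, s <= 0 -> G 0%N s = 0.
Hypothesis G_ge1 : forall s, dl <= s -> G 0%N s = 1.
Hypothesis G_supp : forall n s, s <= 0 \/ dl <= s -> G n.+1 s = 0.
Hypothesis G_pos : forall s, 0 <= G 1%N s.

(** Every [G n] is constant on either side of the interval from 0 to [dl], so its increments are
    controlled by those of [clamp], and the latter add up to at most [dl] along any increasing
    sequence. *)
Definition clamp (s : R) : R := Num.max 0 (Num.min s dl).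

Lemma clamp_in s : 0 <= clamp s <= dl.
Proof. by rewrite /clamp le_max lexx /= ge_max ge_min lexx orbT ltW. Qed.

Lemma clamp_mono s t : s <= t -> clamp s <= clamp t.
Proof.
by move=> st; rewrite /clamp ge_max le_max lexx /= le_max; apply/orP; right; rewrite le_min !ge_min st lexx orbT.
Qed.

Lemma clamp_id s : 0 <= s <= dl -> clamp s = s.
Proof. by move=> /andP[a b]; rewrite /clamp min_l // max_r. Qed.

Lemma G_clamp n s : G n s = G n (clamp s).
Proof.
have [s0|s0] := leP s 0.
  have -> : clamp s = 0 by rewrite /clamp max_l // ge_min s0.
  by case: n => [|n]; rewrite ?G_le0 ?G_supp //; left.
have [s1|s1] := leP dl s; last by rewrite clamp_id // !ltW.
have -> : clamp s = dl by rewrite /clamp min_r // max_r // ltW.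
by case: n => [|n]; rewrite ?G_ge1 ?G_supp //; right.
Qed.

Lemma G_bound n : exists2 B, 0 <= B & forall s, `|G n s| <= B.
Proof.
have Gc : continuous (G n) by move=> s; exact: is_derive_continuous (Gd n s).
have [|c _ cM] := @EVT_max R (fun s => `|G n s|) 0 dl (ltW dl0).
  by apply: continuous_subspaceT => s; apply: (continuous_comp (Gc s)); exact: norm_continuous.
exists `|G n c| => // s; rewrite G_clamp; apply: cM.
by rewrite in_itv; exact: clamp_in.
Qed.

Lemma G_lip n (B : R) s t : (forall s, `|G n.+1 s| <= B) -> s <= t ->
  `|G n t - G n s| <= B * (clamp t - clamp s).
Proof.
move=> GB st; rewrite (G_clamp n t) (G_clamp n s).
have := clamp_mono st; rewrite le_eqVlt => /orP[/eqP ->|lt].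
  by rewrite !subrr mulr0 normr0.
have [c _ ->] := mean_value lt (fun s (_ : clamp _ <= s <= _) => Gd n s).
by rewrite normrM [X in _ * X]ger0_norm ?subr_ge0 ?(ltW lt) // ler_wpM2r // subr_ge0 ltW.
Qed.

Lemma G_nondecreasing s t : s <= t -> G 0%N s <= G 0%N t.
Proof.
rewrite le_eqVlt => /orP[/eqP->//|lt].
have [c _ e] := mean_value lt (fun u (_ : s <= u <= t) => Gd 0 u).
by rewrite -subr_ge0 e mulr_ge0 // subr_ge0 ltW.
Qed.

Variables (h : R) (N n : nat).
Hypothesis h0 : 0 < h.

(** Increment over one mesh width of the [m]-th derivative of the step. For [m = 0] the translates
    by the nodes telescope to a partition of unity of width about [dl + h], whatever the ratio of
    [h] to [dl]. *)
Definition bspl m (u : R) := G m (u + h) - G m u.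
Definition node (k : nat) : R := h * (k%:R - N%:R).

Lemma bspl_supp m u : bspl m u != 0 -> - h < u < dl.
Proof.
apply: contraR; rewrite negb_and -!leNgt /bspl => /orP[u1|u1].
  have uh : u + h <= 0 by rewrite -lerBrDr sub0r.
  have u0 : u <= 0 by apply: le_trans u1 _; rewrite oppr_le0 ltW.
  by case: m => [|m]; rewrite ?G_le0 ?G_supp ?subrr //; left.
have uh : dl <= u + h by apply: le_trans u1 _; rewrite lerDl ltW.
by case: m => [|m]; rewrite ?G_ge1 ?G_supp ?subrr //; right.
Qed.

Lemma bspl_ge0 u : 0 <= bspl 0 u.
Proof. by rewrite subr_ge0 G_nondecreasing // lerDl ltW. Qed.

Lemma nodeS s k : s - node k.+1 + h = s - node k.
Proof. by rewrite /node -[k.+1]addn1 natrD; ring. Qed.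

Lemma sum_bspl0 s :
  \sum_(k < n) bspl 0 (s - node k) = G 0%N (s + h * N%:R + h) - G 0%N (s + h * N%:R + h - h * n%:R).
Proof.
rewrite -(big_mkord xpredT (fun k => bspl 0 (s - node k))).
rewrite (eq_bigr (fun k => - G 0%N (s - node k.+1 + h) - - G 0%N (s - node k + h))); last first.
  by move=> k _; rewrite /bspl nodeS; ring.
rewrite telescope_sumr // opprK addrC; congr (G 0%N _ - G 0%N _); rewrite /node; ring.
Qed.

(** Neither [h] nor [n] enters the bound: each term is at most [B] times an increment of [clamp],
    and these increments telescope. *)
Lemma sum_bspl_bound m (B : R) s : (forall s, `|G m.+1 s| <= B) ->
  \sum_(k < n) `|bspl m (s - node k)| <= B * dl.
Proof.
move=> GB; have B0 : 0 <= B by apply: le_trans (GB 0).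
rewrite -(big_mkord xpredT (fun k => `|bspl m (s - node k)|)).
apply: (@le_trans _ _ (\sum_(0 <= k < n)
   B * ((- clamp (s - node k.+1 + h)) - (- clamp (s - node k + h))))).
  apply: ler_sum => k _; rewrite nodeS opprK [- clamp _ + _]addrC.
  by apply: G_lip => //; rewrite lerDl ltW.
rewrite -mulr_sumr telescope_sumr // ler_wpM2l // opprK.
have := clamp_in (s - node 0 + h); have := clamp_in (s - node n + h); lra.
Qed.

Let T := {ffun 'I_d -> 'I_n}.

Definition lpoint (k : T) : 'rV[R]_d := \row_i node (k i).

Definition weight (k : T) (x : 'rV[R]_d) : R := \prod_i bspl 0 (x 0 i - node (k i)).

(** [phi] may oscillate arbitrarily from one lattice point to the next; [a] records how many
    derivatives are taken in each coordinate. *)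
Definition tfun (phi : T -> R) (a : 'I_d -> nat) (x : 'rV[R]_d) : R :=
  \sum_k phi k * \prod_i bspl (a i) (x 0 i - node (k i)).

Definition incr (a : 'I_d -> nat) (i : 'I_d) : 'I_d -> nat := fun j => (a j + (j == i))%N.

Lemma tfun_derive phi a x v :
  is_derive x v (tfun phi a) (\sum_i v 0 i * tfun phi (incr a i) x).
Proof.
have ed m (u : R) : is_derive u 1 (bspl m) (bspl m.+1 u).
  have := is_deriveB (is_derive1_comp (Gd m (shift h u)) (is_derive_shift u 1 h)) (Gd m u).
  by rewrite mulr1.
have dk k : is_derive x v (fun y : 'rV[R]_d => phi k * \prod_i bspl (a i) (y 0 i - node (k i)))
   (\sum_i v 0 i * (phi k * \prod_j bspl (incr a i j) (x 0 j - node (k j)))).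
  have e i := is_derive_comp (is_derive_coord x v i (node (k i))) (ed (a i) _).
  have := is_deriveM (is_derive_cst (phi k) x v) (is_derive_bigprod e).
  rewrite !fctE => D; apply: (is_derive_eq D).
  rewrite scaler0 addr0 /GRing.scale /= mulr_sumr; apply: eq_bigr => i _.
  rewrite mulrCA; congr (_ * _).
  rewrite (bigD1 i) //= eqxx [in RHS](bigD1 i) //= /incr eqxx addn1 mulrA [v 0 i * _]mulrC.
  congr (_ * _); apply: eq_bigr => j /negbTE ji; by rewrite ji addn0.
apply: (is_derive_eq (is_derive_bigsum dk)).
by rewrite exchange_big /=; apply: eq_bigr => i _; rewrite mulr_sumr.
Qed.

Lemma tfun_bound phi a x (B : nat -> R) : (forall k, `|phi k| <= 1) ->
  (forall m s, `|G m s| <= B m) ->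
  `|tfun phi a x| <= \prod_i (B (a i).+1 * dl).
Proof.
move=> p1 GB; apply: le_trans (ler_norm_sum _ _ _) _.
apply: (@le_trans _ _ (\sum_(k : T) \prod_i `|bspl (a i) (x 0 i - node (k i))|)).
  by apply: ler_sum => k _; rewrite normrM normr_prod ler_piMl // prodr_ge0.
rewrite -(bigA_distr_bigA (fun i (k : 'I_n) => `|bspl (a i) (x 0 i - node k)|)) /=.
apply: ler_prod => i _; rewrite sumr_ge0 //=; exact: sum_bspl_bound.
Qed.

Lemma weight_ge0 k x : 0 <= weight k x.
Proof. by apply: prodr_ge0 => i _; exact: bspl_ge0. Qed.

Lemma weight_supp k x : weight k x != 0 -> `|x - lpoint k| <= h + dl.
Proof.
move/prodf_neq0 => wk; apply: rv_norm_le; first by rewrite addr_ge0 ?ltW.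
move=> i; rewrite !mxE; have /andP[u1 u2] := bspl_supp (wk i isT).
rewrite ler_norml; apply/andP; split; have := h0; have := dl0; lra.
Qed.

Lemma sum_weight x :
  \sum_k weight k x = \prod_i \sum_(k < n) bspl 0 (x 0 i - node k).
Proof. by rewrite (bigA_distr_bigA (fun i (k : 'I_n) => bspl 0 (x 0 i - node k))). Qed.

Lemma sum_weight_le1 x : \sum_k weight k x <= 1.
Proof.
rewrite sum_weight; apply: Num.Theory.prodr_ile1 => i _; rewrite sumr_ge0 /=; last by move=> k _; exact: bspl_ge0.
rewrite sum_bspl0.
have Gin s : 0 <= G 0%N s <= 1.
  rewrite (G_clamp 0 s); have /andP[c0 c1] := clamp_in s.
  by rewrite -[X in X <= _ <= _](@G_le0 0) // -[X in _ <= _ <= X](@G_ge1 dl) // !G_nondecreasing.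
have := Gin (x 0 i + h * N%:R + h).
by have := Gin (x 0 i + h * N%:R + h - h * n%:R); lra.
Qed.

Lemma sum_weight_eq1 x : n = (N + N)%N -> `|x| <= h * N%:R - h - dl -> \sum_k weight k x = 1.
Proof.
move=> nN xN; rewrite sum_weight; apply: big1 => i _; rewrite sum_bspl0 nN natrD.
have := le_trans (coord_le x i) xN; rewrite ler_norml => /andP[x1 x2].
by rewrite G_ge1 ?G_le0 ?subr0 //; have := h0; have := dl0; lra.
Qed.

Lemma tfun0 phi x : tfun phi (fun=> 0%N) x = \sum_k phi k * weight k x.
Proof. by []. Qed.

Lemma tfun_continuous phi a : continuous (tfun phi a).
Proof.
move=> x; apply: (cvg_big add_continuous (nbhs_filter x)) => k _.
apply: cvgM; first exact: cvg_cst.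
elim: (index_enum 'I_d) => [|i s ih].
  by rewrite (_ : (fun x => _) = cst 1); [rewrite big_nil; exact: cvg_cst|apply/funext => y; rewrite big_nil].
rewrite (_ : (fun x => _) = (fun y : 'rV[R]_d => bspl (a i) (y 0 i - node (k i)) *
  \prod_(j <- s) bspl (a j) (y 0 j - node (k j)))); last by apply/funext => y; rewrite big_cons.
rewrite big_cons; apply: cvgM => //.
have ec : continuous (bspl (a i)).
  move=> u; apply: continuousB; last exact: is_derive_continuous (Gd _ u).
  apply: (@continuous_comp _ _ _ (shift h) (G (a i))).
    by apply: continuousD; [exact: cvg_id|exact: cst_continuous].
  exact: is_derive_continuous (Gd _ _).
apply: (@continuous_comp _ _ _ (fun y : 'rV[R]_d => y 0 i - node (k i)) (bspl (a i))); last exact: ec.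
by apply: continuousB; [exact: coord_continuous|exact: cst_continuous].
Qed.

Lemma tfun_pderiv phi a i : pderiv i (tfun phi a) = tfun phi (incr a i).
Proof.
apply/funext => x; rewrite /pderiv; have [_ ->] := tfun_derive phi a x (delta_mx 0 i).
rewrite (bigD1 i) //= big1 ?addr0 => [|j /negbTE ji]; first by rewrite mxE !eqxx mul1r.
by rewrite mxE ji andbF mul0r.
Qed.

Lemma tfun_test phi : test_fun (tfun phi (fun=> 0%N)).
Proof.
split.
  move=> s; have [a ->] : exists a, iter_pderiv s (tfun phi (fun=> 0%N)) = tfun phi a.
    elim: s => [|i s [a e]] /=; first by exists (fun=> 0%N).
    by exists (incr a i); rewrite e tfun_pderiv.
  split; first exact: tfun_continuous.
  by move=> i x; have [] := tfun_derive phi a x (delta_mx 0 i).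
apply: bounded_closed_compact; last exact: closed_closure.
(* A crude radius: the sum over the finite lattice dominates the radius of each support. *)
pose M := \sum_(k : T) (`|lpoint k| + (h + dl)).
have cb : closed [set x : 'rV[R]_d | `|x| <= M].
  apply: (@closed_comp _ _ (fun x : 'rV[R]_d => `|x|) [set r | r <= M]).
    by move=> x _; exact: norm_continuous.
  exact: closed_le.
suff sub : closure [set x | tfun phi (fun=> 0%N) x != 0] `<=` [set x : 'rV[R]_d | `|x| <= M].
  by exists M; split; [exact: num_real|move=> r Mr x /sub /= xM; exact: le_trans xM (ltW Mr)].
have := cb; rewrite closure_id => ->; apply: closure_subset => x /=.
move=> fx; have [k wk] : exists k, weight k x != 0.
  apply/existsP; apply: contraNT fx => /existsPn w0.
  rewrite tfun0 big1 // => k _; have := w0 k; rewrite negbK => /eqP ->; by rewrite mulr0.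
have := weight_supp wk => le; rewrite /M (bigD1 k) //=.
apply: (@le_trans _ _ (`|lpoint k| + (h + dl))).
  by rewrite -[x](subrK (lpoint k)) addrC; apply: le_trans (ler_normD _ _) _; rewrite lerD2l.
by rewrite lerDl sumr_ge0 // => j _; rewrite !addr_ge0 // ltW.
Qed.

End Lattice.

(** * Derivative bounds independent of the mesh *)

Section Jets.
Variables (R : realType) (d : nat).
Local Notation V := 'rV[R]_d.

(** [f1 x v] and [f2 x v] are the first and second derivatives of [f] along [v]. The Taylor bounds
    serve for a time step, the Lipschitz and difference bounds for replacing points and coefficients
    by their values in a cell. *)
Record jet_bounds (K : R) (f : V -> R) (f1 f2 : V -> V -> R) : Prop := JetBounds {
  jet_lip : forall x y, `|f x - f y| <= K * `|x - y|;
  jet1_le : forall x v, `|f1 x v| <= K * `|v|;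
  jet2_le : forall x v, `|f2 x v| <= K * `|v| ^+ 2;
  jet1_lip : forall x y v, `|f1 x v - f1 y v| <= K * `|x - y| * `|v|;
  jet2_lip : forall x y v, `|f2 x v - f2 y v| <= K * `|x - y| * `|v| ^+ 2;
  jet_taylor1 : forall x v, `|f (v + x) - f x - f1 x v| <= K * `|v| ^+ 2;
  jet_taylor2 : forall x v,
    `|f (v + x) + f (- v + x) - 2 * f x - f2 x v| <= 2 * (K * `|v| ^+ 3);
  jet1_dif : forall x v w, `|f1 x v - f1 x w| <= K * `|v - w|;
  jet2_dif : forall x v w, `|f2 x v - f2 x w| <= K * `|v - w| * (`|v| + `|w|)
}.

Definition scol d1 (S : 'M[R]_(d, d1)) (m : 'I_d1) : V := \row_i S i m.

Variables (dl : R) (G : nat -> R -> R).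
Hypothesis dl0 : 0 < dl.
Hypothesis Gd : forall n (s : R), is_derive s 1 (G n) (G n.+1 s).
Hypothesis G_le0 : forall s, s <= 0 -> G 0%N s = 0.
Hypothesis G_ge1 : forall s, dl <= s -> G 0%N s = 1.
Hypothesis G_supp : forall n s, s <= 0 \/ dl <= s -> G n.+1 s = 0.

Section Fixed.
Variables (h : R) (N n : nat) (phi : {ffun 'I_d -> 'I_n} -> R) (C : R).
Hypothesis C0 : 0 <= C.
Hypothesis tfC : forall a x, (forall i, a i <= 3)%N -> `|tfun G h N phi a x| <= C.
Local Notation tf := (tfun G h N phi).

Definition tf1 (x v : V) : R := \sum_i v 0 i * tf (incr (fun=> 0%N) i) x.
Definition tf2 (x v : V) : R :=
  \sum_i v 0 i * \sum_j v 0 j * tf (incr (incr (fun=> 0%N) i) j) x.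

Lemma tf1_derive x v : is_derive x v (tf (fun=> 0%N)) (tf1 x v).
Proof. exact: tfun_derive. Qed.

Lemma tf2_derive x v : is_derive x v (fun y => tf1 y v) (tf2 x v).
Proof.
apply: is_derive_bigsum => i.
have := is_deriveM (is_derive_cst (v 0 i) x v) (tfun_derive Gd h N phi (incr (fun=> 0%N) i) x v).
rewrite !fctE => D; apply: (is_derive_eq D).
by rewrite scaler0 addr0.
Qed.

Lemma sum_coord_le (v : V) (F : 'I_d -> R) (c : R) : (forall i, `|F i| <= c) ->
  `|\sum_i v 0 i * F i| <= d%:R * c * `|v|.
Proof.
move=> Fc; apply: le_trans (ler_norm_sum _ _ _) _.
apply: (@le_trans _ _ (\sum_(i < d) `|v| * c)).
  by apply: ler_sum => i _; rewrite normrM ler_pM // coord_le.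
rewrite sumr_const card_ord (_ : (`|v| * c) *+ d = d%:R * c * `|v|) //.
by rewrite -(mulr_natl (`|v| * c)); ring.
Qed.

Lemma incr_le (a : 'I_d -> nat) i (k : nat) : (forall j, a j <= k)%N -> (forall j, incr a i j <= k.+1)%N.
Proof. by move=> ak j; rewrite /incr -addn1 leq_add // leq_b1. Qed.

Lemma tf_lip a x y : (forall i, a i <= 2)%N ->
  `|tf a x - tf a y| <= d%:R * C * `|x - y|.
Proof.
move=> a2; have [t _] := line_mean_value y (fun z => tfun_derive Gd h N phi a z (x - y)).
rewrite subrK => ->; apply: sum_coord_le => i.
exact/tfC/incr_le.
Qed.

Lemma tf_jet : jet_bounds (C * (d%:R + 1) ^+ 3) (tf (fun=> 0%N)) tf1 tf2.
Proof.
(* Each sum over coordinates costs a factor [d], and at most three are nested. With [d + 1] the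
   powers increase, also for [d = 0]. *)
have dd k : (k <= 3)%N -> d%:R ^+ k * C <= C * (d%:R + 1) ^+ 3.
  move=> k3; rewrite mulrC ler_wpM2l //.
  apply: (@le_trans _ _ ((d%:R + 1) ^+ k)).
    by rewrite lerXn2r ?nnegrE // ?lerDl // addr_ge0.
  by rewrite ler_weXn2l // lerDr.
set K := C * _ in dd *.
have K1 : d%:R * C <= K by have := dd 1%N isT; rewrite expr1.
have K2 : d%:R * (d%:R * C) <= K by have := dd 2 isT; rewrite expr2 mulrA.
have K3 : d%:R * (d%:R * (d%:R * C)) <= K.
  by have := dd 3 isT; rewrite !exprS expr0 mulr1 -!mulrA.
have L1 x y v : `|tf1 x v - tf1 y v| <= K * `|x - y| * `|v|.
  rewrite /tf1 -sumrB; under eq_bigr do rewrite -mulrBr.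
  apply: (@le_trans _ _ (d%:R * (d%:R * C * `|x - y|) * `|v|)).
    by apply: sum_coord_le => i; apply: tf_lip => j; apply: leq_trans (incr_le _ _ _) _.
  apply: ler_wpM2r => //; rewrite (_ : _ * (_ * _ * _) = d%:R * (d%:R * C) * `|x - y|); last by ring.
  exact: ler_wpM2r.
have L2 x y v : `|tf2 x v - tf2 y v| <= K * `|x - y| * `|v| ^+ 2.
  rewrite /tf2 -sumrB; under eq_bigr do rewrite -mulrBr -sumrB.
  apply: (@le_trans _ _ (d%:R * (d%:R * (d%:R * C * `|x - y|) * `|v|) * `|v|)).
    apply: sum_coord_le => i; under eq_bigr do rewrite -mulrBr.
    apply: sum_coord_le => j; apply: tf_lip => l.
    by apply: (@incr_le _ _ 1) => l'; apply: (@incr_le _ _ 0).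
  rewrite expr2 (_ : d%:R * _ * _ = d%:R * (d%:R * (d%:R * C)) * (`|x - y| * (`|v| * `|v|))); last by ring.
  by rewrite -[X in _ <= X]mulrA ler_wpM2r // !mulr_ge0.
have tnorm (t : R) v : -1 <= t <= 1 -> `|t *: v| <= `|v|.
  by move=> t1; rewrite normrZ ler_piMl // ler_norml.
have shiftK (t : R) (v x : V) : t *: v + x - x = t *: v by rewrite addrK.
have C3 : 0 <= K by rewrite mulr_ge0 // exprn_ge0 // addr_ge0.
have tfK (x v w : V) : `|\sum_i v 0 i * \sum_j w 0 j * tf (incr (incr (fun=> 0%N) i) j) x| <= K * `|w| * `|v|.
  apply: (@le_trans _ _ (d%:R * (d%:R * C * `|w|) * `|v|)).
    apply: sum_coord_le => i; apply: sum_coord_le => j; apply: tfC => l.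
    apply: (@leq_trans 2) => //.
    by apply: (@incr_le _ _ 1) => l'; apply: (@incr_le _ _ 0).
  by apply: ler_wpM2r => //; rewrite mulrA; exact: ler_wpM2r.
split=> //.
- move=> x y; apply: (le_trans (tf_lip _ _ _)) => //.
  by rewrite ler_wpM2r.
- move=> x v; apply: (@le_trans _ _ (d%:R * C * `|v|)); last by rewrite ler_wpM2r.
  by apply: sum_coord_le => i; apply: tfC => j; apply: leq_trans (incr_le _ _ _) _.
- by move=> x v; rewrite expr2 [X in _ <= X]mulrA; exact: tfK.
- move=> x v; apply: (taylor1 (fun y => tf1_derive y v)) => t /andP[t0 t1].
  apply: le_trans (L1 _ _ _) _; rewrite shiftK expr2 mulrA ler_wpM2r // ler_wpM2l //.
  by apply: tnorm; rewrite t1 andbT (le_trans _ t0) // lerN10.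
- move=> x v; apply: (taylor2 (fun y => tf1_derive y v) (fun y => tf2_derive y v)) => t t1.
  apply: le_trans (L2 _ _ _) _; rewrite shiftK [X in _ <= _ * X]exprS [X in _ <= X]mulrA.
  apply: ler_wpM2r; first by rewrite exprn_ge0.
  rewrite ler_wpM2l //.
  exact: tnorm.
- move=> x v w; rewrite /tf1 -sumrB.
  rewrite (eq_bigr (fun i => (v - w) 0 i * tf (incr (fun=> 0%N) i) x)); last by move=> i _; rewrite !mxE mulrBl.
  apply: (@le_trans _ _ (d%:R * C * `|v - w|)); last by rewrite ler_wpM2r.
  by apply: sum_coord_le => i; apply: tfC => j; apply: leq_trans (incr_le _ _ _) _.
- move=> x v w; rewrite (_ : tf2 x v - tf2 x w =
    \sum_i (v - w) 0 i * (\sum_j v 0 j * tf (incr (incr (fun=> 0%N) i) j) x) +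
    \sum_i w 0 i * (\sum_j (v - w) 0 j * tf (incr (incr (fun=> 0%N) i) j) x)); last first.
    rewrite -big_split -sumrB /=; apply: eq_bigr => i _.
    rewrite (_ : \sum_j (v - w) 0 j * _ = \sum_j v 0 j * tf (incr (incr (fun=> 0%N) i) j) x
      - \sum_j w 0 j * tf (incr (incr (fun=> 0%N) i) j) x); first by rewrite !mxE; ring.
    by rewrite -sumrB; apply: eq_bigr => j _; rewrite !mxE mulrBl.
  rewrite mulrDr; apply: le_trans (ler_normD _ _) _; apply: lerD; last exact: tfK.
  by rewrite mulrAC; exact: tfK.
Qed.

(** The trace of Sigma Sigma^t D^2 f is the sum of the second derivatives of f along the columns of
    Sigma, the form that fits random moves along columns. *)
Lemma tf_Lop d1 (Sig : V -> 'M[R]_(d, d1)) (b : V -> V) x :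
  Lop Sig b (tf (fun=> 0%N)) x = \sum_m tf2 x (scol (Sig x) m) + tf1 x (b x).
Proof.
rewrite /Lop; congr (_ + _); last first.
  by apply: eq_bigr => i _; rewrite (tfun_pderiv Gd).
under eq_bigr do under eq_bigr do rewrite !(tfun_pderiv Gd) /diffA mxE mulr_suml.
under eq_bigr do rewrite exchange_big /=.
rewrite exchange_big /=; apply: eq_bigr => m _; rewrite /tf2.
rewrite exchange_big /=; apply: eq_bigr => i _; rewrite mulr_sumr.
by apply: eq_bigr => j _; rewrite !mxE; ring.
Qed.

End Fixed.

(** The order of the quantifiers matters: [K] is fixed before [h], [N], [n] and [phi], so the mesh
    can still be refined after every choice that depends on [K]. *)
Lemma lattice_jet : exists2 K, 0 <= K & forall (h : R) (N n : nat)
  (phi : {ffun 'I_d -> 'I_n} -> R), 0 < h -> (forall k, `|phi k| <= 1) ->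
  jet_bounds K (tfun G h N phi (fun=> 0%N)) (tf1 h N phi) (tf2 h N phi).
Proof.
have /choice[B BP] : forall m, exists B, forall s, `|G m s| <= B.
  by move=> m; have [B _ GB] := G_bound dl0 Gd G_le0 G_ge1 G_supp m; exists B.
have B0 m : 0 <= B m by apply: le_trans (BP m 0).
(* Derivatives of orders 0 to 3 are bounded through the next one, hence [B 1] to [B 4]. *)
pose S := 1 + (B 1%N + B 2%N + B 3%N + B 4%N) * dl.
have S1 : 1 <= S by rewrite lerDl mulr_ge0 ?addr_ge0 // ltW.
have CS : 0 <= S ^+ d by rewrite exprn_ge0 // (le_trans ler01).
exists (S ^+ d * (d%:R + 1) ^+ 3); first by rewrite mulr_ge0 // exprn_ge0 // addr_ge0.
move=> h N n phi h0 phi1; apply: tf_jet => // a x a3.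
apply: le_trans (tfun_bound dl0 Gd G_le0 G_ge1 G_supp N h0 a x phi1 BP) _.
rewrite -[X in S ^+ X]card_ord -prodr_const; apply: ler_prod => i _.
rewrite mulr_ge0 ?(ltW dl0) //=.
have := a3 i; move: (a i) => m m3.
have : B m.+1 <= B 1%N + B 2%N + B 3%N + B 4%N.
  have := B0 1%N; have := B0 2%N; have := B0 3%N; have := B0 4%N.
  by case: m m3 => [|[|[|[|]]]] //= _; lra.
by move=> le; apply: (@le_trans _ _ ((B 1%N + B 2%N + B 3%N + B 4%N) * dl)); [rewrite ler_wpM2r // ltW|rewrite lerDr].
Qed.

End Jets.

(** * The cost function *)

Section Modulus.
Variable R : realType.

(** [z] may leave the compact set: [F] is continuous everywhere, and compactness only makes the
    radius uniform. *)
Lemma compact_modulus (X Y : normedModType R) (F : X * Y -> R) (K : set (X * Y)) (th : R) :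
  compact K -> continuous F -> 0 < th ->
  exists2 r : R, 0 < r & forall p z, K p -> `|p.1 - z| <= r -> `|F p - F (z, p.2)| <= th.
Proof.
move=> /compact_near_coveringP cK cF th0.
pose P (r : R) (p : X * Y) := forall z, `|p.1 - z| <= r -> `|F p - F (z, p.2)| <= th.
suff : \forall r \near 0^'+, K `<=` P r.
  move=> H; near (0 : R)^'+ => r; exists r => // p z Kp; apply: (near H r _ p Kp) => //.
apply: cK => p0 Kp0.
have th2 : 0 < th / 2 by rewrite divr_gt0.
have nb : nbhs p0 [set q | `|F p0 - F q| <= th / 2].
  exact: (cvgr_dist_le F (F p0) (cF p0) _ th2).
have [e /= e0 He] := (nbhs_ballP _ _).1 nb.
have e2 : 0 < e / 2 by rewrite divr_gt0.
exists (ball p0 (e / 2), [set r | r < e / 2]).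
  split; first exact: nbhsx_ballx.
  exact: nbhs_right_lt.
case=> p r /= [pb re] z zp.
have b1 : ball p0 e p by apply: le_ball pb; rewrite ler_pdivrMr // ler_pMr // ler1n.
have b2 : ball p0 e (z, p.2).
  case: pb => pb1 pb2; split => /=; last by apply: le_ball pb2; rewrite ler_pdivrMr // ler_pMr // ler1n.
  rewrite [e]splitr; apply: ball_triangle pb1 _.
  by rewrite -ball_normE /=; apply: le_lt_trans re.
have := He _ b1; have := He _ b2 => /= h1 h2.
rewrite -(subrK (F p0) (F p)) -addrA [th]splitr.
apply: le_trans (ler_normD _ _) _; apply: lerD => //; by rewrite distrC.
Unshelve. all: by end_near. Qed.

Lemma compact_bound (X : topologicalType) (F : X -> R) (K : set X) :
  compact K -> continuous F -> exists2 M : R, 0 <= M & forall p, K p -> `|F p| <= M.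
Proof.
move=> cK cF; have [K0|/set0P K0] := eqVneq K set0.
  by exists 0 => // p; rewrite K0.
have [|c _ cM] := @compact_EVT_max X R (fun p => `|F p|) K K0 cK.
  apply: continuous_subspaceT => p; apply: (continuous_comp (cF p)); exact: norm_continuous.
by exists `|F c| => // p Kp; apply: cM; rewrite inE.
Qed.

End Modulus.

Section CostPackage.
Variables (R : realType) (d : nat).
Local Notation V := 'rV[R]_d.
Local Notation Z := (V * V)%type.

(** Interface to the cost used by the discrete argument; [C1 z v] and [C2 z v] are its derivatives
    along [v]. In [cost_supp] one far point is enough for vanishing. The second derivative has only
    a modulus of continuity, in contrast to the Lipschitz bound for test functions. *)
Record cost_bounds (Rad K : R) (C : Z -> R) (C1 C2 : Z -> Z -> R) : Prop := CostBounds {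
  cost_in : forall z, -1 <= C z <= 0;
  cost_supp : forall z, Rad <= `|z.1| \/ Rad <= `|z.2| ->
    [/\ C z = 0, forall v, C1 z v = 0 & forall v, C2 z v = 0];
  cost_d1 : forall v z, is_derive z v C (C1 z v);
  cost_d2 : forall v z, is_derive z v (fun z => C1 z v) (C2 z v);
  cost1_le : forall z v, `|C1 z v| <= K * `|v|;
  cost2_le : forall z v, `|C2 z v| <= K * `|v| ^+ 2;
  cost1_homog : forall z (c : R) v, C1 z (c *: v) = c * C1 z v;
  cost2_homog : forall z (c : R) v, C2 z (c *: v) = c ^+ 2 * C2 z v;
  cost_mod : forall th, 0 < th -> exists2 r, 0 < r &
    forall z z' v, `|z - z'| <= r ->
      `|C1 z v - C1 z' v| <= th * `|v| /\ `|C2 z v - C2 z' v| <= th * `|v| ^+ 2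
}.

Lemma closed_cball_compact (r : R) : compact [set x : V | `|x| <= r].
Proof.
apply: bounded_closed_compact.
  by exists r; split; [exact: num_real|move=> t rt x /= xr; exact: le_trans xr (ltW rt)].
apply: (@closed_comp _ _ (fun x : V => `|x|) [set s | s <= r]).
  by move=> x _; exact: norm_continuous.
exact: closed_le.
Qed.

Lemma pair_cball_compact (r : R) : compact [set z : Z | `|z| <= r].
Proof.
have -> : [set z : Z | `|z| <= r] = [set x : V | `|x| <= r] `*` [set x : V | `|x| <= r].
  by apply/seteqP; split=> z /=; rewrite prod_normE ge_max => /andP.
by apply: compact_setX; exact: closed_cball_compact.
Qed.

Lemma homog_bounds (Rad : R) (F : Z -> Z -> R) (m : nat) :
  continuous (fun p : Z * Z => F p.1 p.2) ->
  (forall z (c : R) v, F z (c *: v) = c ^+ m * F z v) ->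
  (forall z v, Rad <= `|z.1| \/ Rad <= `|z.2| -> F z v = 0) ->
  (exists2 K, 0 <= K & forall z v, `|F z v| <= K * `|v| ^+ m) /\
  (forall th, 0 < th -> exists2 r, 0 < r &
    forall z z' v, `|z - z'| <= r -> `|F z v - F z' v| <= th * `|v| ^+ m).
Proof.
move=> cF hF sF.
(* The margin 1 ensures that if [z] lies beyond it and [z'] is within 1 of [z], then [F] vanishes at
   both. *)
pose K := [set z : Z | `|z| <= `|Rad| + 1] `*` [set v : Z | `|v| <= 1].
have cK : compact K by apply: compact_setX; exact: pair_cball_compact.
have far z v : `|Rad| <= `|z| -> F z v = 0.
  move=> h; apply: sF; move: h; rewrite prod_normE le_max => /orP[] h; [left|right].
    exact: le_trans (ler_norm _) h.
  exact: le_trans (ler_norm _) h.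
(* Homogeneity reduces all directions to the unit ball; [v = 0] is reached as 0 times itself. *)
have unit (P : Z -> R -> Prop) : (forall v, `|v| <= 1 -> P v 1) ->
    (forall c w, 0 <= c -> P w 1 -> P (c *: w) (c ^+ m)) -> forall v, P v (`|v| ^+ m).
  move=> P1 P2 v; have [v0|v0] := eqVneq `|v| 0.
    have /P1/(P2 0 _ (lexx 0)) : `|0 : Z| <= 1 by rewrite normr0.
    by rewrite scale0r v0; move/eqP: v0; rewrite normr_eq0 => /eqP ->.
  have -> : v = `|v| *: (`|v|^-1 *: v) by rewrite scalerA mulfV // scale1r.
  rewrite normrZ normr_id [`|_ *: v|]normrZ normfV normr_id mulVf // mulr1.
  by apply: P2 => //; apply: P1; rewrite normrZ normfV normr_id mulVf.
split.
  have [M M0 MF] := compact_bound cK cF; exists M => // z.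
  apply: (unit (fun v (c : R) => `|F z v| <= M * c)).
    move=> v v1; rewrite mulr1; have [zR|zR] := leP `|z| (`|Rad| + 1).
      exact: (MF (z, v)).
    by rewrite far ?normr0 // (le_trans _ (ltW zR)) // lerDl.
  move=> c w c0; rewrite mulr1 hF normrM ger0_norm ?exprn_ge0 // => h.
  by rewrite [M * _]mulrC ler_wpM2l ?exprn_ge0.
move=> th th0; have [r r0 rF] := compact_modulus cK cF th0.
exists (Num.min r 1); first by rewrite lt_min r0 ltr01.
move=> z z' v; rewrite le_min => /andP[zr z1].
move: v; apply: (unit (fun v (c : R) => `|F z v - F z' v| <= th * c)).
  move=> v v1; rewrite mulr1; have [zR|zR] := leP `|z| (`|Rad| + 1).
    exact: (rF (z, v) z').
  rewrite !far ?subrr ?normr0 ?(ltW th0) //.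
    have := lerB_dist z z'; lra.
  by rewrite (le_trans _ (ltW zR)) // lerDl.
move=> c w c0; rewrite mulr1 !hF -mulrBr normrM ger0_norm ?exprn_ge0 // => h.
by rewrite [th * _]mulrC ler_wpM2l ?exprn_ge0.
Qed.

Lemma cost_package (Rad : R) (C : Z -> R) (C1 C2 : Z -> Z -> R) :
  (forall z, -1 <= C z <= 0) ->
  (forall z, Rad <= `|z.1| \/ Rad <= `|z.2| ->
    [/\ C z = 0, forall v, C1 z v = 0 & forall v, C2 z v = 0]) ->
  (forall v z, is_derive z v C (C1 z v)) ->
  (forall v z, is_derive z v (fun z => C1 z v) (C2 z v)) ->
  continuous (fun p : Z * Z => C1 p.1 p.2) -> continuous (fun p : Z * Z => C2 p.1 p.2) ->
  (forall z (c : R) v, C1 z (c *: v) = c * C1 z v) ->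
  (forall z (c : R) v, C2 z (c *: v) = c ^+ 2 * C2 z v) ->
  exists2 K, 0 <= K & cost_bounds Rad K C C1 C2.
Proof.
move=> Cin Cs d1 d2 c1 c2 h1 h2.
have [|| [K1 K10 K1C] m1] := @homog_bounds Rad C1 1 c1.
- by move=> z c v; rewrite expr1.
- by move=> z v /Cs[].
have [| [K2 K20 K2C] m2] := @homog_bounds Rad C2 2 c2 h2.
  by move=> z v /Cs[].
exists (K1 + K2); first exact: addr_ge0.
split=> //.
- by move=> z v; apply: le_trans (K1C z v) _; rewrite expr1 ler_wpM2r // lerDl.
- by move=> z v; apply: le_trans (K2C z v) _; rewrite ler_wpM2r ?exprn_ge0 // lerDr.
- move=> th th0; have [r1 r10 H1] := m1 th th0; have [r2 r20 H2] := m2 th th0.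
  exists (Num.min r1 r2); first by rewrite lt_min r10.
  move=> z z' v; rewrite le_min => /andP[zr1 zr2]; split; last exact: H2.
  by have := H1 z z' v zr1; rewrite expr1.
Qed.

Section CostUse.
Variables (Rad K : R) (C : Z -> R) (C1 C2 : Z -> Z -> R).
Hypothesis HC : cost_bounds Rad K C C1 C2.

Lemma cost_lip z z' : `|C z - C z'| <= K * `|z - z'|.
Proof.
have [t _] := line_mean_value z' (cost_d1 HC (z - z')).
by rewrite subrK => ->; exact: (cost1_le HC).
Qed.

End CostUse.
End CostPackage.

(** * Powers of the positive part *)

Section PosPart.
Variable R : realType.

Definition ppow (n : nat) (s : R) : R := Num.max 0 s ^+ n.

Lemma ppow_derive n (s : R) : is_derive s 1 (ppow n.+2) (n.+2%:R * ppow n.+1 s).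
Proof.
have nl (r : R) (t : R) : s < t -> \forall x \near s, x < t.
  by move=> st; exact: (@cvgr_lt _ _ _ _ id s (@cvg_id _ (nbhs s))).
case: (ltgtP s 0) => s0.
- rewrite /ppow (_ : Num.max 0 s = 0) ?expr0n ?mulr0; last by rewrite max_l // ltW.
  apply: (@near_eq_is_derive _ _ _ (cst 0)) (is_derive_cst _ _ _).
  near=> t; rewrite /= max_l ?expr0n // ltW //; near: t; exact: nl.
- rewrite /ppow (_ : Num.max 0 s = s); last by rewrite max_r // ltW.
  have := is_deriveX n.+2 (is_derive_id s (1 : R)).
  rewrite /= /GRing.scale /= mulr1; apply: near_eq_is_derive.
  near=> t; rewrite exprfctE /= max_r // ltW //; near: t.
  exact: (@cvgr_gt _ _ _ _ id s (@cvg_id _ (nbhs s))).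
- rewrite s0 /ppow maxxx expr0n /= mulr0.
  apply: (@is_derive_quad _ _ _ 1); first by rewrite maxxx expr0n.
  near=> t; rewrite subr0 mul1r normrX -[t ^+ 2]real_normK ?num_real //.
  have t1 : `|t| <= 1.
    have : `|0 - t| <= 1 by near: t; exact: near_dist_le.
    by rewrite sub0r normrN.
  have h : `|Num.max 0 t| <= `|t|.
    by have [a|a] := leP 0 t; rewrite ?max_r // ?normr0.
  apply: (@le_trans _ _ (`|t| ^+ n.+2)); first by rewrite lerXn2r // nnegrE.
  by rewrite ler_wiXn2l.
Unshelve. all: by end_near. Qed.

Lemma ppow_continuous n : continuous (ppow n).
Proof.
move=> s; rewrite (_ : ppow n = (fun t : R => t ^+ n) \o (fun s => Num.max 0 s)) //.
apply: continuous_comp; last exact: exprn_continuous.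
by apply: continuous_max; [exact: cst_continuous | exact: cvg_id].
Qed.

Lemma ppow_ge0 n s : 0 <= ppow n s.
Proof. by rewrite exprn_ge0 // le_max lexx. Qed.

End PosPart.

Section Cost.
Variables (R : realType) (d : nat) (eps Lam0 kap M : R).
Hypotheses (eps0 : 0 < eps) (Lam00 : 0 < Lam0) (kap0 : 0 < kap) (M0 : 0 < M).
Local Notation V := 'rV[R]_d.
Local Notation Z := (V * V)%type.

(* The cost is [cP (cu (x, y))], where [cu] is [cA] of the squared distance rho
   plus [kap] times the Lyapunov functions [cB] of the squared norms.  With
   l = [lep rho], the generator of [cA] is about 2 ((1 + l) q - 2 l r) / (Lam0 rho)
   for rho much larger than [eps], which is where q < 2 r enters. *)
Definition lep (s : R) : R := ln (1 + s / eps).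
Definition cA (s : R) : R := (1 + lep s) ^+ 2 / (2 * Lam0).
Definition cA1 (s : R) : R := (1 + lep s) / ((s + eps) * Lam0).
Definition cA2 (s : R) : R := - (lep s / ((s + eps) ^+ 2 * Lam0)).
Definition cB (s : R) : R := ln (1 + s).
Definition cB1 (s : R) : R := (1 + s)^-1.
Definition cB2 (s : R) : R := - (1 + s) ^- 2.
(** The cube has two continuous derivatives at the cut [s = M]. On nonnegative arguments the values
    lie between -1 and 0, and the function is nondecreasing and concave. *)
Definition cP (s : R) : R := - ppow 3 (1 - s / M).
Definition cP1 (s : R) : R := 3 / M * ppow 2 (1 - s / M).
Definition cP2 (s : R) : R := - (6 / M ^+ 2 * ppow 1 (1 - s / M)).

Lemma lep_derive (s : R) : 0 <= s -> is_derive s 1 lep (s + eps)^-1.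
Proof.
move=> s0; have p : 0 < 1 + s / eps by rewrite ltr_wpDr // divr_ge0 // ltW.
have ad : is_derive s 1 (fun s : R => 1 + s / eps) (eps^-1).
  have := is_deriveD (is_derive_cst (1 : R) s 1)
     (is_deriveM (is_derive_id s (1 : R)) (is_derive_cst eps^-1 s 1)).
  rewrite !fctE => D; apply: (is_derive_eq D).
  by rewrite /GRing.scale /=; ring.
have := is_derive_comp ad (is_derive1_ln p).
move=> D; apply: (is_derive_eq D); rewrite -invfM; congr (_^-1).
by rewrite mulrDl mul1r divfK ?gt_eqF // addrC.
Qed.

Lemma cA_derive (s : R) : 0 <= s -> is_derive s 1 cA (cA1 s).
Proof.
move=> s0; have sp : 0 < s + eps by rewrite ltr_wpDl.
have := is_deriveM (is_deriveX 2 (is_deriveD (is_derive_cst (1 : R) s 1) (lep_derive s0)))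
    (is_derive_cst (2 * Lam0)^-1 s 1).
rewrite !exprfctE !fctE => D; apply: (is_derive_eq D).
rewrite /GRing.scale /= /cA1 expr1; field.
by rewrite !gt_eqF.
Qed.

Lemma sDeps_inv (s : R) : 0 <= s -> is_derive s 1 (fun s : R => (s + eps)^-1) (- (s + eps) ^- 2).
Proof.
move=> s0; have sp : s + eps != 0 by rewrite gt_eqF // ltr_wpDl.
have := @is_deriveV _ (fun s => s + eps) s _ 1 sp
  (is_deriveD (is_derive_id s (1 : R)) (is_derive_cst eps s 1)).
by move=> D; apply: (is_derive_eq D); rewrite /GRing.scale /=; ring.
Qed.

Lemma cA1_derive (s : R) : 0 <= s -> is_derive s 1 cA1 (cA2 s).
Proof.
move=> s0; have sp : 0 < s + eps by rewrite ltr_wpDl.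
have := is_deriveM (is_deriveM (is_deriveD (is_derive_cst (1 : R) s 1) (lep_derive s0))
   (sDeps_inv s0)) (is_derive_cst Lam0^-1 s 1).
rewrite !fctE => D.
rewrite (_ : cA1 = (fun s => (1 + lep s) * (s + eps)^-1 * Lam0^-1)); last first.
  by apply/funext => t; rewrite /cA1 invfM mulrA.
apply: (is_derive_eq D).
rewrite /GRing.scale /= /cA2; field.
by rewrite !gt_eqF.
Qed.

Lemma cB_derive (s : R) : 0 <= s -> is_derive s 1 cB (cB1 s).
Proof.
move=> s0; have p : 0 < 1 + s by rewrite ltr_wpDr.
have := is_derive_comp (is_deriveD (is_derive_cst (1 : R) s 1) (is_derive_id s (1 : R)))
  (is_derive1_ln p).
by move=> D; apply: (is_derive_eq D); rewrite add0r mulr1.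
Qed.

Lemma cB1_derive (s : R) : 0 <= s -> is_derive s 1 cB1 (cB2 s).
Proof.
move=> s0; have sp : 1 + s != 0 by rewrite gt_eqF // ltr_wpDr.
have := @is_deriveV _ (fun s => 1 + s) s _ 1 sp
  (is_deriveD (is_derive_cst (1 : R) s 1) (is_derive_id s (1 : R))).
by move=> D; apply: (is_derive_eq D); rewrite /GRing.scale /= /cB2; ring.
Qed.

Let aff_derive (s : R) : is_derive s 1 (fun s : R => 1 - s / M) (- M^-1).
Proof.
have := is_deriveB (is_derive_cst (1 : R) s 1)
     (is_deriveM (is_derive_id s (1 : R)) (is_derive_cst M^-1 s 1)).
rewrite !fctE => D; apply: (is_derive_eq D).
by rewrite /GRing.scale /=; ring.
Qed.

Lemma cP_derive (s : R) : is_derive s 1 cP (cP1 s).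
Proof.
have := is_deriveN (is_derive_comp (aff_derive s) (ppow_derive 1 _)).
by move=> D; apply: (is_derive_eq D); rewrite /cP1; ring.
Qed.

Lemma cP1_derive (s : R) : is_derive s 1 cP1 (cP2 s).
Proof.
have := is_deriveM (is_derive_cst (3 / M) s 1)
   (is_derive_comp (aff_derive s) (ppow_derive 0 _)).
rewrite !fctE => D; apply: (is_derive_eq D).
rewrite /GRing.scale /= /cP2; field.
by rewrite gt_eqF.
Qed.

Lemma lep_ge0 (s : R) : 0 <= s -> 0 <= lep s.
Proof. by move=> s0; rewrite ln_ge0 // lerDl divr_ge0 // ltW. Qed.

Lemma cA_ge0 (s : R) : 0 <= cA s.
Proof. by rewrite divr_ge0 ?sqr_ge0 // mulr_ge0 // ltW. Qed.

Lemma dotvD n (u v w : 'rV[R]_n) : dotv u (v + w) = dotv u v + dotv u w.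
Proof. by rewrite /dotv -big_split; apply: eq_bigr => i _; rewrite mxE mulrDr. Qed.

Lemma dotvC n (u v : 'rV[R]_n) : dotv u v = dotv v u.
Proof. by apply: eq_bigr => i _; rewrite mulrC. Qed.

Lemma dotvZ n (c : R) (u v : 'rV[R]_n) : dotv u (c *: v) = c * dotv u v.
Proof. by rewrite /dotv mulr_sumr; apply: eq_bigr => i _; rewrite mxE mulrCA. Qed.

Lemma dotv_ge0 n (u : 'rV[R]_n) : 0 <= dotv u u.
Proof. by apply: sumr_ge0 => i _; rewrite -expr2 sqr_ge0. Qed.

Lemma dotv_continuous (T : topologicalType) n (f g : T -> 'rV[R]_n) t :
  {for t, continuous f} -> {for t, continuous g} ->
  {for t, continuous (fun t => dotv (f t) (g t))}.
Proof.
move=> cf cg; apply: (cvg_big add_continuous (nbhs_filter t)) => i _.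
apply: cvgM.
  exact: (continuous_comp cf (@coord_continuous _ _ _ 0 i (f t))).
exact: (continuous_comp cg (@coord_continuous _ _ _ 0 i (g t))).
Qed.

Section Quad.
Variable l : Z -> V.
Hypothesis ll : forall (c : R) v z, l (c *: v + z) = c *: l v + l z.

Definition qd0 z := dotv (l z) (l z).
Definition qd1 z v := 2 * dotv (l z) (l v).
Definition qd2 (v : Z) := 2 * dotv (l v) (l v).

Lemma qd0_ge0 z : 0 <= qd0 z. Proof. exact: dotv_ge0. Qed.

Lemma qd0_derive v z : is_derive z v qd0 (qd1 z v).
Proof.
apply/is_derive_line.
rewrite (_ : (fun h : R => _) = (fun h => h ^+ 2 * dotv (l v) (l v) + h * qd1 z v + qd0 z)); last first.
  apply/funext => h; rewrite /qd0 ll dotvD !dotvZ ![dotv (_ + _) _]dotvC !dotvD !dotvZ /qd1.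
  by rewrite (dotvC (l z) (l v)); ring.
have id := is_derive_id (0 : R) (1 : R).
have := is_deriveD (is_deriveD (is_deriveM (is_deriveX 2 id) (is_derive_cst (dotv (l v) (l v)) (0 : R) 1))
   (is_deriveM id (is_derive_cst (qd1 z v) (0 : R) 1))) (is_derive_cst (qd0 z) (0 : R) (1 : R)).
rewrite !exprfctE !fctE => D; apply: (is_derive_eq D).
by rewrite /GRing.scale /=; ring.
Qed.

Lemma qd1_derive v z : is_derive z v (fun z => qd1 z v) (qd2 v).
Proof.
apply/is_derive_line.
rewrite (_ : (fun h : R => _) = (fun h => h * qd2 v + qd1 z v)); last first.
  by apply/funext => h; rewrite /qd1 ll dotvC dotvD !dotvZ /qd2 (dotvC (l v) (l z)); ring.
have id := is_derive_id (0 : R) (1 : R).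
have := is_deriveD (is_deriveM id (is_derive_cst (qd2 v) (0 : R) 1)) (is_derive_cst (qd1 z v) (0 : R) (1 : R)).
rewrite !fctE => D; apply: (is_derive_eq D).
by rewrite /GRing.scale /=; ring.
Qed.

Variables (g g1 g2 : R -> R).
Hypothesis gd : forall s : R, 0 <= s -> is_derive s 1 g (g1 s).
Hypothesis g1d : forall s : R, 0 <= s -> is_derive s 1 g1 (g2 s).

Definition gq1 z v := g1 (qd0 z) * qd1 z v.
Definition gq2 z v := g2 (qd0 z) * qd1 z v ^+ 2 + g1 (qd0 z) * qd2 v.

Lemma gq_derive v z : is_derive z v (fun z => g (qd0 z)) (gq1 z v).
Proof. exact: is_derive_comp (qd0_derive v z) (gd (qd0_ge0 z)). Qed.

Lemma gq1_derive v z : is_derive z v (fun z => gq1 z v) (gq2 z v).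
Proof.
have := is_deriveM (is_derive_comp (qd0_derive v z) (g1d (qd0_ge0 z))) (qd1_derive v z).
rewrite !fctE => D; apply: (is_derive_eq D).
by rewrite /GRing.scale /= /gq2; ring.
Qed.

Hypothesis lc : continuous l.

Let lc1 (p : Z * Z) : {for p, continuous (fun p : Z * Z => l p.1)}.
Proof. by apply: continuous_comp; [exact: cvg_fst|exact: lc]. Qed.
Let lc2 (p : Z * Z) : {for p, continuous (fun p : Z * Z => l p.2)}.
Proof. by apply: continuous_comp; [exact: cvg_snd|exact: lc]. Qed.

Hypothesis g2c : forall s : R, 0 <= s -> {for s, continuous g2}.

Let two (p : Z * Z) : {for p, continuous (fun _ : Z * Z => 2 : R)}.
Proof. exact: cst_continuous. Qed.

Let q0c p : {for p, continuous (fun p : Z * Z => qd0 p.1)}.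
Proof. exact: (dotv_continuous (lc1 (p := p)) (lc1 (p := p))). Qed.
Let q1c p : {for p, continuous (fun p : Z * Z => qd1 p.1 p.2)}.
Proof. exact: (continuousM (two (p := p)) (dotv_continuous (lc1 (p := p)) (lc2 (p := p)))). Qed.
Let q2c p : {for p, continuous (fun p : Z * Z => qd2 p.2)}.
Proof. exact: (continuousM (two (p := p)) (dotv_continuous (lc2 (p := p)) (lc2 (p := p)))). Qed.

Lemma gq0_continuous p : {for p, continuous (fun p : Z * Z => g (qd0 p.1))}.
Proof.
apply: (@continuous_comp _ _ _ (fun p : Z * Z => qd0 p.1) g); first exact: q0c.
exact: is_derive_continuous (gd (qd0_ge0 _)).
Qed.
Let g1q p : {for p, continuous (fun p : Z * Z => g1 (qd0 p.1))}.
Proof.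
apply: (@continuous_comp _ _ _ (fun p : Z * Z => qd0 p.1) g1); first exact: q0c.
exact: is_derive_continuous (g1d (qd0_ge0 _)).
Qed.
Let g2q p : {for p, continuous (fun p : Z * Z => g2 (qd0 p.1))}.
Proof.
apply: (@continuous_comp _ _ _ (fun p : Z * Z => qd0 p.1) g2); first exact: q0c.
exact: g2c (qd0_ge0 _).
Qed.

Lemma gq1_continuous p : {for p, continuous (fun p : Z * Z => gq1 p.1 p.2)}.
Proof. by apply: continuousM; [exact: g1q|exact: q1c]. Qed.

Lemma gq2_continuous p : {for p, continuous (fun p : Z * Z => gq2 p.1 p.2)}.
Proof.
apply: continuousD; apply: continuousM; [exact: g2q| |exact: g1q|exact: q2c].
by apply: continuousM; exact: q1c.
Qed.

Lemma gq1_homog z (c : R) v : gq1 z (c *: v) = c * gq1 z v.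
Proof.
have l0 : l 0 = 0.
  by have := ll 1 0 0; rewrite scaler0 addr0 scale1r => /eqP; rewrite addrC -subr_eq subrr eq_sym => /eqP.
by rewrite /gq1 /qd1 -[c *: v]addr0 ll l0 addr0 dotvZ; ring.
Qed.

Lemma gq2_homog z (c : R) v : gq2 z (c *: v) = c ^+ 2 * gq2 z v.
Proof.
have l0 : l 0 = 0.
  by have := ll 1 0 0; rewrite scaler0 addr0 scale1r => /eqP; rewrite addrC -subr_eq subrr eq_sym => /eqP.
rewrite /gq2 /qd1 /qd2 -[c *: v]addr0 ll l0 addr0 !dotvZ (dotvC (c *: l v) (l v)) !dotvZ; ring.
Qed.

End Quad.

Local Notation ld := (fun z : Z => z.1 - z.2).
Local Notation lf := (fun z : Z => z.1).
Local Notation ls := (fun z : Z => z.2).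

Let ldl (c : R) (v z : Z) : ld (c *: v + z) = c *: ld v + ld z.
Proof. by rewrite /= scalerBr opprD !addrA; congr (_ + _); rewrite addrAC. Qed.
Let lfl (c : R) (v z : Z) : lf (c *: v + z) = c *: lf v + lf z. Proof. by []. Qed.
Let lsl (c : R) (v z : Z) : ls (c *: v + z) = c *: ls v + ls z. Proof. by []. Qed.
Let lfc : continuous lf. Proof. by move=> z; exact: cvg_fst. Qed.
Let lsc : continuous ls. Proof. by move=> z; exact: cvg_snd. Qed.
Let ldc : continuous ld. Proof. by move=> z; apply: continuousB; [exact: lfc|exact: lsc]. Qed.

Let cA2c (s : R) : 0 <= s -> {for s, continuous cA2}.
Proof.
move=> s0; rewrite (_ : cA2 = (fun s => - (lep s * ((s + eps)^-1 * (s + eps)^-1) * Lam0^-1))); last first.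
  by apply/funext => t; rewrite /cA2 expr2 !invfM !mulrA.
have c1 := is_derive_continuous (lep_derive s0).
have c2 := is_derive_continuous (sDeps_inv s0).
apply: continuousN; apply: continuousM; last exact: cst_continuous.
by apply: continuousM; [exact: c1|apply: continuousM; exact: c2].
Qed.

Let cB2c (s : R) : 0 <= s -> {for s, continuous cB2}.
Proof.
move=> s0; rewrite (_ : cB2 = (fun s => - (cB1 s * cB1 s))); last first.
  by apply/funext => t; rewrite /cB2 /cB1 -invfM -expr2.
have c1 := is_derive_continuous (cB1_derive s0).
by apply: continuousN; apply: continuousM; exact: c1.
Qed.

Definition cu (z : Z) : R := cA (qd0 ld z) + kap * (cB (qd0 lf z) + cB (qd0 ls z)).
Definition cu1 (z v : Z) : R :=
  gq1 ld cA1 z v + kap * (gq1 lf cB1 z v + gq1 ls cB1 z v).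
Definition cu2 (z v : Z) : R :=
  gq2 ld cA1 cA2 z v + kap * (gq2 lf cB1 cB2 z v + gq2 ls cB1 cB2 z v).

Definition cost z := cP (cu z).
Definition cost1 z v := cP1 (cu z) * cu1 z v.
Definition cost2 z v := cP2 (cu z) * cu1 z v ^+ 2 + cP1 (cu z) * cu2 z v.

Lemma cu_derive v z : is_derive z v cu (cu1 z v).
Proof.
have a := gq_derive ldl cA_derive v z.
have f := gq_derive lfl cB_derive v z.
have s := gq_derive lsl cB_derive v z.
have := is_deriveD a (is_deriveM (is_derive_cst kap z v) (is_deriveD f s)).
rewrite !fctE => D; apply: (is_derive_eq D).
by rewrite /GRing.scale /= mulr0 addr0.
Qed.

Lemma cu1_derive v z : is_derive z v (fun z => cu1 z v) (cu2 z v).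
Proof.
have a := gq1_derive ldl cA1_derive v z.
have f := gq1_derive lfl cB1_derive v z.
have s := gq1_derive lsl cB1_derive v z.
have := is_deriveD a (is_deriveM (is_derive_cst kap z v) (is_deriveD f s)).
rewrite !fctE => D; apply: (is_derive_eq D).
by rewrite /GRing.scale /= mulr0 addr0.
Qed.

Lemma cu_ge0 z : 0 <= cu z.
Proof.
have b l : 0 <= cB (qd0 l z) by rewrite ln_ge0 // lerDl qd0_ge0.
by rewrite addr_ge0 ?cA_ge0 // mulr_ge0 ?addr_ge0 // ltW.
Qed.

Lemma cost_derive v z : is_derive z v cost (cost1 z v).
Proof. exact: is_derive_comp (cu_derive v z) (cP_derive (cu z)). Qed.

Lemma cost1_derive v z : is_derive z v (fun z => cost1 z v) (cost2 z v).
Proof.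
have := is_deriveM (is_derive_comp (cu_derive v z) (cP1_derive (cu z))) (cu1_derive v z).
rewrite !fctE => D; apply: (is_derive_eq D).
by rewrite /GRing.scale /= /cost2; ring.
Qed.

Let cu_cont (p : Z * Z) : {for p, continuous (fun p : Z * Z => cu p.1)}.
Proof.
have a := gq0_continuous cA_derive ldc (p:=p).
have f := gq0_continuous cB_derive lfc (p:=p).
have s := gq0_continuous cB_derive lsc (p:=p).
apply: continuousD; first exact: a.
by apply: continuousM; [exact: cst_continuous|apply: continuousD; [exact: f|exact: s]].
Qed.

Let cu1_cont (p : Z * Z) : {for p, continuous (fun p : Z * Z => cu1 p.1 p.2)}.
Proof.
have a := gq1_continuous cA1_derive ldc (p:=p).
have f := gq1_continuous cB1_derive lfc (p:=p).
have s := gq1_continuous cB1_derive lsc (p:=p).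
apply: continuousD; first exact: a.
by apply: continuousM; [exact: cst_continuous|apply: continuousD; [exact: f|exact: s]].
Qed.

Let cu2_cont (p : Z * Z) : {for p, continuous (fun p : Z * Z => cu2 p.1 p.2)}.
Proof.
have a := gq2_continuous cA1_derive ldc cA2c (p:=p).
have f := gq2_continuous cB1_derive lfc cB2c (p:=p).
have s := gq2_continuous cB1_derive lsc cB2c (p:=p).
apply: continuousD; first exact: a.
by apply: continuousM; [exact: cst_continuous|apply: continuousD; [exact: f|exact: s]].
Qed.

Let cP1_cont (p : Z * Z) : {for p, continuous (fun p : Z * Z => cP1 (cu p.1))}.
Proof.
apply: (@continuous_comp _ _ _ (fun p : Z * Z => cu p.1) cP1); first exact: cu_cont.
exact: is_derive_continuous (cP1_derive _).
Qed.

Let cP2_cont (p : Z * Z) : {for p, continuous (fun p : Z * Z => cP2 (cu p.1))}.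
Proof.
apply: (@continuous_comp _ _ _ (fun p : Z * Z => cu p.1) cP2); first exact: cu_cont.
apply: continuousN; apply: continuousM; first exact: cst_continuous.
exact: (continuous_comp (is_derive_continuous (aff_derive _)) (@ppow_continuous _ 1 _)).
Qed.

Lemma cost1_continuous : continuous (fun p : Z * Z => cost1 p.1 p.2).
Proof. by move=> p; exact: (continuousM (@cP1_cont p) (@cu1_cont p)). Qed.

Lemma cost2_continuous : continuous (fun p : Z * Z => cost2 p.1 p.2).
Proof.
move=> p; have c := @cu1_cont p.
exact: (continuousD (continuousM (@cP2_cont p) (continuousM c c))
  (continuousM (@cP1_cont p) (@cu2_cont p))).
Qed.

Lemma sq_norm_le (x : V) : `|x| ^+ 2 <= dotv x x.
Proof.
have dx0 := dotv_ge0 x.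
rewrite -[leRHS]sqr_sqrtr // lerXn2r ?nnegrE ?sqrtr_ge0 //.
apply: rv_norm_le; first exact: sqrtr_ge0.
move=> i; rewrite -sqrtr_sqr ler_wsqrtr // /dotv (bigD1 i) //= expr2 lerDl.
by apply: sumr_ge0 => j _; rewrite -expr2 sqr_ge0.
Qed.

Lemma cost_pack : exists Rad K, [/\ 0 <= Rad, 0 <= K & cost_bounds Rad K cost cost1 cost2].
Proof.
(* From this radius on [kap * ln (1 + |x| ^ 2)] is at least [M], so the truncation makes the cost
   vanish. As [Rad >= 1], [Rad] is at most its square. *)
pose Rad := expR (M / kap); exists Rad.
have Rad0 : 0 < Rad by exact: expR_gt0.
have Rad1 : 1 <= Rad.
  by rewrite -expR0 ler_expR divr_ge0 ?ltW.
have big (x : V) : Rad <= `|x| -> M <= kap * cB (dotv x x).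
  move=> xR; rewrite -ler_pdivrMl // mulrC -ler_expR lnK ?posrE; last first.
    by rewrite ltr_wpDr // dotv_ge0.
  apply: (@le_trans _ _ (Rad ^+ 2)); first by rewrite -/Rad expr2 ler_peMl // ltW.
  apply: (@le_trans _ _ (`|x| ^+ 2)); first by rewrite lerXn2r // nnegrE // ltW.
  by apply: (le_trans (sq_norm_le x)); rewrite lerDr.
have uM z : Rad <= `|z.1| \/ Rad <= `|z.2| -> forall n, ppow n.+1 (1 - cu z / M) = 0.
  move=> zR n; suff le : M <= cu z.
    by rewrite /ppow max_l ?expr0n // subr_le0 ler_pdivlMr // mul1r.
  have a0 := cA_ge0 (qd0 ld z).
  have f0 : 0 <= kap * cB (qd0 lf z) by rewrite mulr_ge0 ?(ltW kap0) // ln_ge0 // lerDl qd0_ge0.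
  have s0 : 0 <= kap * cB (qd0 ls z) by rewrite mulr_ge0 ?(ltW kap0) // ln_ge0 // lerDl qd0_ge0.
  rewrite /cu mulrDr; case: zR => /big; rewrite /qd0 in a0 f0 s0 *; lra.
have [||||||||K K0 HK] := @cost_package R d Rad cost cost1 cost2; last first.
  by exists K; split=> //; exact: ltW.
- move=> z c v; rewrite /cost2 /cu1 /cu2.
  by rewrite !(gq1_homog ldl, gq1_homog lfl, gq1_homog lsl,
    gq2_homog ldl, gq2_homog lfl, gq2_homog lsl); ring.
- move=> z c v; rewrite /cost1 /cu1.
  by rewrite !(gq1_homog ldl, gq1_homog lfl, gq1_homog lsl); ring.
- exact: cost2_continuous.
- exact: cost1_continuous.
- exact: cost1_derive.
- exact: cost_derive.
- move=> z /uM z0; split.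
  + by rewrite /cost /cP z0 oppr0.
  + by move=> v; rewrite /cost1 /cP1 z0 mulr0 mul0r.
  + by move=> v; rewrite /cost2 /cP2 /cP1 !z0 !mulr0 oppr0 !mul0r addr0.
- move=> z; rewrite /cost /cP oppr_le0 ppow_ge0 andbT lerN2.
  rewrite /ppow exprn_ile1 ?le_max ?lexx // ge_max ler01 /=.
  by rewrite gerBl divr_ge0 ?cu_ge0 // ltW.
Qed.

End Cost.

(** * Coupling discretised solutions *)

Lemma small_real (R : realFieldType) (s : seq R) :
  (forall a, a \in s -> 0 < a) -> exists2 c : R, 0 < c & forall a, a \in s -> c <= a.
Proof.
elim: s => [|a s ih] sp; first by exists 1.
have [|c c0 cs] := ih; first by move=> b bs; apply: sp; rewrite inE bs orbT.
exists (Num.min a c); first by rewrite lt_min c0 sp // mem_head.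
move=> b; rewrite inE => /orP[/eqP->|/cs h]; first by rewrite ge_min lexx.
by rewrite ge_min h orbT.
Qed.

(** * Rounding to the mesh and moves between lattice points *)

Section Mesh.
Variables (R : realType) (d : nat) (h : R).
Hypothesis h0 : 0 < h.
Local Notation V := 'rV[R]_d.
Implicit Types u v p : V.

Definition on_mesh (p : V) := forall i, exists z : int, p 0 i = h * z%:~R.

Definition mesh_round (v : V) : V := \row_i (h * (Num.floor (v 0 i / h))%:~R).

Lemma mesh_round_mesh v : on_mesh (mesh_round v).
Proof. by move=> i; exists (Num.floor (v 0 i / h)); rewrite mxE. Qed.

Lemma mesh_round_le v : `|mesh_round v - v| <= h.
Proof.
apply: rv_norm_le; first exact: ltW.
move=> i; rewrite !mxE; set s := v 0 i.
have -> : h * (Num.floor (s / h))%:~R - s = h * ((Num.floor (s / h))%:~R - s / h).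
  by rewrite mulrBr mulrCA mulfV ?gt_eqF // mulr1.
rewrite normrM gtr0_norm // -[leRHS]mulr1 ler_wpM2l ?(ltW h0) //.
have f1 := ge_floor (s / h); have f2 := floorD1_gt (s / h).
rewrite intrD in f2; rewrite ler_norml; apply/andP; split; lra.
Qed.

Lemma on_meshB p v : on_mesh p -> on_mesh v -> on_mesh (p - v).
Proof.
by move=> mp mv i; have [a ea] := mp i; have [b eb] := mv i; exists (a - b); rewrite !mxE ea eb -mulrBr -rmorphB.
Qed.

Lemma on_meshD p v : on_mesh p -> on_mesh v -> on_mesh (p + v).
Proof.
by move=> mp mv i; have [a ea] := mp i; have [b eb] := mv i; exists (a + b); rewrite !mxE ea eb -mulrDr -rmorphD.
Qed.

Variable N : nat.
Local Notation T := {ffun 'I_d -> 'I_(N + N)}.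
Local Notation lp := (@lpoint R d h N (N + N)).

Lemma lpoint_mesh (k : T) : on_mesh (lp k).
Proof.
by move=> i; exists ((k i)%:Z - N%:Z); rewrite mxE /node rmorphB.
Qed.

Lemma lpoint_inj : injective lp.
Proof.
move=> k l /rowP e; apply/ffunP => i; apply/val_inj; have := e i.
rewrite !mxE /node => /(mulfI (lt0r_neq0 h0)) /addIr /eqP.
by rewrite eqr_nat => /eqP.
Qed.

Lemma lpoint_surj p : on_mesh p -> `|p| <= h * N%:R - h -> exists k : T, lp k = p.
Proof.
move=> mp pN; have zk i : exists k : 'I_(N + N), node h N k = p 0 i.
  have [z ez] := mp i; have := le_trans (coord_le p i) pN.
  rewrite ez normrM gtr0_norm // (_ : h * N%:R - h = h * (N%:R - 1)); last by ring.
  rewrite ler_pM2l // => zN.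
  (* The nodes run from [- h * N] to [h * N - h], so the symmetric range of admissible integers
     stops at [N - 1]. *)
  have zN' : `|z| <= N%:Z - 1.
    by rewrite -(ler_int R) rmorphB /= intr_norm.
  have z0 : 0 <= z + N%:Z by move: zN'; rewrite ler_norml; lia.
  have zk : (`|(z + N%:Z)%R|%N < N + N)%N by move: zN'; rewrite ler_norml; lia.
  exists (Ordinal zk); rewrite /node /=.
  by rewrite natr_absz ger0_norm // rmorphD /= addrK.
have /choice[k kP] := zk; exists (finfun k).
by apply/rowP => i; rewrite mxE ffunE kP.
Qed.

(** [None] stands for every point off the finite lattice; the lattice will be so large that costs
    and test functions vanish there. *)
Definition mesh_move (k : T) (u : V) : option T := [pick k' | lp k' == lp k + u].

Lemma mesh_moveP k u : on_mesh u ->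
  match mesh_move k u with
  | Some k' => lp k' = lp k + u
  | None => h * N%:R - h < `|lp k + u|
  end.
Proof.
move=> mu; rewrite /mesh_move; case: pickP => [k' /eqP //|no].
rewrite ltNge; apply/negP => le.
have [k' e] := lpoint_surj (on_meshD (lpoint_mesh k) mu) le.
by have := no k'; rewrite e eqxx.
Qed.

Variable G : nat -> R -> R.

(** A weight depends only on the difference between the point and the node, so moving the nodes by a
    mesh vector [u] amounts to translating [x] by [u]. This is why moves are rounded: the moved
    marginal, tested against [phi], becomes the smooth lattice function at [u + x]. Nodes lost at
    the boundary have [phi = 0]. *)
Lemma mesh_move_sum (phi : T -> R) (Rad : R) x u : on_mesh u ->
  (forall k, Rad <= `|lp k| -> phi k = 0) -> Rad + `|u| <= h * N%:R - h ->
  \sum_k weight G h N k x * (if mesh_move k u is Some k' then phi k' else 0) =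
  \sum_k phi k * weight G h N k (u + x).
Proof.
move=> mu phiR RN.
transitivity (\sum_k \sum_k' (if lp k' == lp k + u then phi k' * weight G h N k x else 0)).
  apply: eq_bigr => k _; rewrite /mesh_move; case: pickP => [k0 /eqP e0|no].
    rewrite (bigD1 k0) //= ifT ?e0 // [X in _ + X]big1 => [|k' k'n].
      by rewrite addr0 mulrC.
    by rewrite ifF // -e0 (inj_eq lpoint_inj) (negbTE k'n).
  by rewrite mulr0 big1 // => k' _; rewrite no.
rewrite exchange_big /=; apply: eq_bigr => k' _.
have [k'R|k'R] := leP Rad `|lp k'|.
  by rewrite phiR // mul0r big1 // => k _; rewrite mul0r if_same.
have [|k ek] := lpoint_surj (on_meshB (lpoint_mesh k') mu).
  by apply: le_trans (ler_normB _ _) _; apply: le_trans RN; rewrite lerD2r ltW.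
rewrite (bigD1 k) //= ifT ?ek ?subrK // [X in _ + X]big1 ?addr0 => [|k2 k2n]; last first.
  rewrite ifF //; apply: contraNF k2n => /eqP e.
  by apply/eqP/lpoint_inj; rewrite ek e addrK.
congr (_ * _); apply: eq_bigr => i _; congr (bspl G h 0 _).
have /rowP/(_ i) := ek; rewrite !mxE => ->; ring.
Qed.

End Mesh.

(** * One random step against the cost and against test functions *)

Section DiscreteDrift.
Variables (R : realType) (d d1 : nat).
Local Notation V := 'rV[R]_d.
Local Notation Z := (V * V)%type.

(* [gen] is the generator of the synchronous coupling applied to the cost. *)
Definition gen (C1 C2 : Z -> Z -> R) (z : Z) (b b' : V) (S S' : 'M[R]_(d, d1)) : R :=
  C1 z (b, b') + \sum_m C2 z (scol S m, scol S' m).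

Definition size2 (b : V) (S : 'M[R]_(d, d1)) : R := `|b| + \sum_m `|scol S m| ^+ 2.

Variables (Rad K : R) (C : Z -> R) (C1 C2 : Z -> Z -> R).
Hypothesis HC : cost_bounds Rad K C C1 C2.
Hypothesis K0 : 0 <= K.

Local Notation E := (option ('I_d1 * bool)).
(** The [2 d1 + 1] moves are equally likely. Noise has size [s] and drift size [s ^ 2], so the
    increments of f add up to [s ^ 2] times L f in leading order; the two opposite moves along a
    column give exactly its second derivative, in accordance with a generator that has no factor
    1/2. *)
Definition step_dir (s : R) (b : V) (S : 'M[R]_(d, d1)) (e : E) : V :=
  match e with
  | None => s ^+ 2 *: b
  | Some (m, true) => s *: scol S m
  | Some (m, false) => - (s *: scol S m)
  end.

Lemma sum_dirs (F : E -> R) :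
  \sum_e F e = F None + \sum_m (F (Some (m, true)) + F (Some (m, false))).
Proof.
rewrite (bigD1 None) //=; congr (_ + _).
rewrite (reindex_omap Some id) /=; last by case.
transitivity (\sum_(p : 'I_d1 * bool) F (Some (p.1, p.2))).
  by apply: eq_big => [[m e]|[m e] _]; rewrite ?eqxx.
rewrite -(pair_bigA _ (fun m (e : bool) => F (Some (m, e)))) /=.
by apply: eq_bigr => m _; rewrite big_bool.
Qed.

Lemma scol_pair_norm (x y : V) : `|(x, y) : Z| <= `|x| + `|y|.
Proof. by rewrite prod_normE ge_max lerDl lerDr !normr_ge0. Qed.

(** The generator is taken at [z] while the move starts at a lattice point [z'] within [r] of it.
    Both discrepancies are measured by the modulus [th]: the drift pays [2 th], the noise [3 th],
    and 6 covers both. *)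
Lemma cost_step (th r s : R) (z z' : Z) (b b' : V) (S S' : 'M[R]_(d, d1)) (B : R) :
  0 < th -> 0 < s -> s <= 1 ->
  (forall z z' v, `|z - z'| <= r ->
      `|C1 z v - C1 z' v| <= th * `|v| /\ `|C2 z v - C2 z' v| <= th * `|v| ^+ 2) ->
  `|z' - z| <= r -> s * B <= r ->
  `|b| <= B -> `|b'| <= B -> (forall m, `|scol S m| <= B) -> (forall m, `|scol S' m| <= B) ->
  \sum_e (C ((step_dir s b S e, step_dir s b' S' e) + z') - C z') <=
    s ^+ 2 * (gen C1 C2 z b b' S S' + 6 * th * (size2 b S + size2 b' S')).
Proof.
move=> th0 s0 s1 Hmod zr sB bB b'B SB S'B.
have pB (x y : V) : `|x| <= B -> `|y| <= B -> `|(x, y) : Z| <= B.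
  by move=> h1 h2; rewrite prod_normE ge_max h1.
have sq (x y : V) : `|(x, y) : Z| ^+ 2 <= `|x| ^+ 2 + `|y| ^+ 2.
  rewrite prod_normE; have [_|_] := leP `|x| `|y|; rewrite ?lerDl ?lerDr exprn_ge0 //.
have small (v : Z) (t : R) : `|v| <= B -> -1 <= t <= 1 -> `|t *: (s *: v) + z' - z'| <= r.
  move=> vB t1; rewrite addrK !normrZ; apply: le_trans sB.
  rewrite (gtr0_norm s0) -[leRHS]mul1r ler_pM ?mulr_ge0 ?(ltW s0) //.
    by rewrite ler_norml.
  by rewrite ler_wpM2l // ltW.
rewrite sum_dirs.
have drift : C ((s ^+ 2 *: b, s ^+ 2 *: b') + z') - C z' <=
    s ^+ 2 * (C1 z (b, b') + 2 * th * (`|b| + `|b'|)).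
  set v : Z := (b, b'); have -> : (s ^+ 2 *: b, s ^+ 2 *: b') = s ^+ 2 *: v by [].
  have vB : `|v| <= B := pB _ _ bB b'B.
  have T := @taylor1 R _ C (fun z => C1 z (s ^+ 2 *: v)) z' (s ^+ 2 *: v) (th * `|s ^+ 2 *: v|)
    (cost_d1 HC (s ^+ 2 *: v)).
  have {}T : `|C (s ^+ 2 *: v + z') - C z' - C1 z' (s ^+ 2 *: v)| <= th * `|s ^+ 2 *: v|.
    apply: T => t /andP[t0 t1]; apply: (Hmod _ _ _ _).1.
    have -> : t *: (s ^+ 2 *: v) = (t * s) *: (s *: v).
      by rewrite scalerA [RHS]scalerA expr2 mulrA.
    apply: small => //.
    have : 0 <= t * s by rewrite mulr_ge0 // ltW.
    have : t * s <= 1 * 1 by rewrite ler_pM // ltW.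
    by move=> h1 h2; apply/andP; split; lra.
  have [M1 _] := Hmod z' z v zr.
  have nv := scol_pair_norm b b'; rewrite -/v in nv.
  have e1 := cost1_homog HC z' (s ^+ 2) v.
  rewrite e1 normrZ ger0_norm ?sqr_ge0 // in T.
  move: T M1; rewrite !ler_norml => /andP[_ T] /andP[_ M1].
  have s20 : 0 <= s ^+ 2 by exact: sqr_ge0.
  have : s ^+ 2 * C1 z' v <= s ^+ 2 * (C1 z v + th * `|v|) by rewrite ler_wpM2l //; lra.
  have : s ^+ 2 * (th * `|v|) <= s ^+ 2 * (th * (`|b| + `|b'|)).
    by rewrite ler_wpM2l // ler_wpM2l // ltW.
  rewrite (_ : th * (s ^+ 2 * `|v|) = s ^+ 2 * (th * `|v|)) in T; last by ring.
  have -> : s ^+ 2 * (C1 z v + 2 * th * (`|b| + `|b'|)) =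
    s ^+ 2 * C1 z v + s ^+ 2 * (th * (`|b| + `|b'|)) + s ^+ 2 * (th * (`|b| + `|b'|)) by ring.
  have -> : s ^+ 2 * (C1 z v + th * `|v|) = s ^+ 2 * C1 z v + s ^+ 2 * (th * `|v|) by ring.
  lra.
have noise m : (C ((s *: scol S m, s *: scol S' m) + z') - C z') +
     (C ((- (s *: scol S m), - (s *: scol S' m)) + z') - C z') <=
    s ^+ 2 * (C2 z (scol S m, scol S' m) + 3 * th * (`|scol S m| ^+ 2 + `|scol S' m| ^+ 2)).
  set v : Z := (scol S m, scol S' m).
  have -> : (s *: scol S m, s *: scol S' m) = s *: v by [].
  have -> : (- (s *: scol S m), - (s *: scol S' m)) = - (s *: v) by [].
  have vB : `|v| <= B by exact: pB.
  have T := @taylor2 R _ C (fun z => C1 z (s *: v)) (fun z => C2 z (s *: v)) z' (s *: v)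
    (th * `|s *: v| ^+ 2) (cost_d1 HC _) (cost_d2 HC _).
  have {}T : `|C (s *: v + z') + C (- (s *: v) + z') - 2 * C z' - C2 z' (s *: v)| <= 2 * (th * `|s *: v| ^+ 2).
    by apply: T => t t1; apply: (Hmod _ _ _ _).2; exact: small.
  have [_ M2] := Hmod z' z v zr.
  have nv := sq (scol S m) (scol S' m); rewrite -/v in nv.
  rewrite (cost2_homog HC) normrZ (gtr0_norm s0) exprMn in T.
  move: T M2; rewrite !ler_norml => /andP[_ T] /andP[_ M2].
  have s20 : 0 <= s ^+ 2 by exact: sqr_ge0.
  have : s ^+ 2 * C2 z' v <= s ^+ 2 * (C2 z v + th * `|v| ^+ 2) by rewrite ler_wpM2l //; lra.
  set q := `|scol S m| ^+ 2 + _ in nv *.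
  have : s ^+ 2 * (th * `|v| ^+ 2) <= s ^+ 2 * (th * q).
    by rewrite ler_wpM2l // ler_wpM2l // ltW.
  rewrite (_ : th * (s ^+ 2 * `|v| ^+ 2) = s ^+ 2 * (th * `|v| ^+ 2)) in T; last by ring.
  have -> : s ^+ 2 * (C2 z v + 3 * th * q) = s ^+ 2 * C2 z v + 3 * (s ^+ 2 * (th * q)) by ring.
  have -> : s ^+ 2 * (C2 z v + th * `|v| ^+ 2) = s ^+ 2 * C2 z v + s ^+ 2 * (th * `|v| ^+ 2) by ring.
  lra.
apply: le_trans (lerD drift (ler_sum _ (fun m _ => noise m))) _.
rewrite -mulr_sumr -mulrDr ler_wpM2l ?sqr_ge0 // /gen big_split /= -mulr_sumr big_split /= /size2.
set Q := \sum_i `|scol S i| ^+ 2; set Q' := \sum_i `|scol S' i| ^+ 2.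
have Q0 : 0 <= Q by apply: sumr_ge0 => m _; exact: exprn_ge0.
have Q'0 : 0 <= Q' by apply: sumr_ge0 => m _; exact: exprn_ge0.
have := normr_ge0 b; have := normr_ge0 b'; move: (\sum_m _) => X; nra.
Qed.

(** Here the second derivatives are Lipschitz, so the error has an additional factor [s] and becomes
    negligible after division by [s ^ 2]. *)
Lemma test_step (K' s B : R) f f1 f2 x (b : V) (S : 'M[R]_(d, d1)) :
  jet_bounds K' f f1 f2 -> 0 <= K' -> 0 < s -> s <= 1 ->
  (forall c v, f1 x (c *: v) = c * f1 x v) -> (forall c v, f2 x (c *: v) = c ^+ 2 * f2 x v) ->
  `|b| <= B -> (forall m, `|scol S m| <= B) ->
  \sum_e (f (step_dir s b S e + x) - f x) <=
    s ^+ 2 * (\sum_m f2 x (scol S m) + f1 x b + s * (K' * (B ^+ 2 + 2 * d1%:R * B ^+ 3))).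
Proof.
move=> J K'0 s0 s1 h1 h2 bB SB; rewrite sum_dirs.
have B0 : 0 <= B by exact: le_trans bB.
have drift : f (s ^+ 2 *: b + x) - f x <= s ^+ 2 * (f1 x b + s * (K' * B ^+ 2)).
  have := jet_taylor1 J x (s ^+ 2 *: b); rewrite h1 normrZ ger0_norm ?sqr_ge0 // exprMn.
  rewrite ler_norml => /andP[_].
  have : K' * ((s ^+ 2) ^+ 2 * `|b| ^+ 2) <= K' * (s ^+ 2 * s * B ^+ 2).
    apply: ler_wpM2l => //; apply: ler_pM; [exact: sqr_ge0|exact: sqr_ge0| |].
      rewrite (expr2 (s ^+ 2)); apply: ler_wpM2l; first exact: sqr_ge0.
      by rewrite expr2 ler_piMr // ltW.
    by apply: lerXn2r; rewrite ?nnegrE.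
  have -> : s ^+ 2 * (f1 x b + s * (K' * B ^+ 2)) = s ^+ 2 * f1 x b + K' * (s ^+ 2 * s * B ^+ 2) by ring.
  lra.
have noise m : (f (s *: scol S m + x) - f x) + (f (- (s *: scol S m) + x) - f x) <=
    s ^+ 2 * (f2 x (scol S m) + s * (2 * (K' * B ^+ 3))).
  have := jet_taylor2 J x (s *: scol S m); rewrite h2 normrZ gtr0_norm // exprMn.
  rewrite ler_norml => /andP[_].
  have : K' * (s ^+ 3 * `|scol S m| ^+ 3) <= K' * (s ^+ 3 * B ^+ 3).
    apply: ler_wpM2l => //; apply: ler_wpM2l; first by rewrite exprn_ge0 // ltW.
    by apply: lerXn2r; rewrite ?nnegrE.
  have -> : s ^+ 2 * (f2 x (scol S m) + s * (2 * (K' * B ^+ 3))) =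
    s ^+ 2 * f2 x (scol S m) + 2 * (K' * (s ^+ 3 * B ^+ 3)) by ring.
  lra.
apply: le_trans (lerD drift (ler_sum _ (fun m _ => noise m))) _.
rewrite -mulr_sumr -mulrDr ler_wpM2l ?sqr_ge0 // big_split /= sumr_const card_ord.
rewrite -(mulr_natl (s * (2 * (K' * B ^+ 3)))) le_eqVlt; apply/orP; left; apply/eqP; ring.
Qed.

End DiscreteDrift.

Lemma combine_le (R : realFieldType) (e1 th X Y Z : R) :
  Y <= Z -> - (2 * e1 + 5 * th) <= X + Y + th -> - (2 * e1 + 6 * th + Z) <= X.
Proof. lra. Qed.

(** * A nearly optimal coupling of two discrete measures *)

Section DiscreteCoupling.
Variables (R : realType) (d d1 : nat).
Local Notation V := 'rV[R]_d.
Local Notation Z := (V * V)%type.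
Variables (Rad K : R) (C : Z -> R) (C1 C2 : Z -> Z -> R).
Hypothesis HC : cost_bounds Rad K C C1 C2.
Hypothesis K0 : 0 <= K.
Variables (dl : R) (G : nat -> R -> R).
Hypothesis dl0 : 0 < dl.
Hypothesis Gd : forall n (s : R), is_derive s 1 (G n) (G n.+1 s).
Hypothesis G_le0 : forall s, s <= 0 -> G 0%N s = 0.
Hypothesis G_ge1 : forall s, dl <= s -> G 0%N s = 1.
Hypothesis G_supp : forall n s, s <= 0 \/ dl <= s -> G n.+1 s = 0.
Hypothesis G_pos : forall s, 0 <= G 1%N s.
Variable K' : R.
Hypothesis K'0 : 0 <= K'.
Hypothesis jets : forall (h : R) (N n : nat)
  (phi : {ffun 'I_d -> 'I_n} -> R), 0 < h -> (forall k, `|phi k| <= 1) ->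
  jet_bounds K' (tfun G h N phi (fun=> 0%N)) (tf1 G h N phi) (tf2 G h N phi).

Variables (J : finType) (x b : J -> V) (S : J -> 'M[R]_(d, d1)) (B : R).
Hypothesis bB : forall j, `|b j| <= B.
Hypothesis SB : forall j m, `|scol (S j) m| <= B.

(** Stationarity restricted to the test functions that the comparison of marginals produces. One
    inequality is enough, since only a gain of mass has to be bounded. *)
Definition approx_stat (e1 : R) (mu : J -> R) := forall (h : R) (N n : nat)
  (phi : {ffun 'I_d -> 'I_n} -> R), 0 < h -> h <= 1 / 4 -> (forall k, 0 <= phi k <= 1) ->
  (forall k, Rad <= `|lpoint h N k| -> phi k = 0) ->
  \sum_j mu j * (\sum_m tf2 G h N phi (x j) (scol (S j) m) + tf1 G h N phi (x j) (b j)) <= e1.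

Definition prob (mu : J -> R) := (forall j, 0 <= mu j) /\ \sum_j mu j = 1.

Section Marginal.
Variables (h s : R) (N : nat).
Hypotheses (h0 : 0 < h) (h4 : h <= 1 / 4) (s0 : 0 < s) (s1 : s <= 1) (sB : s * B <= 1 / 2).
Hypotheses (dl4 : dl <= 1 / 4) (hN : Rad + 3 <= h * N%:R).
Local Notation T := {ffun 'I_d -> 'I_(N + N)}.
Local Notation E := (option ('I_d1 * bool)).
Local Notation lp := (@lpoint R d h N (N + N)).
Let nE : R := #|{: E}|%:R.

Let nE0 : 0 < nE. Proof. by rewrite ltr0n; apply/card_gt0P; exists None. Qed.

(** Law of the random lattice point that replaces [x j]; the defect of the partition of unity far
    from the origin goes to [None]. *)
Definition wt (j : J) (a : option T) : R :=
  if a is Some k then weight G h N k (x j) else 1 - \sum_(k : T) weight G h N k (x j).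

Lemma wt_ge0 j a : 0 <= wt j a.
Proof.
case: a => [k|]; first exact: weight_ge0.
by rewrite subr_ge0; apply: (sum_weight_le1 dl0 Gd G_le0 G_ge1 G_supp G_pos).
Qed.

Lemma sum_opt (A : finType) (F : option A -> R) : \sum_a F a = F None + \sum_k F (Some k).
Proof.
rewrite (bigD1 None) //=; congr (_ + _).
rewrite (reindex_omap Some id) /=; last by case.
by apply: eq_bigl => m; rewrite eqxx.
Qed.

Lemma sum_prod (A A' : finType) (F : A * A' -> R) :
  \sum_z F z = \sum_a \sum_a' F (a, a').
Proof. by rewrite pair_bigA; apply: eq_bigr => -[]. Qed.

Lemma wt_sum j : \sum_a wt j a = 1.
Proof. by rewrite sum_opt /= subrK. Qed.

Definition shift_of (e : E) (j : J) : V := mesh_round h (step_dir s (b j) (S j) e).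

Definition mv (e : E) (z : J * option T) : option T :=
  if z.2 is Some k then mesh_move h k (shift_of e z.1) else None.

Lemma step_dir_le e j : `|step_dir s (b j) (S j) e| <= 1 / 2.
Proof.
have B0 : 0 <= B by exact: le_trans (bB j).
have sv (v : V) : `|v| <= B -> `|s *: v| <= 1 / 2.
  by move=> vB; rewrite normrZ gtr0_norm //; apply: le_trans sB; rewrite ler_wpM2l // ltW.
case: e => [[m []]|] /=; [exact: sv|by rewrite normrN; exact: sv|].
rewrite expr2 -scalerA normrZ gtr0_norm // -[leRHS]mul1r ler_pM //; first exact: ltW.
exact: sv.
Qed.

Lemma shift_le e j : `|shift_of e j| <= 1.
Proof.
have := mesh_round_le h0 (step_dir s (b j) (S j) e); have := step_dir_le e j.
have := ler_normD (shift_of e j - step_dir s (b j) (S j) e) (step_dir s (b j) (S j) e).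
by rewrite subrK /shift_of; move: h4; lra.
Qed.

Definition joint (mu : J -> R) (z : J * option T) : R := mu z.1 * wt z.1 z.2.

Lemma marginal_drift (mu : J -> R) (e1 : R) (A : pred T) :
  (forall j, 0 <= mu j) -> \sum_j mu j = 1 -> approx_stat e1 mu ->
  (forall k, A k -> `|lp k| < Rad) ->
  \sum_(k | A k) Num.max 0 (\sum_e nE^-1 * \sum_(z | mv e z == Some k) joint mu z -
     \sum_(z | z.2 == Some k) joint mu z) <=
  nE^-1 * (s ^+ 2 * (e1 + s * (K' * (B ^+ 2 + 2 * d1%:R * B ^+ 3))) + nE * (K' * h)).
Proof.
move=> mu0 mu1 st AR; set la := joint mu.
pose df k := \sum_e nE^-1 * \sum_(z | mv e z == Some k) la z - \sum_(z | z.2 == Some k) la z.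
(* The indicator of the lattice points that gain mass turns the sum of positive parts into a single
   linear functional, the integral of the increment of the smooth function [f]. *)
pose phi k : R := if A k && (0 < df k) then 1 else 0.
pose phi' a : R := if a is Some k then phi k else 0.
have phi01 k : 0 <= phi k <= 1 by rewrite /phi; case: ifP; rewrite ?lexx ?ler01.
have phiR k : Rad <= `|lp k| -> phi k = 0.
  by move=> Rk; rewrite /phi ifF //; apply/negbTE; apply: contraTN Rk => /andP[/AR]; rewrite -ltNge.
pose f := tfun G h N phi (fun=> 0%N).
have ef y : f y = \sum_k phi k * weight G h N k y by rewrite /f tfun0.
have -> : \sum_(k | A k) Num.max 0 (df k) = \sum_a phi' a *
    (\sum_e nE^-1 * \sum_(z | mv e z == a) la z - \sum_(z | z.2 == a) la z).
  rewrite sum_opt /= mul0r add0r big_mkcond /=; apply: eq_bigr => k _.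
  rewrite /phi -/(df k); case: (A k) => /=; last by rewrite mul0r.
  by case: ltP => [p|n]; rewrite ?mul1r ?mul0r.
under eq_bigr do rewrite mulrBr.
rewrite sumrB (sum_fiber snd la phi').
have -> : \sum_a phi' a * (\sum_e nE^-1 * \sum_(z | mv e z == a) la z) =
   nE^-1 * \sum_e \sum_z phi' (mv e z) * la z.
  under eq_bigr do rewrite mulr_sumr.
  rewrite exchange_big mulr_sumr /=; apply: eq_bigr => e _.
  rewrite -(sum_fiber (mv e) la phi') mulr_sumr; apply: eq_bigr => a _.
  by rewrite mulrCA.
have pairE (F : J * option T -> R) : \sum_z F z * la z = \sum_j mu j * \sum_a wt j a * F (j, a).
  rewrite (eq_bigr (fun z => F (z.1, z.2) * la (z.1, z.2))); last by case.
  rewrite -(pair_bigA _ (fun j a => F (j, a) * la (j, a))) /=; apply: eq_bigr => j _.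
  by rewrite mulr_sumr; apply: eq_bigr => a _; rewrite /la /joint /=; ring.
have E1 e : \sum_z phi' (mv e z) * la z = \sum_j mu j * f (shift_of e j + x j).
  rewrite pairE; apply: eq_bigr => j _; congr (_ * _).
  rewrite sum_opt /= mulr0 add0r ef.
  rewrite -(@mesh_move_sum R d h h0 N G phi Rad (x j) _ (mesh_round_mesh h _) phiR); last first.
    by have := shift_le e j; rewrite -/(shift_of e j); move: hN h4; lra.
  by apply: eq_bigr => k _; rewrite /mv /= -/(shift_of e j) /phi'.
have E2 : \sum_z phi' z.2 * la z = \sum_j mu j * f (x j).
  rewrite pairE; apply: eq_bigr => j _; congr (_ * _).
  by rewrite sum_opt /= mulr0 add0r ef; apply: eq_bigr => k _; rewrite mulrC.
rewrite E2; under eq_bigr do rewrite E1.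
have J0 : jet_bounds K' f (tf1 G h N phi) (tf2 G h N phi).
  by apply: jets => // k; have /andP[p0 p1] := phi01 k; rewrite ger0_norm.
have key j : \sum_e (f (shift_of e j + x j) - f (x j)) <=
    s ^+ 2 * (\sum_m tf2 G h N phi (x j) (scol (S j) m) + tf1 G h N phi (x j) (b j)
      + s * (K' * (B ^+ 2 + 2 * d1%:R * B ^+ 3))) + nE * (K' * h).
  have h1 c v : tf1 G h N phi (x j) (c *: v) = c * tf1 G h N phi (x j) v.
    by rewrite /tf1 mulr_sumr; apply: eq_bigr => i _; rewrite mxE mulrA.
  have h2 c v : tf2 G h N phi (x j) (c *: v) = c ^+ 2 * tf2 G h N phi (x j) v.
    rewrite /tf2 mulr_sumr; apply: eq_bigr => i _; rewrite mxE !mulr_sumr.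
    by apply: eq_bigr => l _; rewrite mxE; ring.
  have TS := test_step J0 K'0 s0 s1 h1 h2 (bB j) (SB j).
  (* Replacing the exact move by the rounded one costs at most [K' * h] for each of the [nE]
     moves. *)
  apply: le_trans (lerD TS (lexx _)).
  have -> : nE * (K' * h) = \sum_(e : E) K' * h by rewrite sumr_const -mulr_natl.
  rewrite -big_split /=; apply: ler_sum => e _.
  have := jet_lip J0 (shift_of e j + x j) (step_dir s (b j) (S j) e + x j).
  have -> : shift_of e j + x j - (step_dir s (b j) (S j) e + x j) =
     shift_of e j - step_dir s (b j) (S j) e by rewrite opprD addrACA subrr addr0.
  move=> L; have := ler_wpM2l K'0 (mesh_round_le h0 (step_dir s (b j) (S j) e)).
  by move: L; rewrite -/(shift_of e j) ler_norml => /andP[_]; lra.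
have -> : nE^-1 * (\sum_e \sum_j mu j * f (shift_of e j + x j)) - \sum_j mu j * f (x j) =
   nE^-1 * \sum_j mu j * \sum_e (f (shift_of e j + x j) - f (x j)).
  have -> : \sum_j mu j * f (x j) = nE^-1 * \sum_(e : E) \sum_j mu j * f (x j).
    by rewrite sumr_const -[_ *+ _]mulr_natl mulKf // gt_eqF.
  rewrite -mulrBr -sumrB; congr (_ * _).
  under [RHS]eq_bigr do rewrite mulr_sumr.
  rewrite [RHS]exchange_big /=; apply: eq_bigr => e _.
  by rewrite -sumrB; apply: eq_bigr => j _; rewrite mulrBr.
rewrite ler_wpM2l ?invr_ge0 ?(ltW nE0) //.
apply: le_trans (ler_sum _ (fun j _ => ler_wpM2l (mu0 j) (key j))) _.
under eq_bigr do rewrite mulrDr mulrCA mulrDr.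
rewrite big_split /= -mulr_sumr big_split /= -!mulr_suml mu1 !mul1r.
rewrite lerD2r ler_wpM2l ?sqr_ge0 // lerD2r.
exact: (st h N (N + N)%N phi h0 h4 phi01 phiR).
Qed.

Definition cc (a a' : option T) : R :=
  if a is Some k then if a' is Some l then C (lp k, lp l) else 0 else 0.

(** A move that leaves the lattice ends beyond [Rad], where [C] is 0, the value that [cc] assigns to
    [None]. *)
Lemma cc_move (k l : T) u u' : on_mesh h u -> on_mesh h u' ->
  cc (mesh_move h k u) (mesh_move h l u') = C ((u, u') + (lp k, lp l)).
Proof.
move=> mu mu'.
have Ru (p : V) : h * N%:R - h < `|p| -> Rad <= `|p| by move: hN h4; lra.
have := mesh_moveP h0 k mu; have := mesh_moveP h0 l mu'.
have eq : (u, u') + (lp k, lp l) = (lp k + u, lp l + u') :> Z.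
  by congr (_, _); exact: addrC.
rewrite eq; case: (mesh_move h k u) => [k'|] h2 h1.
  case: (mesh_move h l u') h2 => [l'|] h2; first by rewrite /cc h1 h2.
  by have [->] := cost_supp HC (or_intror (Ru _ h2) : Rad <= `|(lp k + u, lp l + u').1| \/ Rad <= `|(lp k + u, lp l + u').2|).
by have [->] := cost_supp HC (or_introl (Ru _ h1) : Rad <= `|(lp k + u, lp l + u').1| \/ Rad <= `|(lp k + u, lp l + u').2|).
Qed.

Lemma wt_supp j a : wt j a != 0 ->
  if a is Some k then `|x j - lp k| <= h + dl else Rad + 1 < `|x j|.
Proof.
case: a => [k|] /=; first exact: (weight_supp dl0 G_le0 G_ge1 G_supp h0).
apply: contraNT; rewrite -leNgt => xj.
rewrite (sum_weight_eq1 dl0 G_le0 G_ge1 h0) ?subrr //.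
by move: hN h4 dl4; lra.
Qed.

Lemma bracket_le (th r : R) z z' : 0 < th ->
  (forall z z' v, `|z - z'| <= r ->
      `|C1 z v - C1 z' v| <= th * `|v| /\ `|C2 z v - C2 z' v| <= th * `|v| ^+ 2) ->
  h + dl <= r -> s * B <= r -> wt z.1 z.2 != 0 -> wt z'.1 z'.2 != 0 ->
  \sum_e nE^-1 * cc (mv e z) (mv e z') - cc z.2 z'.2 <=
    nE^-1 * (s ^+ 2 * (gen C1 C2 (x z.1, x z'.1) (b z.1) (b z'.1) (S z.1) (S z'.1)
      + 6 * th * (size2 (b z.1) (S z.1) + size2 (b z'.1) (S z'.1))) + nE * (K * h)).
Proof.
move=> th0 Hmod hr sr /wt_supp wz /wt_supp wz'.
case: z z' wz wz' => [j a] [j' a'] /= wz wz'.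
have size0 b0 (S0 : 'M[R]_(d, d1)) : 0 <= size2 b0 S0.
  by rewrite addr_ge0 // sumr_ge0 // => m _; rewrite exprn_ge0.
(* A smeared point can be off the lattice only if its original lies beyond [Rad]; the generator then
   vanishes and the bound is trivially nonnegative. *)
have none : Rad <= `|x j| \/ Rad <= `|x j'| -> 0 <=
   nE^-1 * (s ^+ 2 * (gen C1 C2 (x j, x j') (b j) (b j') (S j) (S j')
      + 6 * th * (size2 (b j) (S j) + size2 (b j') (S j'))) + nE * (K * h)).
  move=> far; have [_ c1 c2] := cost_supp HC (far : Rad <= `|(x j, x j').1| \/ Rad <= `|(x j, x j').2|).
  rewrite /gen c1 big1 => [|m _]; last exact: c2.
  rewrite !add0r mulr_ge0 ?invr_ge0 ?(ltW nE0) // addr_ge0 //.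
    apply: mulr_ge0; first exact: sqr_ge0.
    by apply: mulr_ge0; [apply: mulr_ge0 => //; exact: ltW | exact: addr_ge0].
  by apply: mulr_ge0; [exact: ltW | apply: mulr_ge0 => //; exact: ltW].
case: a wz => [k|] wz; last first.
  have e0 e : mv e (j, None) = None by [].
  rewrite (eq_bigr (fun=> 0)) => [|e _]; last by rewrite e0 /= mulr0.
  rewrite big1 // subrr; apply: none; left; apply: ltW; apply: le_lt_trans wz.
  by rewrite lerDl.
case: a' wz' => [l|] wz'; last first.
  have e0 e : mv e (j', None) = None by [].
  rewrite (eq_bigr (fun=> 0)) => [|e _]; last first.
    by rewrite e0 /= /cc; case: (mv _ _) => [?|]; rewrite mulr0.
  rewrite big1 // subrr; apply: none; right; apply: ltW; apply: le_lt_trans wz'.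
  by rewrite lerDl.
have -> : \sum_e nE^-1 * cc (mv e (j, Some k)) (mv e (j', Some l)) - cc (Some k) (Some l) =
   nE^-1 * \sum_e (C ((shift_of e j, shift_of e j') + (lp k, lp l)) - C (lp k, lp l)).
  rewrite sumrB mulrBr sumr_const -[_ *+ #|_|]mulr_natl mulKf ?gt_eqF //.
  rewrite mulr_sumr; congr (_ - _); apply: eq_bigr => e _; congr (_ * _).
  by rewrite /mv /= cc_move //; exact: mesh_round_mesh.
rewrite ler_wpM2l ?invr_ge0 ?(ltW nE0) //.
have step := @cost_step R d d1 Rad K C C1 C2 HC th r s (x j, x j') (lp k, lp l) (b j) (b j')
  (S j) (S j') B th0 s0 s1 Hmod.
apply: le_trans (lerD (step _ sr (bB j) (bB j') (SB j) (SB j')) (lexx (nE * (K * h)))); last first.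
  apply: le_trans hr; rewrite prod_normE ge_max /=.
  by rewrite distrC wz distrC wz'.
have -> : nE * (K * h) = \sum_(e : E) K * h by rewrite sumr_const -mulr_natl.
rewrite -big_split /=; apply: ler_sum => e _.
have := cost_lip HC ((shift_of e j, shift_of e j') + (lp k, lp l))
   ((step_dir s (b j) (S j) e, step_dir s (b j') (S j') e) + (lp k, lp l)).
rewrite opprD addrACA subrr addr0.
have : `|(shift_of e j, shift_of e j') - (step_dir s (b j) (S j) e, step_dir s (b j') (S j') e) : Z| <= h.
  by rewrite prod_normE ge_max /= !mesh_round_le.
move=> /(ler_wpM2l K0) L; rewrite ler_norml => /andP[_]; move: L; lra.
Qed.

Lemma coupling_gen (mu nu : J -> R) (e1 th Q r : R) : 0 < th ->
  (forall z z' v, `|z - z'| <= r ->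
      `|C1 z v - C1 z' v| <= th * `|v| /\ `|C2 z v - C2 z' v| <= th * `|v| ^+ 2) ->
  h + dl <= r -> s * B <= r ->
  prob mu -> prob nu -> approx_stat e1 mu -> approx_stat e1 nu ->
  \sum_j mu j * size2 (b j) (S j) <= Q -> \sum_j nu j * size2 (b j) (S j) <= Q ->
  s * (K' * (B ^+ 2 + 2 * d1%:R * B ^+ 3)) <= th -> nE * (K' * h) <= s ^+ 2 * th ->
  nE * (K * h) <= s ^+ 2 * th ->
  exists2 pi, coupling mu nu pi &
    - (2 * e1 + 6 * th + 12 * th * Q) <=
    \sum_j \sum_j' pi j j' * gen C1 C2 (x j, x j') (b j) (b j') (S j) (S j').
Proof.
move=> th0 Hmod hr sr [mu0 mu1] [nu0 nu1] smu snu Qmu Qnu sth hth hth2.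
pose A (a : option T) := if a is Some k then `|lp k| < Rad else false.
have j0 la : (forall j, 0 <= la j) -> forall z, 0 <= joint la z.
  by move=> la0 z; rewrite mulr_ge0 // wt_ge0.
have jr la (F : J -> R) : \sum_z F z.1 * joint la z = \sum_j la j * F j.
  rewrite sum_prod; apply: eq_bigr => j _; rewrite /joint /=.
  by rewrite -[in RHS](mulr1 (la j)) -(wt_sum j) mulrAC mulr_sumr; apply: eq_bigr => a _; ring.
have j1 la : \sum_z joint la z = \sum_j la j.
  have := jr la (fun=> 1); under eq_bigr do rewrite mul1r; move=> ->.
  by apply: eq_bigr => j _; rewrite mulr1.
have cin a a' : -1 <= cc a a' <= 0.
  by case: a a' => [k|] [l|] /=; rewrite ?lexx ?lerN10 //; exact: cost_in HC _.
have cA a a' : ~~ (A a && A a') -> cc a a' = 0.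
  case: a a' => [k|] [l|] //=; rewrite negb_and -!leNgt => far.
  have fo : Rad <= `|(lp k, lp l).1| \/ Rad <= `|(lp k, lp l).2| by case/orP: far; [left|right].
  by have [] := cost_supp HC fo.
have ss0 : 0 < nE^-1 * (s ^+ 2 * th) by rewrite !mulr_gt0 ?invr_gt0 ?exprn_gt0.
have t0 (e : E) : 0 <= nE^-1 by rewrite invr_ge0 ltW.
have t1 : \sum_(e : E) nE^-1 = 1 by rewrite sumr_const -mulr_natl mulfV // gt_eqF.
have := @coupling_drift R _ _ _ A snd (joint mu) (joint nu) (fun=> nE^-1) mv cc _ ss0
  (j0 _ mu0) (j0 _ nu0) _ t0 t1 cin cA.
rewrite !j1 mu1 nu1 => /(_ erefl)[Gh [Gh0 Ghm Ghn] Gle].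
(* The lattice components are summed out: the generator depends on the cells only. *)
pose pi j j' := \sum_a \sum_a' Gh (j, a) (j', a').
have piE (F : J -> J -> R) : \sum_z \sum_z' F z.1 z'.1 * Gh z z' = \sum_j \sum_j' pi j j' * F j j'.
  rewrite sum_prod; apply: eq_bigr => j _; rewrite exchange_big sum_prod /=.
  apply: eq_bigr => j' _; rewrite exchange_big mulr_suml /=; apply: eq_bigr => a _.
  by rewrite mulr_suml; apply: eq_bigr => a' _; rewrite mulrC.
have pim j : \sum_j' pi j j' = mu j.
  rewrite exchange_big /= -[RHS]mulr1 -(wt_sum j) mulr_sumr; apply: eq_bigr => a _.
  by rewrite -/(joint mu (j, a)) -Ghm sum_prod.
have pin j' : \sum_j pi j j' = nu j'.
  rewrite /pi; under eq_bigr do rewrite exchange_big /=.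
  rewrite exchange_big /= -[RHS]mulr1 -(wt_sum j') mulr_sumr; apply: eq_bigr => a _.
  by rewrite -/(joint nu (j', a)) -Ghn sum_prod.
have pi0 j j' : 0 <= pi j j' by apply: sumr_ge0 => a _; apply: sumr_ge0.
exists pi => //.
have supp (la : J -> R) z : joint la z != 0 -> wt z.1 z.2 != 0.
  by apply: contraNneq => w0; rewrite /joint w0 mulr0.
pose g j j' := gen C1 C2 (x j, x j') (b j) (b j') (S j) (S j').
pose sz j := size2 (b j) (S j).
have up : \sum_z \sum_z' (\sum_e nE^-1 * cc (mv e z) (mv e z') - cc z.2 z'.2) * Gh z z' <=
   \sum_j \sum_j' pi j j' * (nE^-1 * (s ^+ 2 * (g j j' + 6 * th * (sz j + sz j')) + nE * (K * h))).
  rewrite -piE; apply: ler_sum => z _; apply: ler_sum => z' _.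
  have [g0|gn] := eqVneq (Gh z z') 0; first by rewrite g0 !mulr0.
  rewrite ler_wpM2r //.
  have GC : coupling (joint mu) (joint nu) Gh by split.
  have [lem len] := coupling_le z z' GC.
  have gp : 0 < Gh z z' by rewrite lt_def gn Gh0.
  apply: (@bracket_le th r z z') => //; apply: supp.
    by apply: lt0r_neq0; exact: lt_le_trans gp lem.
  by apply: lt0r_neq0; exact: lt_le_trans gp len.
have errle la : prob la -> approx_stat e1 la ->
    \sum_(a | A a) Num.max 0 (\sum_e nE^-1 * \sum_(z | mv e z == a) joint la z
       - \sum_(z | z.2 == a) joint la z) <= nE^-1 * (s ^+ 2 * (e1 + 2 * th)).
  move=> [la0 la1] sla; rewrite big_mkcond sum_opt /= add0r -big_mkcond /=.
  apply: (le_trans (marginal_drift la0 la1 sla (fun k (Ak : (`|lp k| < Rad)) => Ak))).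
  rewrite ler_wpM2l ?invr_ge0 ?(ltW nE0) //.
  have -> : s ^+ 2 * (e1 + 2 * th) = s ^+ 2 * (e1 + th) + s ^+ 2 * th by ring.
  by apply: lerD => //; rewrite ler_wpM2l ?sqr_ge0 // lerD2l.
have em := errle _ (conj mu0 mu1) smu; have en := errle _ (conj nu0 nu1) snu.
have {up Gle} main := le_trans Gle up.
have pisum (F : J -> R) : \sum_j \sum_j' pi j j' * F j = \sum_j mu j * F j.
  by apply: eq_bigr => j _; rewrite -mulr_suml pim.
have pisum' (F : J -> R) : \sum_j \sum_j' pi j j' * F j' = \sum_j nu j * F j.
  by rewrite exchange_big /=; apply: eq_bigr => j _; rewrite -mulr_suml pin.
have tot (c : R) : \sum_j \sum_j' pi j j' * c = c.
  by rewrite (pisum (fun=> c)) -mulr_suml mu1 mul1r.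
have Eup : \sum_j \sum_j' pi j j' * (nE^-1 * (s ^+ 2 * (g j j' + 6 * th * (sz j + sz j')) + nE * (K * h)))
  = nE^-1 * (s ^+ 2 * (\sum_j \sum_j' pi j j' * g j j' + 6 * th * (\sum_j mu j * sz j + \sum_j nu j * sz j))
      + nE * (K * h)).
  pose al := nE^-1 * s ^+ 2; pose be := al * (6 * th).
  transitivity (\sum_j (al * (\sum_j' pi j j' * g j j') + be * (\sum_j' pi j j' * sz j)
     + be * (\sum_j' pi j j' * sz j') + \sum_j' pi j j' * (nE^-1 * (nE * (K * h))))).
    apply: eq_bigr => j _; rewrite !mulr_sumr -!big_split /=.
    by apply: eq_bigr => j' _; rewrite /be /al; ring.
  rewrite !big_split /= -!mulr_sumr pisum pisum' tot /be /al; ring.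
rewrite Eup in main.
move: main; rewrite -/(sz _); set X := \sum_j \sum_j' _; set Y := \sum_j _; set Y' := \sum_j nu j * _.
move=> main.
have s20 : 0 < s ^+ 2 by rewrite exprn_gt0.
(* All terms carry the factor [s ^ 2] over [nE]. Each marginal contributes [e1 + 2 th] (Taylor error
   and rounding), the slack of the optimal coupling another [th], and the rounding in the cost the
   sixth [th]. *)
have {main} : - (nE^-1 * (s ^+ 2 * (2 * e1 + 5 * th))) <=
     nE^-1 * (s ^+ 2 * (X + 6 * th * (Y + Y') + th)).
  apply: (@le_trans _ _ (nE^-1 * (s ^+ 2 * (X + 6 * th * (Y + Y')) + nE * (K * h)))).
    apply: le_trans main; rewrite lerN2.
    have -> : nE^-1 * (s ^+ 2 * (2 * e1 + 5 * th)) = nE^-1 * (s ^+ 2 * (e1 + 2 * th)) +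
       nE^-1 * (s ^+ 2 * (e1 + 2 * th)) + nE^-1 * (s ^+ 2 * th) by ring.
    by rewrite lerD2r lerD.
  rewrite ler_wpM2l ?invr_ge0 ?(ltW nE0) // [X in _ <= X]mulrDr lerD2l //.
rewrite -mulrN ler_pM2l ?invr_gt0 // -mulrN ler_pM2l //.
have : 6 * th * (Y + Y') <= 6 * th * (Q + Q).
  apply: ler_wpM2l; last exact: lerD.
  by apply: mulr_ge0 => //; exact: ltW.
have -> : 6 * th * (Q + Q) = 12 * th * Q by ring.
exact: combine_le.
Qed.

End Marginal.

Hypothesis B0 : 0 <= B.

Lemma discrete_coupling (mu nu : J -> R) (e1 th Q r : R) : 0 < th -> 0 < r ->
  (forall z z' v, `|z - z'| <= r ->
      `|C1 z v - C1 z' v| <= th * `|v| /\ `|C2 z v - C2 z' v| <= th * `|v| ^+ 2) ->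
  dl <= 1 / 4 -> dl <= r / 2 -> prob mu -> prob nu -> approx_stat e1 mu -> approx_stat e1 nu ->
  \sum_j mu j * size2 (b j) (S j) <= Q -> \sum_j nu j * size2 (b j) (S j) <= Q ->
  exists2 pi, coupling mu nu pi &
    - (2 * e1 + 6 * th + 12 * th * Q) <=
    \sum_j \sum_j' pi j j' * gen C1 C2 (x j, x j') (b j) (b j') (S j) (S j').
Proof.
move=> th0 r0 Hmod dl4 dlr pm pn smu snu Qmu Qnu.
pose P := K' * (B ^+ 2 + 2 * d1%:R * B ^+ 3).
have P0 : 0 <= P by rewrite mulr_ge0 // addr_ge0 ?exprn_ge0 // !mulr_ge0 // exprn_ge0.
have B1 : 0 < B + 1 by rewrite ltr_wpDl.
have P1 : 0 < P + 1 by rewrite ltr_wpDl.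
have divb (u c : R) a : 0 <= u -> 0 <= c -> a <= c / (u + 1) -> a * u <= c.
  move=> u0 c0 ac; apply: (@le_trans _ _ (c / (u + 1) * u)); first exact: ler_wpM2r.
  by rewrite mulrAC ler_pdivrMr ?ltr_wpDl // ler_wpM2l // lerDl.
(* The time step is chosen first. Dividing by [B + 1] and [P + 1] avoids a zero denominator. *)
have [|s s0 sl] := @small_real R [:: 1; (1 / 2) / (B + 1); r / (B + 1); th / (P + 1)].
  by move=> a; rewrite !inE => /or4P[] /eqP->; rewrite ?ltr01 ?divr_gt0.
have s1 : s <= 1 by apply: sl; rewrite !inE eqxx.
have sB : s * B <= 1 / 2 by apply: divb => //; apply: sl; rewrite !inE eqxx orbT.
have sr : s * B <= r by apply: divb => //; [exact: ltW|apply: sl; rewrite !inE eqxx !orbT].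
have sP : s * P <= th by apply: divb => //; [exact: ltW|apply: sl; rewrite !inE eqxx !orbT].
pose nE : R := #|{: option ('I_d1 * bool)}|%:R.
have st0 : 0 < s ^+ 2 * th by rewrite mulr_gt0 // exprn_gt0.
have n1 : 0 <= nE * K' by rewrite mulr_ge0.
have n2 : 0 <= nE * K by rewrite mulr_ge0.
(* The total rounding error must be at most [s ^ 2 * th], hence the dependence of [h] on [s]. *)
have [|h h0 hl] := @small_real R [:: 1 / 4; r / 2; s ^+ 2 * th / (nE * K' + 1); s ^+ 2 * th / (nE * K + 1)].
  by move=> a; rewrite !inE => /or4P[] /eqP->; rewrite ?divr_gt0 // ltr_wpDl.
have h4 : h <= 1 / 4 by apply: hl; rewrite !inE eqxx.
have hr : h <= r / 2 by apply: hl; rewrite !inE eqxx orbT.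
have hK' : h * (nE * K') <= s ^+ 2 * th.
  by apply: divb => //; [exact: ltW|apply: hl; rewrite !inE eqxx !orbT].
have hK : h * (nE * K) <= s ^+ 2 * th.
  by apply: divb => //; [exact: ltW|apply: hl; rewrite !inE eqxx !orbT].
(* The margin 3 covers moves of length at most 1, one mesh width, and the distance needed for the
   weights to sum to 1 up to radius [Rad + 1]. *)
pose N := (Num.truncn ((Rad + 3) / h)).+1.
have hN : Rad + 3 <= h * N%:R.
  by rewrite mulrC -ler_pdivrMr // ltW // truncnS_gt.
apply: (@coupling_gen h s N h0 h4 s0 s1 sB dl4 hN mu nu e1 th Q r) => //.
- by move: hr dlr; lra.
- by rewrite mulrA mulrC.
- by rewrite mulrA mulrC.
Qed.

End DiscreteCoupling.

(** * Bounds for the generator of the cost *)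

Section GeneratorBound.
Variables (R : realType) (d d1 : nat).
Local Notation V := 'rV[R]_d.
Implicit Types (x y u v b : V) (S : 'M[R]_(d, d1)).

Lemma enorm_sq n (u : 'rV[R]_n) : enorm u ^+ 2 = dotv u u.
Proof. by rewrite sqr_sqrtr // dotv_ge0. Qed.

Lemma enorm_ge0 n (u : 'rV[R]_n) : 0 <= enorm u.
Proof. exact: sqrtr_ge0. Qed.

Lemma dotvB n (u v w : 'rV[R]_n) : dotv u (v - w) = dotv u v - dotv u w.
Proof. by rewrite dotvD -scaleN1r dotvZ mulN1r. Qed.

Lemma cauchy_schwarz n (u v : 'rV[R]_n) : `|dotv u v| <= enorm u * enorm v.
Proof.
rewrite -(@ler_pXn2r _ 2) // ?nnegrE ?mulr_ge0 ?enorm_ge0 //.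
rewrite exprMn !enorm_sq real_normK ?num_real //.
have b0 := dotv_ge0 v; have a0 := dotv_ge0 u.
have := dotv_ge0 (dotv v v *: u - dotv u v *: v).
rewrite dotvB !dotvZ dotvC dotvB !dotvZ (dotvC (_ - _) v) dotvB !dotvZ (dotvC v u).
move: b0; rewrite le_eqVlt => /orP[/eqP b0 _|bp].
  have v0 i : v 0 i = 0.
    apply/eqP; rewrite -sqrf_eq0 expr2; apply/eqP.
    by apply: (psumr_eq0P (P := xpredT) (F := fun i => v 0 i * v 0 i)) => // j _; rewrite -expr2 sqr_ge0.
  by rewrite -b0 mulr0 /dotv big1 ?expr0n // => i _; rewrite v0 mulr0.
move: (dotv u u) (dotv v v) (dotv u v) bp => a c g c0 H.
have : 0 <= c * (a * c - g ^+ 2) by apply: le_trans H _; rewrite le_eqVlt; apply/orP; left; apply/eqP; ring.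
by rewrite pmulr_rge0 // subr_ge0.
Qed.

Lemma trace_scol S : \tr (S *m S^T) = \sum_m dotv (scol S m) (scol S m).
Proof.
rewrite /mxtrace; under eq_bigr do rewrite mxE.
rewrite exchange_big /=; apply: eq_bigr => m _; apply: eq_bigr => i _.
by rewrite !mxE.
Qed.

Lemma scolB S S' m : scol (S - S') m = scol S m - scol S' m.
Proof. by apply/rowP => i; rewrite !mxE. Qed.

Lemma hsnorm_sq S : hsnorm S ^+ 2 = \sum_m dotv (scol S m) (scol S m).
Proof. by rewrite sqr_sqrtr trace_scol // sumr_ge0 // => m _; exact: dotv_ge0. Qed.

Lemma dotvZZ n (c : R) (u : 'rV[R]_n) : dotv (c *: u) (c *: u) = c ^+ 2 * dotv u u.
Proof. by rewrite dotvZ dotvC dotvZ mulrA. Qed.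

(** Multiplication by the squared distance clears the normalised direction; the identity then also
    holds at [x = y], where both sides are 0. *)
Lemma rfunE (Sig : V -> 'M[R]_(d, d1)) x y : 
  dotv (x - y) (x - y) * rfun Sig x y =
  \sum_m dotv (x - y) (scol (Sig x) m - scol (Sig y) m) ^+ 2.
Proof.
rewrite /rfun enorm_sq dotvZZ exprVn enorm_sq mulrA.
have e m : dotv (x - y) (scol (Sig x) m - scol (Sig y) m) = ((x - y) *m (Sig x - Sig y)) 0 m.
  by rewrite mxE; apply: eq_bigr => i _; rewrite !mxE.
under eq_bigr do rewrite e.
have [r0|r0] := eqVneq (dotv (x - y) (x - y)) 0; last first.
  by rewrite mulfV // mul1r; apply: eq_bigr => m _; rewrite expr2.
have xy i : (x - y) 0 i = 0.
  apply/eqP; rewrite -sqrf_eq0 expr2; apply/eqP.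
  by apply: (psumr_eq0P (P := xpredT) (F := fun i => (x - y) 0 i * (x - y) 0 i)) => // j _; rewrite -expr2 sqr_ge0.
by rewrite r0 !mul0r big1 // => m _; rewrite mxE big1 ?expr0n // => i _; rewrite xy mul0r.
Qed.

Lemma rfun_ge0 (Sig : V -> 'M[R]_(d, d1)) x y : 0 <= rfun Sig x y.
Proof. exact: sqr_ge0. Qed.

Variables (eps Lam0 kap M : R).
Hypotheses (eps0 : 0 < eps) (Lam00 : 0 < Lam0) (kap0 : 0 < kap) (M0 : 0 < M).

Let A1 := cA1 eps Lam0.
Let A2 := cA2 eps Lam0.

(** The generator of the coupling applied to [cA] of the squared distance: the terms with the first
    derivative combine into q, the second derivative multiplies rho r. *)
Definition main_part (rho q r : R) : R := 2 * A1 rho * q + 4 * A2 rho * (rho * r).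

Lemma lep_le rho : 0 <= rho -> lep eps rho <= rho / eps.
Proof. by move=> r0; apply: le_ln1Dx; rewrite (lt_le_trans (ltrN10 _)) // divr_ge0 // ltW. Qed.

Lemma main_partE rho q r : 0 <= rho -> main_part rho q r =
  2 / (Lam0 * (rho + eps) ^+ 2) * ((1 + lep eps rho) * (rho + eps) * q - 2 * lep eps rho * (rho * r)).
Proof.
move=> r0; have p : rho + eps != 0 by rewrite gt_eqF // ltr_wpDl.
rewrite /main_part /A1 /A2 /cA1 /cA2; field.
by rewrite p gt_eqF.
Qed.

(** The inequality [q <= 2 * r] absorbs the term [l * rho * q] and leaves
    [q * (rho + eps + l * eps)]. Since ln (1 + t) <= t gives [l * eps <= rho], the Lambda bound
    estimates this by [2 * La * (rho + eps) ^ 2]. The logarithm has disappeared, so the division by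
    [Lam0] is a net gain. *)
Lemma main_le rho q r La : 0 <= rho -> 0 <= r -> 0 <= La -> q <= La * rho ->
  (0 < rho -> q <= 2 * r) -> main_part rho q r <= 4 / Lam0 * La.
Proof.
move=> rho0 r0 La0 qL qr; rewrite main_partE //.
have l0 := lep_ge0 eps0 rho0; have l1 := lep_le rho0.
have pe : 0 < rho + eps by rewrite ltr_wpDl.
have p2 : 0 < (rho + eps) ^+ 2 by rewrite exprn_gt0.
set l := lep eps rho in l0 l1 *.
have le : l * eps <= rho by rewrite -ler_pdivlMr.
rewrite (_ : 2 / _ * _ = 2 / Lam0 * (((1 + l) * (rho + eps) * q - 2 * l * (rho * r)) / (rho + eps) ^+ 2)); last first.
  by field; rewrite !gt_eqF.
rewrite (_ : 4 / Lam0 * La = 2 / Lam0 * (2 * La)); last by field; rewrite gt_eqF.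
rewrite ler_wpM2l ?divr_ge0 ?(ltW Lam00) // ler_pdivrMr //.
have lr : 0 <= l * rho by rewrite mulr_ge0.
have [q0|q0] := leP q 0.
  apply: (@le_trans _ _ 0); last by apply: mulr_ge0; [exact: mulr_ge0|exact: sqr_ge0].
  have : (1 + l) * (rho + eps) * q <= 0.
    by apply: mulr_ge0_le0 => //; apply: mulr_ge0; [exact: addr_ge0|exact: ltW].
  have : 0 <= 2 * l * (rho * r) by rewrite !mulr_ge0.
  lra.
have rhop : 0 < rho.
  by move: rho0; rewrite le_eqVlt => /orP[/eqP e|//]; move: qL; rewrite -e mulr0; lra.
have {}qr := qr rhop.
have h1 : l * rho * q <= l * rho * (2 * r) by rewrite ler_wpM2l.
have h2 : (1 + l) * (rho + eps) * q - 2 * l * (rho * r) <= q * (rho + eps + l * eps).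
  have -> : (1 + l) * (rho + eps) * q - 2 * l * (rho * r) =
     q * (rho + eps + l * eps) + (l * rho * q - l * rho * (2 * r)) by ring.
  lra.
apply: le_trans h2 _.
have h3 : q * (rho + eps + l * eps) <= La * rho * (rho + eps + rho).
  apply: ler_pM => //; [exact: ltW| |by rewrite lerD2l].
  by rewrite !addr_ge0 ?mulr_ge0 // ltW.
apply: le_trans h3 _; rewrite [2 * La]mulrC -!mulrA; apply: ler_wpM2l => //.
have : 0 < eps * rho by rewrite mulr_gt0.
rewrite expr2; nra.
Qed.

(** For [rho >= rho0] the logarithm [l] is at least [Lam0], and the gain is [l * rho * m]. The
    errors [l * eps * q] and [(rho + eps) * q] each consume at most a quarter of it, by the
    assumptions on [eps * Q] and on [8 * Q / m]. Since [l / Lam0 >= 1], the remaining half is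
    bounded independently of [eps]. *)
Lemma main_strict rho q r m Q rho0 rhoM : 0 < rho0 -> rho0 <= rho -> rho <= rhoM -> 0 < m ->
  `|q| <= Q -> m <= 2 * r - q -> eps <= rho0 -> eps * Q <= rho0 * m / 4 ->
  Lam0 = ln (1 + rho0 / eps) -> 8 * Q / m <= Lam0 ->
  main_part rho q r <= - (m / (4 * rhoM)).
Proof.
move=> r00 rr rM m0 qQ mr er eQ LE LQ.
have rp : 0 < rho by exact: lt_le_trans rr.
have rMp : 0 < rhoM by exact: lt_le_trans rM.
rewrite main_partE ?(ltW rp) //.
have Ll : Lam0 <= lep eps rho.
  have pp a : 0 < a -> 0 < 1 + a / eps by move=> a0; rewrite addr_gt0 // divr_gt0.
  rewrite LE /lep ler_ln ?posrE ?pp //.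
  by rewrite lerD2l ler_pM2r ?invr_gt0.
have l0 := lep_ge0 eps0 (ltW rp).
set l := lep eps rho in l0 Ll *.
have pe : 0 < rho + eps by rewrite addr_gt0.
have [q1 q2] : - Q <= q /\ q <= Q by move: qQ; rewrite ler_norml => /andP[].
have Q0 : 0 <= Q by exact: le_trans qQ.
have h1 : l * (eps * Q) <= l * (rho * m / 4).
  by rewrite ler_wpM2l // (le_trans eQ) // ler_pM2r ?invr_gt0 // ler_pM2r.
have h2 : (rho + eps) * Q <= rho * (l * m / 4).
  apply: (@le_trans _ _ (rho * (2 * Q))).
    by rewrite mulrA ler_wpM2r //; lra.
  rewrite ler_wpM2l ?(ltW rp) //.
  have : 8 * Q <= l * m by rewrite -ler_pdivrMr // (le_trans LQ).
  lra.
have h3 : (1 + l) * (rho + eps) * q - 2 * l * (rho * r) <= - (l * rho * m / 2).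
  have e1 : l * (eps * q) <= l * (eps * Q) by rewrite !ler_wpM2l // ltW.
  have e2 : (rho + eps) * q <= (rho + eps) * Q by rewrite ler_wpM2l // ltW.
  have e3 : l * (rho * m) <= l * (rho * (2 * r - q)) by rewrite !ler_wpM2l // ltW.
  have -> : (1 + l) * (rho + eps) * q - 2 * l * (rho * r) =
    - (l * (rho * (2 * r - q))) + l * (eps * q) + (rho + eps) * q by ring.
  have f1 : l * (rho * m / 4) = l * rho * m / 4 by ring.
  have f2 : rho * (l * m / 4) = l * rho * m / 4 by ring.
  have f3 : l * (rho * m) = l * rho * m by ring.
  move: h1 h2 e1 e2 e3; rewrite f1 f2 f3; lra.
have cp : 0 < 2 / (Lam0 * (rho + eps) ^+ 2) by rewrite divr_gt0 // mulr_gt0 // exprn_gt0.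
apply: (le_trans (ler_wpM2l (ltW cp) h3)).
rewrite mulrN lerN2.
rewrite (_ : 2 / _ * _ = (l / Lam0) * (rho * m / (rho + eps) ^+ 2)); last first.
  by field; rewrite !gt_eqF.
apply: (@le_trans _ _ (1 * (rho * m / (rho + eps) ^+ 2))); last first.
  by rewrite ler_wpM2r ?divr_ge0 ?sqr_ge0 ?mulr_ge0 ?(ltW rp) ?(ltW m0) // ler_pdivlMr // mul1r.
rewrite mul1r ler_pdivlMr ?exprn_gt0 // mulrAC ler_pdivrMr ?mulr_gt0 //.
have : (rho + eps) ^+ 2 <= (2 * rho) * (2 * rho).
  by rewrite expr2; apply: ler_pM; rewrite ?(ltW pe) //; lra.
have : rho * rho <= rho * rhoM by rewrite ler_wpM2l // ltW.
move=> h4 h5; have : m * (rho + eps) ^+ 2 <= m * (4 * (rho * rhoM)).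
  by rewrite ler_wpM2l ?(ltW m0) //; lra.
by move/le_trans; apply; rewrite le_eqVlt; apply/orP; left; apply/eqP; ring.
Qed.

Definition ga x b S : R := hsnorm S ^+ 2 / (1 + enorm x ^+ 2) + enorm b / (1 + enorm x).

Lemma ga_ge0 x b S : 0 <= ga x b S.
Proof.
have e := enorm_ge0 x; have f := enorm_ge0 b.
by rewrite addr_ge0 // divr_ge0 ?sqr_ge0 ?addr_ge0 ?sqr_ge0.
Qed.

(** The left side is the generator of ln (1 + |x|^2). Its concave part is dropped by sign;
    Cauchy-Schwarz and t / (1 + t^2) <= 2 / (1 + t) leave exactly the integrable weights. *)
Lemma lyapunov_le x b S :
  cB1 (dotv x x) * (2 * dotv x b) + \sum_m (cB2 (dotv x x) * (2 * dotv x (scol S m)) ^+ 2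
     + cB1 (dotv x x) * (2 * dotv (scol S m) (scol S m))) <= 4 * ga x b S.
Proof.
have s0 := dotv_ge0 x; have ex := enorm_ge0 x; have eb := enorm_ge0 b.
have p1 : 0 < 1 + dotv x x by rewrite ltr_wpDr.
have c1 : 0 <= cB1 (dotv x x) by rewrite invr_ge0 ltW.
apply: (@le_trans _ _ (2 * (cB1 (dotv x x) * (enorm x * enorm b)) +
   2 * (cB1 (dotv x x) * \sum_m dotv (scol S m) (scol S m)))).
  apply: lerD.
    rewrite mulrCA ler_wpM2l // ler_wpM2l //.
    exact: le_trans (ler_norm _) (cauchy_schwarz _ _).
  rewrite mulrA mulr_sumr; apply: ler_sum => m _.
  rewrite (_ : 2 * _ * _ = 0 + cB1 (dotv x x) * (2 * dotv (scol S m) (scol S m))); last by ring.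
  by rewrite lerD2r /cB2 mulNr oppr_le0 mulr_ge0 ?sqr_ge0 // invr_ge0 sqr_ge0.
rewrite -hsnorm_sq /ga /cB1 -enorm_sq.
have h0 : 0 <= hsnorm S ^+ 2 / (1 + enorm x ^+ 2) by rewrite divr_ge0 ?sqr_ge0 // addr_ge0 ?sqr_ge0.
have k : (1 + enorm x ^+ 2)^-1 * (enorm x * enorm b) <= 2 * (enorm b / (1 + enorm x)).
  have pe : 0 < 1 + enorm x by rewrite ltr_wpDr.
  rewrite -enorm_sq in p1.
  rewrite mulrC ler_pdivrMr //.
  have -> : 2 * (enorm b / (1 + enorm x)) * (1 + enorm x ^+ 2) =
    enorm b * (2 * (1 + enorm x ^+ 2)) / (1 + enorm x) by ring.
  rewrite ler_pdivlMr // [enorm x * _]mulrC -mulrA; apply: ler_wpM2l => //.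
  by move: ex; move: (enorm x) => e ex; nra.
rewrite [_^-1 * hsnorm S ^+ 2]mulrC; lra.
Qed.

(** Concavity of [cP] discards the squared gradient, and its monotonicity preserves bounds on the
    generator of [cu]. *)
Lemma gen_cost_le (Sig : V -> 'M[R]_(d, d1)) (bb : V -> V) x y :
  gen (cost1 eps Lam0 kap M) (cost2 eps Lam0 kap M) (x, y) (bb x) (bb y) (Sig x) (Sig y) <=
  cP1 M (cu eps Lam0 kap (x, y)) * (main_part (dotv (x - y) (x - y)) (qfun Sig bb x y) (rfun Sig x y)
    + 4 * kap * (ga x (bb x) (Sig x) + ga y (bb y) (Sig y))).
Proof.
have P1 : 0 <= cP1 M (cu eps Lam0 kap (x, y)) by rewrite mulr_ge0 ?divr_ge0 ?(ltW M0) // ppow_ge0.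
have P2 : cP2 M (cu eps Lam0 kap (x, y)) <= 0.
  by rewrite oppr_le0 mulr_ge0 ?divr_ge0 ?sqr_ge0 // ppow_ge0.
apply: (@le_trans _ _ (cP1 M (cu eps Lam0 kap (x, y)) * (cu1 eps Lam0 kap (x, y) (bb x, bb y) +
   \sum_m cu2 eps Lam0 kap (x, y) (scol (Sig x) m, scol (Sig y) m)))).
  rewrite /gen /cost1 /cost2 [leRHS]mulrDr lerD2l mulr_sumr; apply: ler_sum => m _.
  by rewrite gerDr mulr_le0_ge0 // sqr_ge0.
rewrite ler_wpM2l //.
have Lx := lyapunov_le x (bb x) (Sig x); have Ly := lyapunov_le y (bb y) (Sig y).
rewrite /cu1 /cu2 /gq1 /gq2 /qd0 /qd1 /qd2 /= big_split /= -mulr_sumr.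
set U := \sum_m _; set X := \sum_m _.
have eX : X = \sum_m (cB2 (dotv x x) * (2 * dotv x (scol (Sig x) m)) ^+ 2
     + cB1 (dotv x x) * (2 * dotv (scol (Sig x) m) (scol (Sig x) m))) +
   \sum_m (cB2 (dotv y y) * (2 * dotv y (scol (Sig y) m)) ^+ 2
     + cB1 (dotv y y) * (2 * dotv (scol (Sig y) m) (scol (Sig y) m))) by rewrite -big_split.
have eU : A1 (dotv (x - y) (x - y)) * (2 * dotv (x - y) (bb x - bb y)) + U =
    main_part (dotv (x - y) (x - y)) (qfun Sig bb x y) (rfun Sig x y).
  rewrite /main_part rfunE /qfun trace_scol.
  under [\sum_m dotv (scol (_ - _) m) _]eq_bigr do rewrite scolB.
  rewrite /U big_split /= -/A1 -/A2.
  under eq_bigr do rewrite exprMn mulrCA.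
  rewrite -mulr_sumr -mulr_sumr.
  under [X in _ + (_ + X)]eq_bigr do rewrite mulrCA.
  rewrite -!mulr_sumr; ring.
have kX : kap * X <= kap * (4 * ga x (bb x) (Sig x) + 4 * ga y (bb y) (Sig y)
     - cB1 (dotv x x) * (2 * dotv x (bb x)) - cB1 (dotv y y) * (2 * dotv y (bb y))).
  by rewrite ler_wpM2l ?(ltW kap0) // eX; lra.
rewrite -eU -/A1; move: kX; move: (ga x _ _) (ga y _ _) => gx gy; lra.
Qed.

Lemma gen_upper (Sig : V -> 'M[R]_(d, d1)) (bb : V -> V) (Lam : V -> R) x y :
  (forall x, 0 <= Lam x) ->
  (forall x y, qfun Sig bb x y <= (Lam x + Lam y) * enorm (x - y) ^+ 2) ->
  (forall x y, x != y -> qfun Sig bb x y < 2 * rfun Sig x y) ->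
  gen (cost1 eps Lam0 kap M) (cost2 eps Lam0 kap M) (x, y) (bb x) (bb y) (Sig x) (Sig y) <=
  3 / M * (4 / Lam0 * (Lam x + Lam y) + 4 * kap * (ga x (bb x) (Sig x) + ga y (bb y) (Sig y))).
Proof.
move=> L0 qL qr; apply: le_trans (gen_cost_le Sig bb x y) _.
have u0 := cu_ge0 eps Lam00 kap0 (x, y).
have pp : 0 <= ppow 2 (1 - cu eps Lam0 kap (x, y) / M) <= 1.
  rewrite ppow_ge0 /=; apply: exprn_ile1; first by rewrite le_max lexx.
  by rewrite ge_max ler01 gerBl divr_ge0 // ltW.
have ml : main_part (dotv (x - y) (x - y)) (qfun Sig bb x y) (rfun Sig x y) <= 4 / Lam0 * (Lam x + Lam y).
  apply: main_le; rewrite ?dotv_ge0 ?rfun_ge0 ?addr_ge0 //; first by rewrite -enorm_sq.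
  move=> rp; apply/ltW/qr; apply: contraTneq rp => ->.
  by rewrite subrr /dotv big1 ?ltxx // => i _; rewrite mxE mul0r.
rewrite /cP1 -[leLHS]mulrA ler_wpM2l ?divr_ge0 ?(ltW M0) //.
have g0 : 0 <= 4 * kap * (ga x (bb x) (Sig x) + ga y (bb y) (Sig y)).
  by apply: mulr_ge0; [apply: mulr_ge0 => //; exact: ltW | rewrite addr_ge0 ?ga_ge0].
have L4 : 0 <= 4 / Lam0 * (Lam x + Lam y) by apply: mulr_ge0; [apply: divr_ge0 => //; exact: ltW | exact: addr_ge0].
move: (main_part _ _ _) (ppow 2 _) pp ml => a p /andP[p0 p1] ml.
apply: (@le_trans _ _ (p * (4 / Lam0 * (Lam x + Lam y) + 4 * kap * (ga x (bb x) (Sig x) + ga y (bb y) (Sig y))))).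
  by rewrite ler_wpM2l // lerD2r.
by rewrite ler_piMl // addr_ge0.
Qed.

(** Where [cu] is at most [M / 2], the squared positive part in [cP1] is at least 1/4, so the
    truncation keeps a quarter of the negative bound. *)
Lemma gen_strict (Sig : V -> 'M[R]_(d, d1)) (bb : V -> V) (m1 : R) x y :
  0 <= m1 -> cu eps Lam0 kap (x, y) <= M / 2 ->
  main_part (dotv (x - y) (x - y)) (qfun Sig bb x y) (rfun Sig x y) <= - m1 ->
  gen (cost1 eps Lam0 kap M) (cost2 eps Lam0 kap M) (x, y) (bb x) (bb y) (Sig x) (Sig y) <=
  3 / M * (- (m1 / 4) + 4 * kap * (ga x (bb x) (Sig x) + ga y (bb y) (Sig y))).
Proof.
move=> m10 uM ml; apply: le_trans (gen_cost_le Sig bb x y) _.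
have u0 := cu_ge0 eps Lam00 kap0 (x, y).
have h : 1 / 2 <= 1 - cu eps Lam0 kap (x, y) / M <= 1.
  rewrite gerBl divr_ge0 ?(ltW M0) // andbT.
  have : cu eps Lam0 kap (x, y) / M <= 1 / 2 by rewrite ler_pdivrMr // mulrC mulrA mulr1.
  lra.
have pp : 1 / 4 <= ppow 2 (1 - cu eps Lam0 kap (x, y) / M) <= 1.
  case/andP: h => h1 h2; rewrite /ppow max_r; last by lra.
  by rewrite expr2; apply/andP; split; nra.
rewrite /cP1 -[leLHS]mulrA ler_wpM2l ?divr_ge0 ?(ltW M0) //.
have g0 : 0 <= 4 * kap * (ga x (bb x) (Sig x) + ga y (bb y) (Sig y)).
  by apply: mulr_ge0; [apply: mulr_ge0 => //; exact: ltW | rewrite addr_ge0 ?ga_ge0].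
move: (main_part _ _ _) (ppow 2 _) (4 * kap * _) pp ml g0 => a p g /andP[p0 p1] ml g0.
by nra.
Qed.

End GeneratorBound.

(** * Borel probabilities on a Euclidean space *)

Section RealProbability.
Context d (T : measurableType d) (R : realType) (mu : probability T R).
Implicit Types A B : set T.

Definition pr A : R := fine (mu A).

Lemma prE A : measurable A -> (pr A)%:E = mu A.
Proof. by move=> mA; rewrite fineK // fin_num_measure. Qed.

Lemma pr_ge0 A : 0 <= pr A.
Proof. exact: fine_ge0. Qed.

Lemma pr_le A B : measurable A -> measurable B -> A `<=` B -> pr A <= pr B.
Proof. by move=> mA mB AB; rewrite -lee_fin !prE // le_measure // inE. Qed.

Lemma prT : pr setT = 1. Proof. by rewrite /pr probability_setT. Qed.

Lemma prU A B : measurable A -> measurable B -> pr (A `|` B) <= pr A + pr B.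
Proof.
move=> mA mB; rewrite -lee_fin EFinD !prE //; last exact: measurableU.
exact: measureU2.
Qed.

Lemma pr_sigma (F : nat -> set T) (e : R) : 0 <= e -> (forall n, measurable (F n)) ->
  (forall n, pr (F n) <= e / (2 ^ n.+1)%:R) -> pr (\bigcup_n F n) <= e.
Proof.
move=> e0 mF Fe; have mU : measurable (\bigcup_n F n) by exact: bigcupT_measurable.
rewrite -lee_fin prE //.
apply: le_trans (epsilon_trick0 xpredT e0).
apply: (@le_trans _ _ (\sum_(n <oo) mu (F n))%E).
  exact: measure_sigma_subadditive.
by apply: lee_nneseries => // n _; rewrite -prE // lee_fin.
Qed.

Lemma pr_decr (F : nat -> set T) (e : R) : 0 < e -> (forall n, measurable (F n)) ->
  (forall n, F n.+1 `<=` F n) -> \bigcap_n F n = set0 -> exists n, pr (F n) <= e.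
Proof.
move=> e0 mF dF F0.
have : mu \o F @ \oo --> mu set0.
  rewrite -F0; apply: nonincreasing_cvg_mu => //.
  - by rewrite (le_lt_trans (probability_le1 _ _)) ?ltry.
  - exact: bigcapT_measurable.
  - by apply/nonincreasing_seqP => n; apply/subsetPset; exact: dF.
rewrite measure0 => /fine_cvgP[_ /cvgrPdist_le /(_ e e0)[n _ /(_ n (leqnn n))]] /=.
rewrite sub0r normrN => h; exists n; apply: le_trans h; exact: ler_norm.
Qed.

End RealProbability.

(** * Approximation by closed sets from inside and open sets from outside *)

Section Regularity.
Variables (R : realType) (d : nat).
Local Notation V := 'rV[R]_d.
Local Notation T := (Rd R d).

Lemma open_meas (A : set V) : open A -> measurable (A : set T).
Proof. by move=> oA; exact: sub_sigma_algebra. Qed.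

Lemma closed_meas (A : set V) : closed A -> measurable (A : set T).
Proof.
by move=> cA; rewrite -[A]setCK; apply: measurableC; apply: open_meas; exact: closed_openC.
Qed.

(** The points at distance at least 1/(n + 1) from the complement, written so as to make sense when
    the complement is empty. The gap is what the transport estimate needs. *)
Definition inner_part (U : set V) (n : nat) : set V :=
  [set x | forall y, `|x - y| < n.+1%:R^-1 -> U y].

Lemma inner_part_closed (U : set V) n : closed (inner_part U n).
Proof.
rewrite -[inner_part U n]setCK; apply: open_closedC; rewrite openE => x.
rewrite /inner_part /setC /= => /existsNP[y /not_implyP[xy nUy]].
pose e := n.+1%:R^-1 - `|x - y|.
have e0 : 0 < e by rewrite subr_gt0.
apply/nbhs_ballP; exists e => // z; rewrite -ball_normE /= => xz.
apply/existsNP; exists y; apply/not_implyP; split => //.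
by apply: le_lt_trans (ler_distD x z y) _; rewrite (distrC z x) -ltrBrDr.
Qed.

Lemma inner_part_sub (U : set V) n : inner_part U n `<=` U.
Proof. by move=> x; apply; rewrite subrr normr0 invr_gt0 ltr0n. Qed.

Lemma inner_part_mono (U : set V) n : inner_part U n `<=` inner_part U n.+1.
Proof.
move=> x h y xy; apply: h; apply: lt_le_trans xy _.
by rewrite lef_pV2 ?posrE ?ltr0n // ler_nat.
Qed.

Lemma inner_part_cover (U : set V) x : open U -> U x -> exists n, inner_part U n x.
Proof.
move=> oU Ux; have : nbhs x U by exact: open_nbhs_nbhs.
move=> /nbhs_ballP[e /= e0 eU]; have [n _ /(_ n (leqnn n)) ne] := near_infty_natSinv_lt (PosNum e0).
exists n => y xy; apply: eU; rewrite -ball_normE /=; exact: lt_trans xy ne.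
Qed.

Variable mu : probability T R.

Lemma inner_part_approx (U : set V) (e : R) : open U -> 0 < e ->
  exists n, pr mu (U `\` inner_part U n : set T) <= e.
Proof.
move=> oU e0; apply: (@pr_decr _ _ _ mu (fun n => U `\` inner_part U n)) => //.
- by move=> n; apply: measurableD; [exact: open_meas|apply: closed_meas; exact: inner_part_closed].
- by move=> n x [Ux nx]; split=> // h; apply: nx; exact: inner_part_mono.
- rewrite -subset0 => x h; have [Ux _] := h 0%N I.
  have [n xn] := inner_part_cover oU Ux.
  by have [_] := h n I; apply.
Qed.

Definition regular_set (A : set T) := forall e : R, 0 < e -> exists F U : set V,
  [/\ closed F, open U, F `<=` A, A `<=` U & pr mu (U `\` F : set T) <= e].

Lemma regular_open (A : set V) : open A -> regular_set A.
Proof.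
move=> oA e e0; have [n ne] := inner_part_approx oA e0.
exists (inner_part A n), A; split=> //; [exact: inner_part_closed|exact: inner_part_sub].
Qed.

Lemma regularC A : regular_set A -> regular_set (~` A).
Proof.
move=> rA e e0; have [F [U [cF oU FA AU UF]]] := rA e e0.
exists (~` U), (~` F); split.
- exact: open_closedC.
- exact: closed_openC.
- exact: subsetC.
- exact: subsetC.
- by rewrite setDE setCK setIC -setDE.
Qed.

Lemma regular_bigcup (A : nat -> set T) : (forall n, regular_set (A n)) ->
  regular_set (\bigcup_n A n).
Proof.
move=> rA e e0.
have en n : 0 < e / 2 / (2 ^ n.+1)%:R by rewrite !divr_gt0 // ltr0n expn_gt0.
have /choice[FU FUP] : forall n, exists FU : set V * set V,
    [/\ closed FU.1, open FU.2, FU.1 `<=` A n, A n `<=` FU.2 &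
      pr mu (FU.2 `\` FU.1 : set T) <= e / 2 / (2 ^ n.+1)%:R].
  by move=> n; have [F [U H]] := rA n _ (en n); exists (F, U).
pose F n := (FU n).1; pose U n := (FU n).2.
have cF n : closed (F n) by have [] := FUP n.
have oU n : open (U n) by have [] := FUP n.
have FA n : F n `<=` A n by have [] := FUP n.
have AU n : A n `<=` U n by have [] := FUP n.
have UF n : pr mu (U n `\` F n : set T) <= e / 2 / (2 ^ n.+1)%:R by have [] := FUP n.
have mF n : measurable (F n : set T) by exact: closed_meas.
have mU n : measurable (U n : set T) by exact: open_meas.
(* A countable union of closed sets need not be closed; a finite one loses at most [e / 2], by
   continuity of the measure. *)
pose FN N : set V := \big[setU/set0]_(i < N) F i.
have cFN N : closed (FN N) by apply: closed_bigsetU.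
have mBF : measurable (\bigcup_n F n : set T) by exact: bigcupT_measurable.
have mFN N : measurable (FN N : set T) by exact: closed_meas.
have [||||N NP] := @pr_decr _ _ _ mu (fun N => (\bigcup_n F n) `\` FN N) (e / 2).
- by rewrite divr_gt0.
- by move=> n; exact: measurableD.
- move=> n x [Fx nF]; split=> // h; apply: nF.
  by rewrite /FN big_ord_recr; left.
- rewrite -subset0 => x h; have [[n _ Fx] _] := h 0%N I.
  have [_] := h n.+1 I; apply; rewrite /FN big_ord_recr; by right.
exists (FN N), (\bigcup_n U n); split=> //.
- exact: bigcup_open.
- move=> x; rewrite /FN -bigcup_mkord => -[n _ Fx]; exists n => //; exact: FA.
- by move=> x [n _ Ax]; exists n => //; exact: AU.
have mUF : measurable (\bigcup_n (U n `\` F n) : set T).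
  by apply: bigcupT_measurable => n; exact: measurableD.
apply: (@le_trans _ _ (pr mu ((\bigcup_n (U n `\` F n)) `|` ((\bigcup_n F n) `\` FN N) : set T))).
  apply: pr_le.
  - by apply: measurableD => //; exact: bigcupT_measurable.
  - by apply: measurableU => //; exact: measurableD.
  - move=> x [[n _ Ux] nF]; have [Fx|nFx] := pselect (F n x).
      by right; split=> //; exists n.
    by left; exists n.
apply: (le_trans (prU _ mUF (measurableD mBF (mFN N)))).
rewrite [leRHS]splitr; apply: lerD => //.
apply: pr_sigma => //; first by rewrite divr_ge0 // ltW.
by move=> n; exact: measurableD.
Qed.

Lemma regular_measurable (A : set T) : measurable A -> regular_set A.
Proof.
apply: smallest_sub; last exact: regular_open.
split.
- by apply: regular_open; exact: open0.
- by move=> B; rewrite setTD; exact: regularC.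
- exact: regular_bigcup.
Qed.

End Regularity.

(** * Lusin's theorem for two measures and finitely many functions *)

Section Lusin.
Variables (R : realType) (d : nat).
Local Notation V := 'rV[R]_d.
Local Notation T := (Rd R d).
Variables (mu nu : probability T R).

Lemma regular_both (A : set T) (e : R) : measurable A -> 0 < e ->
  exists F U : set V, [/\ closed F, open U, F `<=` A, A `<=` U &
    pr mu (U `\` F : set T) <= e /\ pr nu (U `\` F : set T) <= e].
Proof.
move=> mA e0.
have [F1 [U1 [cF1 oU1 FA1 AU1 e1]]] := regular_measurable mu mA e0.
have [F2 [U2 [cF2 oU2 FA2 AU2 e2]]] := regular_measurable nu mA e0.
exists (F1 `|` F2), (U1 `&` U2); split.
- exact: closedU.
- exact: openI.
- by move=> x [/FA1|/FA2].
- by move=> x Ax; split; [exact: AU1|exact: AU2].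
have mD (F U : set V) : closed F -> open U -> measurable (U `\` F : set T).
  by move=> cF oU; apply: measurableD; [exact: open_meas|exact: closed_meas].
have m12 : measurable ((U1 `&` U2) `\` (F1 `|` F2) : set T).
  by apply: mD; [exact: closedU|exact: openI].
split; [apply: le_trans e1|apply: le_trans e2]; apply: pr_le => //; try exact: mD.
  by move=> x [[a b] nF]; split=> // h; apply: nF; left.
by move=> x [[a b] nF]; split=> // h; apply: nF; right.
Qed.

Lemma tight_ball (la : probability T R) (e : R) : 0 < e ->
  exists n : nat, pr la ([set x : V | n%:R < `|x|] : set T) <= e.
Proof.
move=> e0; apply: (@pr_decr _ _ _ la (fun n : nat => [set x : V | n%:R < `|x|])) => //.
- move=> n; apply: open_meas.
  rewrite (_ : [set x | _] = (fun x : V => `|x|) @^-1` [set r | n%:R < r]) //.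
  by apply: open_comp; [move=> x _; exact: norm_continuous | exact: open_gt].
- by move=> n x /=; apply: le_lt_trans; rewrite ler_nat.
- rewrite -subset0 => x h; have := h (Num.truncn `|x|).+1 I => /=.
  by rewrite ltNge ltW // truncnS_gt.
Qed.

(** Each preimage of a rational half-line lies between a closed and an open set with small
    difference. Off the countable union of the differences these preimages are relatively open,
    which is continuity; intersecting with a ball makes the set bounded. *)
Lemma lusin (I : finType) (f : I -> V -> R) (e : R) :
  (forall i, measurable_fun (setT : set T) (f i)) -> 0 < e ->
  exists S : set V, [/\ closed S, exists M : R, forall x, S x -> `|x| <= M,
    pr mu (~` S : set T) <= e, pr nu (~` S : set T) <= e &
    forall i, {within S, continuous (f i)}].
Proof.
move=> mf e0.
pose A (k : I * rat * bool) : set V :=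
  if k.2 then [set x | f k.1.1 x < ratr k.1.2] else [set x | ratr k.1.2 < f k.1.1 x].
have mA k : measurable (A k : set T).
  case: k => [[i q] b]; rewrite /A /=; case: b.
    rewrite (_ : [set x | _] = setT `&` f i @^-1` `]-oo, (ratr q : R)[%classic); last first.
      by rewrite setTI; apply/seteqP; split=> x /=; rewrite in_itv.
    exact: (mf i measurableT _ (measurable_itv _)).
  rewrite (_ : [set x | _] = setT `&` f i @^-1` `](ratr q : R), +oo[%classic); last first.
    by rewrite setTI; apply/seteqP; split=> x /=; rewrite in_itv /= andbT.
  exact: (mf i measurableT _ (measurable_itv _)).
pose e2 := e / 2; have e20 : 0 < e2 by rewrite divr_gt0.
pose An n : set V := if unpickle n is Some k then A k else set0.
have mAn n : measurable (An n : set T).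
  by rewrite /An; case: unpickle => [k|]; [exact: mA|exact: measurable0].
have /choice[FU FUP] : forall n, exists FU : set V * set V,
    [/\ closed FU.1, open FU.2, FU.1 `<=` An n, An n `<=` FU.2 &
      pr mu (FU.2 `\` FU.1 : set T) <= e2 / (2 ^ n.+1)%:R /\
      pr nu (FU.2 `\` FU.1 : set T) <= e2 / (2 ^ n.+1)%:R].
  move=> n; have [|F [U H]] := @regular_both (An n) (e2 / (2 ^ n.+1)%:R) (mAn n).
    by rewrite divr_gt0 // ltr0n expn_gt0.
  by exists (F, U).
pose F n := (FU n).1; pose U n := (FU n).2.
have [n1 n1P] := tight_ball mu e20; have [n2 n2P] := tight_ball nu e20.
pose B := [set x : V | `|x| <= (n1 + n2)%:R].
pose S0 := \bigcap_n ~` (U n `\` F n).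
have oD n : open (U n `\` F n).
  by have [cF oU _ _ _] := FUP n; rewrite setDE; apply: openI => //; exact: closed_openC.
have cB : closed B.
  apply: (@closed_comp _ _ (fun x : V => `|x|) [set r | r <= (n1 + n2)%:R]).
    by move=> x _; exact: norm_continuous.
  exact: closed_le.
have cS : closed (S0 `&` B).
  by apply: closedI => //; apply: closed_bigI => n _; exact: open_closedC.
have mass (la : probability T R) n0 : (n0 <= n1 + n2)%N ->
   pr la ([set x : V | n0%:R < `|x|] : set T) <= e2 ->
   (forall n, pr la (U n `\` F n : set T) <= e2 / (2 ^ n.+1)%:R) -> pr la (~` (S0 `&` B) : set T) <= e.
  move=> n0n le1 le2; rewrite setCI setC_bigcap.
  rewrite (eq_bigcupr (fun n _ => setCK (U n `\` F n))).
  have mU : measurable (\bigcup_n (U n `\` F n) : set T).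
    by apply: bigcupT_measurable => n; exact: open_meas.
  have mB : measurable (~` B : set T) by apply: measurableC; exact: closed_meas.
  apply: (le_trans (prU la mU mB)); rewrite [leRHS]splitr; apply: lerD.
    by apply: pr_sigma => //; [exact: ltW|move=> n; exact: open_meas].
  apply: le_trans le1; apply: pr_le => //.
    apply: open_meas; rewrite (_ : [set x | _] = (fun x : V => `|x|) @^-1` [set r | n0%:R < r]) //.
    by apply: open_comp; [move=> x _; exact: norm_continuous | exact: open_gt].
  move=> x /= /negP; rewrite -ltNge; apply: le_lt_trans.
  by rewrite ler_nat.
exists (S0 `&` B); split=> //.
- by exists (n1 + n2)%:R => x [].
- by apply: (mass mu n1 _ n1P); [exact: leq_addr|move=> n; have [_ _ _ _ []] := FUP n].
- by apply: (mass nu n2 _ n2P); [exact: leq_addl|move=> n; have [_ _ _ _ []] := FUP n].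
move=> i; apply/subspace_continuousP => x [S0x Bx].
have cut k : A k x -> \forall y \near within (S0 `&` B) (nbhs (x : V)), A k y.
  move=> Akx; have [cF oU FA AU _] := FUP (pickle k).
  have eA : An (pickle k) = A k by rewrite /An pickleK.
  rewrite near_withinE.
  have : nbhs x (U (pickle k)) by apply: open_nbhs_nbhs; split=> //; apply: AU; rewrite eA.
  apply: filterS => y Uy [S0y _]; rewrite -eA; apply: FA.
  have := S0y (pickle k) Logic.I; rewrite setDE setCI setCK => -[nU|//].
  by exfalso; apply: nU.
apply/cvgrPdist_le => eps eps0.
have [|q1 q1P] := @rat_in_itvoo R (f i x - eps) (f i x); first by rewrite ltrBlDr ltrDl.
have [|q2 q2P] := @rat_in_itvoo R (f i x) (f i x + eps); first by rewrite ltrDl.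
move: q1P q2P; rewrite !in_itv /= => /andP[a1 a2] /andP[a3 a4].
have c1 := cut (i, q1, false) a2; have c2 := cut (i, q2, true) a3.
near=> y.
have h1 : A (i, q1, false) y by near: y.
have h2 : A (i, q2, true) y by near: y.
move: h1 h2; rewrite /A /= => h1 h2; rewrite ler_norml; apply/andP; split.
  by rewrite lerBrDl lerBlDr (ltW (lt_trans h2 a4)).
by rewrite lerBlDl -lerBlDr (ltW (lt_trans a1 h1)).
Unshelve. all: by end_near. Qed.

End Lusin.

(** * Uniform strictness on the far pairs of a compact set *)

Section Positivity.
Variables (R : realType) (d d1 : nat).
Local Notation V := 'rV[R]_d.
Variables (Sig : V -> 'M[R]_(d, d1)) (b : V -> V) (S : set V).
Hypothesis cS : closed S.
Hypothesis bS : exists M : R, forall x, S x -> `|x| <= M.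
Hypothesis Sigc : forall i m, {within S, continuous (fun x => Sig x i m)}.
Hypothesis bc : forall i, {within S, continuous (fun x => b x 0 i)}.
Variable rho0 : R.
Hypothesis rho00 : 0 < rho0.
Hypothesis qr : forall x y, x != y -> qfun Sig b x y < 2 * rfun Sig x y.

Let K2 : set (V * V) := (S `*` S) `&` [set p | rho0 <= dotv (p.1 - p.2) (p.1 - p.2)].

Let cmpS : compact S.
Proof.
apply: bounded_closed_compact => //; have [M MP] := bS.
by exists M; split; [exact: num_real|move=> t Mt x Sx; exact: le_trans (MP x Sx) (ltW Mt)].
Qed.

Let cK2 : compact K2.
Proof.
apply: compact_closedI; first exact: compact_setX.
apply: (@closed_comp _ _ (fun p : V * V => dotv (p.1 - p.2) (p.1 - p.2)) [set r | rho0 <= r]).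
  have c : continuous (fun p : V * V => p.1 - p.2).
    by move=> p; apply: cvgB; [exact: cvg_fst|exact: cvg_snd].
  by move=> p _; exact: (dotv_continuous (c p) (c p)).
exact: closed_ge.
Qed.

Let within_fst (f : V -> R) : {within S, continuous f} ->
  continuous ((fun p : V * V => f p.1) : subspace K2 -> R).
Proof.
move/subspace_continuousP => fc; apply/subspace_continuousP => p [[S1 S2] _].
have fp := fc _ S1; move=> P Pn.
have nP : nbhs p.1 [set z | S z -> P (f z)] by exact: (fp P Pn).
rewrite /within /=.
have : nbhs p [set z : V * V | S z.1 -> P (f z.1)] by exact: (cvg_fst nP).
apply: filterS => z h Kz.
by apply: h; case: Kz => -[].
Qed.

Let within_snd (f : V -> R) : {within S, continuous f} ->
  continuous ((fun p : V * V => f p.2) : subspace K2 -> R).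
Proof.
move/subspace_continuousP => fc; apply/subspace_continuousP => p [[S1 S2] _].
have fp := fc _ S2; move=> P Pn.
have nP : nbhs p.2 [set z | S z -> P (f z)] by exact: (fp P Pn).
rewrite /within /=.
have : nbhs p [set z : V * V | S z.2 -> P (f z.2)] by exact: (cvg_snd nP).
apply: filterS => z h Kz.
by apply: h; case: Kz => -[].
Qed.

Let id_within i : {within S, continuous (fun x : V => x 0 i)}.
Proof. by apply: continuous_subspaceT => x; exact: coord_continuous. Qed.

Let diffc (f : V -> R) : {within S, continuous f} ->
  continuous ((fun p : V * V => f p.1 - f p.2) : subspace K2 -> R).
Proof.
move=> fc p.
exact: (continuousB (f := (fun p : V * V => f p.1) : subspace K2 -> R)
  (g := (fun p : V * V => f p.2) : subspace K2 -> R) (@within_fst f fc p) (@within_snd f fc p)).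
Qed.

Lemma sum_continuous (Tp : topologicalType) (I : finType) (F : I -> Tp -> R) :
  (forall i, continuous (F i)) -> continuous (fun p => \sum_i F i p).
Proof. by move=> Fc p; apply: (cvg_big add_continuous (nbhs_filter p)) => i _; exact: Fc. Qed.

Definition qexp (p : V * V) : R := \sum_i (p.1 0 i - p.2 0 i) * (b p.1 0 i - b p.2 0 i)
  + \sum_m \sum_i (Sig p.1 i m - Sig p.2 i m) * (Sig p.1 i m - Sig p.2 i m).
(** The product rho r rather than r itself: a polynomial in the coordinates and in the entries of
    Sigma, so continuity on the Lusin set is inherited. *)
Definition rexp (p : V * V) : R :=
  \sum_m ((\sum_i (p.1 0 i - p.2 0 i) * (Sig p.1 i m - Sig p.2 i m)) *
          (\sum_i (p.1 0 i - p.2 0 i) * (Sig p.1 i m - Sig p.2 i m))).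
Definition rhoexp (p : V * V) : R := \sum_i (p.1 0 i - p.2 0 i) * (p.1 0 i - p.2 0 i).

Lemma qexpE p : qexp p = qfun Sig b p.1 p.2.
Proof.
rewrite /qexp /qfun trace_scol; congr (_ + _).
  by apply: eq_bigr => i _; rewrite !mxE.
by apply: eq_bigr => m _; apply: eq_bigr => i _; rewrite !mxE.
Qed.

Lemma rexpE p : rexp p = dotv (p.1 - p.2) (p.1 - p.2) * rfun Sig p.1 p.2.
Proof.
rewrite rfunE; apply: eq_bigr => m _; rewrite expr2.
by congr (_ * _); apply: eq_bigr => i _; rewrite !mxE.
Qed.

Lemma rhoexpE p : rhoexp p = dotv (p.1 - p.2) (p.1 - p.2).
Proof. by apply: eq_bigr => i _; rewrite !mxE. Qed.

Let prodc (f g : subspace K2 -> R) : continuous f -> continuous g ->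
  continuous ((fun p => f p * g p) : subspace K2 -> R).
Proof. by move=> fc gc p; exact: (continuousM (fc p) (gc p)). Qed.

Let qexpc : continuous (qexp : subspace K2 -> R).
Proof.
move=> p; apply: continuousD; move: p.
  apply: sum_continuous => i; apply: prodc; [exact: (@diffc (fun x : V => x 0 i) (@id_within i))|exact: (@diffc (fun x : V => b x 0 i) (bc (i:=i)))].
apply: sum_continuous => m; apply: sum_continuous => i.
by apply: prodc; exact: (@diffc (fun x : V => Sig x i m) (Sigc (i:=i) (m:=m))).
Qed.

Let rexpc : continuous (rexp : subspace K2 -> R).
Proof.
apply: sum_continuous => m; apply: prodc; apply: sum_continuous => i;
  by apply: prodc; [exact: (@diffc (fun x : V => x 0 i) (@id_within i))|exact: (@diffc (fun x : V => Sig x i m) (Sigc (i:=i) (m:=m)))].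
Qed.

Let rhoexpc : continuous (rhoexp : subspace K2 -> R).
Proof. by apply: sum_continuous => i; apply: prodc; exact: (@diffc (fun x : V => x 0 i) (@id_within i)). Qed.

Lemma compact_strict : exists m Q rhoM : R, [/\ 0 < m, 0 < rhoM &
  forall x y, S x -> S y -> rho0 <= dotv (x - y) (x - y) ->
    [/\ m <= 2 * rfun Sig x y - qfun Sig b x y, `|qfun Sig b x y| <= Q &
        dotv (x - y) (x - y) <= rhoM]].
Proof.
have [K0|/set0P K0] := eqVneq K2 set0.
  exists 1, 0, 1; split=> // x y Sx Sy h.
  by have : K2 (x, y) by []; rewrite K0.
have pneg (f : subspace K2 -> R) : continuous f -> continuous ((fun p => - f p) : subspace K2 -> R).
  by move=> fc p; exact: (continuousN (fc p)).
have [pQ _ Qmax] : exists2 c, c \in K2 & forall p, p \in K2 -> `|qexp p| <= `|qexp c|.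
  apply: (@compact_EVT_max _ _ (fun p : V * V => `|qexp p|)) => // p.
  exact: (continuous_comp (qexpc (x := p)) (@norm_continuous _ _ _)).
have [pR _ Rmax] : exists2 c, c \in K2 & forall p, p \in K2 -> rhoexp p <= rhoexp c.
  by apply: compact_EVT_max.
(* This is rho (2 r - q). Its minimum over the compact set is attained, hence positive; dividing it
   by an upper bound of rho bounds 2 r - q from below. *)
pose N p := rexp p * 2 - rhoexp p * qexp p.
have [pN pNK Nmin] : exists2 c, c \in K2 & forall p, p \in K2 -> N c <= N p.
  have Nc : continuous (N : subspace K2 -> R).
    have c1 : continuous ((fun p => rexp p * 2) : subspace K2 -> R).
      by apply: prodc => // p; exact: cst_continuous.
    by move=> p; exact: (continuousB (c1 p) (@prodc _ _ rhoexpc qexpc p)).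
  exact: compact_EVT_min.
have NE p : N p = rhoexp p * (2 * rfun Sig p.1 p.2 - qfun Sig b p.1 p.2).
  by rewrite /N rexpE rhoexpE qexpE; ring.
have rpos p : p \in K2 -> rho0 <= rhoexp p by rewrite inE rhoexpE => -[].
have N0 : 0 < N pN.
  rewrite NE; apply: mulr_gt0; first exact: lt_le_trans (rpos _ pNK).
  rewrite subr_gt0; apply: qr; apply/eqP => e.
  have := rpos _ pNK; rewrite rhoexpE e subrr /dotv big1 ?leNgt ?rho00 // => i _.
  by rewrite mxE mul0r.
have rM0 : 0 < `|rhoexp pR| + 1 by rewrite ltr_wpDl.
exists (N pN / (`|rhoexp pR| + 1)), `|qexp pQ|, (`|rhoexp pR| + 1); split=> //.
  exact: divr_gt0.
move=> x y Sx Sy h; have xyK : (x, y) \in K2 by rewrite inE.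
have rle : dotv (x - y) (x - y) <= `|rhoexp pR| + 1.
  rewrite -(rhoexpE (x, y)); apply: le_trans (Rmax _ xyK) _.
  by apply: le_trans (ler_norm _) _; rewrite lerDl.
split=> //; last by rewrite -(qexpE (x, y)); exact: Qmax.
have rp : 0 < dotv (x - y) (x - y) by exact: lt_le_trans h.
have := Nmin _ xyK; rewrite (NE (x, y)) rhoexpE /= => le.
have t0 : 0 <= 2 * rfun Sig x y - qfun Sig b x y.
  by rewrite -(pmulr_rge0 _ rp); apply: le_trans le; exact: ltW.
rewrite ler_pdivrMr //; apply: le_trans le _.
by rewrite mulrC ler_wpM2l.
Qed.

End Positivity.

(** * Means and finite measurable partitions *)

Section Expectation.
Context d (T : measurableType d) (R : realType) (mu : probability T R).
Local Open Scope ereal_scope.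

Definition has_mean (f : T -> R) := mu.-integrable setT (EFin \o f).
Definition mean (f : T -> R) : R := (\int[mu]_x f x)%R.

Lemma has_mean_meas f : has_mean f -> measurable_fun setT f.
Proof. by move=> /integrableP[/measurable_EFinP]. Qed.

Lemma has_mean_cst (c : R) : has_mean (fun=> c).
Proof. exact: finite_measure_integrable_cst. Qed.

Lemma mean_cst (c : R) : mean (fun=> c) = c.
Proof. by rewrite /mean Rintegral_cst // -[fine _]/(pr mu setT) prT mulr1. Qed.

Lemma has_meanD f g : has_mean f -> has_mean g -> has_mean (fun x => f x + g x)%R.
Proof. by move=> sf sg; have := integrableD measurableT sf sg. Qed.

Lemma meanD f g : has_mean f -> has_mean g -> mean (fun x => f x + g x)%R = (mean f + mean g)%R.
Proof. exact: RintegralD. Qed.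

Lemma has_meanZ (c : R) f : has_mean f -> has_mean (fun x => c * f x)%R.
Proof. by move=> sf; have := integrableZl measurableT c sf. Qed.

Lemma meanZ (c : R) f : has_mean f -> mean (fun x => c * f x)%R = (c * mean f)%R.
Proof. by move=> sf; exact: RintegralZl. Qed.

Lemma le_mean f g : has_mean f -> has_mean g -> (forall x, f x <= g x)%R -> (mean f <= mean g)%R.
Proof. by move=> sf sg fg; apply: le_Rintegral => // x _; exact: fg. Qed.

Lemma mean_ge0 f : (forall x, 0 <= f x)%R -> (0 <= mean f)%R.
Proof. by move=> f0; apply: Rintegral_ge0. Qed.

Lemma has_mean_le (f g : T -> R) : measurable_fun setT f -> has_mean g -> (forall x, `|f x| <= g x)%R -> has_mean f.
Proof.
move=> mf sg fg; apply: le_integrable sg => //; first exact/measurable_EFinP.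
by move=> x _ /=; rewrite lee_fin (le_trans (fg x)) // ler_norm.
Qed.

Lemma has_mean_lt_pinfty (f : T -> R) : measurable_fun setT f -> (forall x, 0 <= f x)%R ->
  \int[mu]_x (f x)%:E < +oo -> has_mean f.
Proof.
move=> mf f0 fi; apply/integrableP; split; first exact/measurable_EFinP.
by under eq_integral do rewrite /= ger0_norm //.
Qed.

Lemma has_mean_indic A : measurable A -> has_mean (\1_A : T -> R).
Proof. by move=> mA; apply: integrable_indic => //; exact: fin_num_measure. Qed.

Lemma mean_indic A : measurable A -> mean (\1_A : T -> R) = pr mu A.
Proof. by move=> mA; rewrite /mean /Rintegral integral_indic // setIT. Qed.

Section Cell.
Variables (J : finType) (cell : T -> J).
Hypothesis mcell : forall j, measurable [set x | cell x = j].

Let decomp (F : J -> R) x : F (cell x) = (\sum_j F j * (\1_[set x | cell x = j] : T -> R) x)%R.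
Proof.
rewrite (bigD1 (cell x)) //= indicE mem_set // mulr1 big1 ?addr0 // => j jx.
rewrite indicE memNset ?mulr0 //= => e; by rewrite e eqxx in jx.
Qed.

Lemma has_mean_cell (F : J -> R) : has_mean (fun x => F (cell x)).
Proof.
rewrite /has_mean (_ : EFin \o _ = fun x => \sum_j (F j * (\1_[set x | cell x = j] : T -> R) x)%:E).
  by apply: integrable_sum => // j _; apply: has_meanZ; exact: has_mean_indic.
by apply/funext => x; rewrite sumEFin -decomp.
Qed.

Lemma mean_cell (F : J -> R) : mean (fun x => F (cell x)) = (\sum_j pr mu [set x | cell x = j] * F j)%R.
Proof.
rewrite /mean /Rintegral (_ : (fun x => _) =
    fun x => \sum_j (F j * (\1_[set x | cell x = j] : T -> R) x)%:E); last first.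
  by apply/funext => x; rewrite sumEFin -decomp.
rewrite integral_sum //; last by move=> j; apply: has_meanZ; exact: has_mean_indic.
rewrite (eq_bigr (fun j => (pr mu [set x | cell x = j] * F j)%:E)) ?sumEFin // => j _.
under eq_integral do rewrite EFinM.
rewrite integralZl //; last exact: has_mean_indic.
by rewrite integral_indic // setIT [X in _ = X%:E]mulrC EFinM prE.
Qed.

Lemma cell_prob : prob (fun j => pr mu [set x | cell x = j]).
Proof.
split=> [j|]; first exact: pr_ge0.
have := mean_cell (fun=> 1%R); rewrite mean_cst => ->.
by apply: eq_bigr => j _; rewrite mulr1.
Qed.

End Cell.

Definition excess (W : T -> R) (B : R) : T -> R := fun x => (W x * (\1_[set x | B < W x]%R : T -> R) x)%R.

Lemma excessE W B x : excess W B x = (if (B < W x)%R then W x else 0%R).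
Proof.
by rewrite /excess indicE; case: ifPn => h; [rewrite mem_set ?mulr1|rewrite memNset ?mulr0 //=; exact/negP].
Qed.

Lemma gt_meas (W : T -> R) (B : R) : measurable_fun setT W -> measurable [set x | B < W x]%R.
Proof.
move=> mW; rewrite (_ : [set x | _] = setT `&` W @^-1` `]B, +oo[%classic); last first.
  by rewrite setTI; apply/seteqP; split=> x /=; rewrite in_itv /= andbT.
exact: (mW measurableT _ (measurable_itv _)).
Qed.

Lemma excess_has_mean W B : has_mean W -> (forall x, 0 <= W x)%R -> has_mean (excess W B).
Proof.
move=> sW W0; have mW := has_mean_meas sW; apply: has_mean_le sW _.
  by apply: measurable_funM => //; apply: measurable_indic; exact: gt_meas.
by move=> x; rewrite excessE; case: ifP; rewrite ?normr0 ?ger0_norm.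
Qed.

Lemma excess_small W (e : R) : has_mean W -> (forall x, 0 <= W x)%R -> (0 < e)%R ->
  exists B0, forall B, (B0 <= B)%R -> (mean (excess W B) <= e)%R.
Proof.
move=> sW W0 e0; have mW := has_mean_meas sW.
have [|||||_ _] := @dominated_convergence _ T R mu setT measurableT
  (fun n x => (excess W n%:R x)%:E) (cst 0) (EFin \o W).
- by move=> n; apply/measurable_EFinP; exact: (has_mean_meas (excess_has_mean _ sW W0)).
- exact: measurable_cst.
- apply: aeW => x _; apply: cvg_near_cst; exists (Num.truncn (W x)).+1 => // n /= nx.
  rewrite excessE ltNge (_ : (W x <= n%:R)%R) //.
  by rewrite (le_trans (ltW (truncnS_gt _))) // ler_nat.
- exact: sW.
- apply: aeW => x n _; rewrite lee_fin excessE; case: ifP; rewrite ?normr0 ?ger0_norm //.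
rewrite integral_cst // mul0e => /fine_cvgP[_ /cvgrPdist_le /(_ e e0)[n _ /(_ n (leqnn n))]] /=.
rewrite sub0r normrN => h; exists n%:R => B nB.
apply: le_trans (le_trans (ler_norm _) h); apply: le_mean.
- exact: excess_has_mean.
- exact: excess_has_mean.
- move=> x; rewrite !excessE; case: ifPn => [BW|_]; last by case: ifP.
  by rewrite (le_lt_trans nB BW).
Qed.

End Expectation.

(** * Finite partitions with small oscillation *)

Section Cells.
Context d (T : measurableType d) (R : realType).

(** The cell of a point is the vector of its memberships. *)
Lemma finite_cells (I : finType) (A : I -> set T) : (forall i, measurable (A i)) ->
  exists (J : finType) (cell : T -> J), (forall j, measurable [set x | cell x = j]) /\
    forall x y, cell x = cell y -> forall i, A i x -> A i y.
Proof.
move=> mA; exists {ffun I -> bool}, (fun x => [ffun i => x \in A i]); split.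
  move=> j; rewrite (_ : [set x | _] = \big[setI/setT]_i (if j i then A i else ~` A i)).
    by apply: bigsetI_measurable => i _; case: (j i) => //; exact: measurableC.
  apply/seteqP; split=> x.
    move=> <-; rewrite -bigcap_seq /= => i _; rewrite /= ffunE.
    by case: ifPn => [/set_mem//|/negP h Ax]; apply: h; exact: mem_set.
  rewrite -bigcap_seq /= => h; apply/ffunP => i; rewrite ffunE.
  have := h i (mem_index_enum i); case: (j i) => /= Ax; first by rewrite mem_set.
  by rewrite memNset.
by move=> x y /ffunP e i Ax; have := e i; rewrite !ffunE mem_set // => /esym/set_mem.
Qed.

(* The sets [g i > - B + k tau] cut the range of each [g i] into slices. *)
Lemma fine_cells (I I' : finType) (A : I -> set T) (g : I' -> T -> R) (D : set T) (B tau : R) :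
  (forall i, measurable (A i)) -> (forall i, measurable_fun setT (g i)) ->
  (forall i x, D x -> `|g i x| <= B) -> 0 < tau ->
  exists (J : finType) (cell : T -> J), [/\ forall j, measurable [set x | cell x = j],
    forall x y, cell x = cell y -> forall i, A i x -> A i y &
    forall x y, cell x = cell y -> D x -> D y -> forall i, `|g i x - g i y| <= tau].
Proof.
move=> mA mg gB t0; pose n := (Num.truncn (2 * B / tau)).+2.
pose A' (i : I + I' * 'I_n) : set T := match i with
  | inl i => A i | inr (i, k) => [set x | - B + k%:R * tau < g i x] end.
have [|J [cell [mc cA]]] := @finite_cells _ A'.
  by case=> [i|[i k]] //=; exact: gt_meas.
exists J, cell; split=> //; first by move=> x y e i; exact: (cA _ _ e (inl i)).
move=> x y e Dx Dy i.
wlog le : x y e Dx Dy / g i x <= g i y.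
  move=> h; have [|/ltW] := leP (g i x) (g i y); first exact: h.
  by rewrite distrC; exact: h.
rewrite ler0_norm ?subr_le0 // opprB leNgt; apply/negP => lt.
have [x1 _] : - B <= g i x /\ g i x <= B by move: (gB i x Dx); rewrite ler_norml => /andP[].
have [_ y2] : - B <= g i y /\ g i y <= B by move: (gB i y Dy); rewrite ler_norml => /andP[].
(* The first threshold above [g i x]; a gap larger than [tau] would place it strictly between the
   two values. *)
pose k := (Num.truncn ((g i x + B) / tau)).+1.
have k1 : g i x + B < k%:R * tau by rewrite -ltr_pdivrMr // truncnS_gt.
have k2 : k%:R * tau <= g i x + B + tau.
  rewrite /k -natr1 mulrDl mul1r lerD2r -ler_pdivlMr // truncn_le.
  by rewrite divr_ge0 ?(ltW t0) //; move: x1; lra.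
have kn : (k < n)%N.
  rewrite -(ltr_nat R); apply: (@le_lt_trans _ _ (2 * B / tau)).
    rewrite ler_pdivlMr //; move: k2 lt y2; lra.
  by apply: lt_trans (truncnS_gt _) _; rewrite ltr_nat.
have := cA _ _ (esym e) (inr (i, Ordinal kn)); rewrite /= => h.
have : - B + k%:R * tau < g i x by apply: h; move: k2 lt; lra.
by move: k1; lra.
Qed.

End Cells.

Section ContinuousMeasurable.
Variables (R : realType) (d : nat).
Local Notation V := 'rV[R]_d.
Local Notation T := (Rd R d).

Lemma continuous_meas (f : V -> R) : continuous f -> measurable_fun (setT : set T) f.
Proof.
move=> fc; apply: (measurability _ (RGenOInfty.measurableE R)) => _ [_ [x ->] <-].
apply: measurableI => //; apply: open_meas; apply: open_comp.
  by move=> y _; exact: fc.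
by rewrite set_itvoy; exact: open_gt.
Qed.

End ContinuousMeasurable.

(** * Discretising a solution *)

Section Stationarity.
Variables (R : realType) (d d1 : nat).
Local Notation V := 'rV[R]_d.
Local Notation T := (Rd R d).

Lemma scol_norm_le (S : 'M[R]_(d, d1)) : \sum_m `|scol S m| ^+ 2 <= hsnorm S ^+ 2.
Proof. by rewrite hsnorm_sq; apply: ler_sum => m _; exact: sq_norm_le. Qed.

Lemma norm_le_enorm (u : V) : `|u| <= enorm u.
Proof.
by rewrite -(ler_pXn2r (n := 2)) ?nnegrE ?enorm_ge0 // enorm_sq sq_norm_le.
Qed.

Lemma dotv_le (r : R) (x : V) : `|x| <= r -> dotv x x <= d%:R * r ^+ 2.
Proof.
move=> xr; have r0 : 0 <= r by exact: le_trans xr.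
apply: (@le_trans _ _ (\sum_(i < d) r ^+ 2)).
  apply: ler_sum => i _; rewrite -expr2 -real_normK ?num_real // lerXn2r ?nnegrE //.
  by rewrite (le_trans (coord_le _ _)).
by rewrite sumr_const card_ord -(mulr_natl (r ^+ 2)).
Qed.

Lemma size2_le (r : R) (x b : V) (S : 'M[R]_(d, d1)) : `|x| <= r ->
  size2 b S <= (2 + d%:R * r ^+ 2) * ga x b S.
Proof.
move=> xr; have ex := enorm_ge0 x; have eb := enorm_ge0 b.
have e2 : enorm x ^+ 2 <= d%:R * r ^+ 2 by rewrite enorm_sq dotv_le.
have p2 : 0 < 1 + enorm x ^+ 2 by rewrite ltr_pwDl // sqr_ge0.
have p1 : 0 < 1 + enorm x by rewrite ltr_pwDl.
rewrite /size2 /ga addrC mulrDr; apply: lerD.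
  apply: le_trans (scol_norm_le S) _.
  rewrite mulrA ler_pdivlMr // mulrC ler_wpM2r ?sqr_ge0 //; lra.
apply: le_trans (norm_le_enorm b) _.
rewrite mulrA ler_pdivlMr // mulrC ler_wpM2r //.
by move: e2; move: (enorm x) ex => e ex; nra.
Qed.

Section Measurable.
Variables (Sig : V -> 'M[R]_(d, d1)) (b : V -> V) (Lam : V -> R).
Hypothesis mSig : forall i m, measurable_fun (setT : set T) (fun x => Sig x i m).
Hypothesis mb : forall i, measurable_fun (setT : set T) (fun x => b x 0 i).
Hypothesis mLam : measurable_fun (setT : set T) Lam.

Lemma enorm_continuous : continuous (fun x : V => enorm x).
Proof.
move=> x; apply: (continuous_comp (f := fun x : V => dotv x x)); last exact: sqrt_continuous.
by apply: dotv_continuous; exact: cvg_id.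
Qed.

Lemma meas_sum (I : finType) (f : I -> V -> R) :
  (forall i, measurable_fun (setT : set T) (f i)) -> measurable_fun (setT : set T) (fun x => \sum_i f i x).
Proof. by move=> mf; apply: measurable_sum. Qed.

Lemma inv1D_continuous (f : V -> R) : continuous f -> (forall x, 0 <= f x) ->
  continuous (fun x => (1 + f x)^-1).
Proof.
move=> fc f0 x; have n0 : 1 + f x != 0 by rewrite gt_eqF // ltr_pwDl.
apply: (@continuousV _ _ (fun x => 1 + f x) x n0).
have c1 : {for x, continuous (fun _ : V => 1 : R)} by exact: cst_continuous.
exact: (continuousD c1 (fc x)).
Qed.

Lemma total_meas : measurable_fun (setT : set T) (fun x => ga x (b x) (Sig x) + Lam x).
Proof.
apply: measurable_funD => //; apply: measurable_funD.
  apply: measurable_funM; last first.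
    apply: continuous_meas; apply: inv1D_continuous => x; last exact: sqr_ge0.
    exact: (continuousM (@enorm_continuous x) (@enorm_continuous x)).
  rewrite (_ : (fun x => _) = fun x => \sum_m \sum_i Sig x i m * Sig x i m).
    by apply: meas_sum => m; apply: meas_sum => i; exact: measurable_funM.
  apply/funext => x; rewrite hsnorm_sq; apply: eq_bigr => m _; apply: eq_bigr => i _.
  by rewrite !mxE.
apply: measurable_funM; last first.
  apply: continuous_meas; apply: inv1D_continuous => x; first exact: enorm_continuous.
  exact: enorm_ge0.
rewrite (_ : (fun x => _) = Num.sqrt \o (fun x => dotv (b x) (b x))) //.
apply: measurableT_comp.
  by apply: continuous_measurable_fun; exact: sqrt_continuous.
by apply: meas_sum => i; exact: measurable_funM.
Qed.

Lemma jets_meas (dl : R) G (h : R) N n (phi : {ffun 'I_d -> 'I_n} -> R) :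
  0 < dl -> (forall n (s : R), is_derive s 1 (G n) (G n.+1 s)) ->
  measurable_fun (setT : set T) (fun x => \sum_m tf2 G h N phi x (scol (Sig x) m) + tf1 G h N phi x (b x)).
Proof.
move=> dl0 Gd; have mt a : measurable_fun (setT : set T) (tfun G h N phi a).
  by apply: continuous_meas; exact: tfun_continuous.
apply: measurable_funD.
  apply: meas_sum => m; apply: meas_sum => i; apply: measurable_funM.
    by under eq_fun do rewrite mxE; exact: mSig.
  apply: meas_sum => j; apply: measurable_funM => //.
  by under eq_fun do rewrite mxE; exact: mSig.
by apply: meas_sum => i; exact: measurable_funM.
Qed.

End Measurable.

End Stationarity.

(** * Stationarity after freezing the coefficients on cells *)

Section ApproxStationarity.
Variables (R : realType) (d d1 : nat).
Local Notation V := 'rV[R]_d.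
Local Notation T := (Rd R d).

Lemma jet_size2 (K' : R) f f1 f2 (x b : V) (S : 'M[R]_(d, d1)) : jet_bounds K' f f1 f2 ->
  `|\sum_m f2 x (scol S m) + f1 x b| <= K' * size2 b S.
Proof.
move=> JB; rewrite /size2 addrC mulrDr; apply: le_trans (ler_normD _ _) _; apply: lerD.
  exact: jet1_le JB _ _.
rewrite mulr_sumr; apply: le_trans (ler_norm_sum _ _ _) _.
by apply: ler_sum => m _; exact: jet2_le JB _ _.
Qed.

Lemma jet_dif (K' : R) f f1 f2 (x y b b' : V) (S S' : 'M[R]_(d, d1)) (B tau : R) :
  jet_bounds K' f f1 f2 -> 0 <= K' -> 0 <= tau -> 0 <= B ->
  `|y - x| <= tau -> `|b' - b| <= tau -> (forall m, `|scol S' m - scol S m| <= tau) ->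
  `|b| <= B -> (forall m, `|scol S m| <= B) -> (forall m, `|scol S' m| <= B) ->
  `|\sum_m f2 y (scol S' m) + f1 y b' - (\sum_m f2 x (scol S m) + f1 x b)| <=
    K' * tau * (B + 1 + d1%:R * (B ^+ 2 + 2 * B)).
Proof.
move=> JB K0 t0 B0 xt bt St bB SB SB'.
set A := \sum_m f2 y _; set A' := \sum_m f2 x _.
rewrite (_ : A + _ - _ = (f1 y b' - f1 x b) + (A - A')); last by ring.
rewrite /A /A' -sumrB; apply: le_trans (ler_normD _ _) _; rewrite mulrDr; apply: lerD.
  rewrite (_ : _ + _ = (f1 y b' - f1 y b) + (f1 y b - f1 x b)); last by ring.
  apply: le_trans (ler_normD _ _) _; rewrite [B + 1]addrC mulrDr mulr1; apply: lerD.
    by apply: le_trans (jet1_dif JB _ _ _) _; rewrite ler_wpM2l.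
  apply: le_trans (jet1_lip JB _ _ _) _; apply: ler_pM => //; first exact: mulr_ge0.
  by rewrite ler_wpM2l.
apply: le_trans (ler_norm_sum _ _ _) _.
apply: (@le_trans _ _ (\sum_(m < d1) K' * tau * (B ^+ 2 + 2 * B))).
  apply: ler_sum => m _.
  rewrite (_ : _ - _ = (f2 y (scol S' m) - f2 y (scol S m)) + (f2 y (scol S m) - f2 x (scol S m))); last by ring.
  apply: le_trans (ler_normD _ _) _; rewrite [B ^+ 2 + _]addrC mulrDr; apply: lerD.
    apply: le_trans (jet2_dif JB _ _ _) _; apply: ler_pM => //; rewrite ?addr_ge0 ?mulr_ge0 //.
      by rewrite ler_wpM2l.
    by rewrite mulr_natl mulr2n lerD.
  apply: le_trans (jet2_lip JB _ _ _) _; apply: ler_pM => //; rewrite ?mulr_ge0 ?exprn_ge0 //.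
    by rewrite ler_wpM2l.
  by rewrite lerXn2r ?nnegrE.
rewrite sumr_const card_ord -(mulr_natl (K' * tau * _)) le_eqVlt; apply/orP; left; apply/eqP.
by ring.
Qed.

Variables (Sig : V -> 'M[R]_(d, d1)) (b : V -> V) (Lam : V -> R).
Hypothesis mSig : forall i m, measurable_fun (setT : set T) (fun x => Sig x i m).
Hypothesis mb : forall i, measurable_fun (setT : set T) (fun x => b x 0 i).
Hypothesis Lam0 : forall x, 0 <= Lam x.
Let W (x : V) : R := ga x (b x) (Sig x) + Lam x.

Let W0 x : 0 <= W x. Proof. by rewrite addr_ge0 // ga_ge0. Qed.

Variables (Rad B : R).
Hypothesis Rad0 : 0 <= Rad.
Hypothesis B0 : 0 <= B.
Definition growth : R := 2 + d%:R * (Rad + 1) ^+ 2.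
(** Coefficients are bounded on the core. A point outside it either lies beyond [Rad + 1], where the
    test functions vanish, or has weight above [B], so that integrability of the weight makes its
    contribution small. *)
Definition core : set V := [set x | `|x| <= Rad + 1 /\ W x <= B].

Lemma growth_ge0 : 0 <= growth.
Proof. by rewrite addr_ge0 // mulr_ge0 // exprn_ge0 // addr_ge0. Qed.

Lemma size2_growth x : `|x| <= Rad + 1 -> size2 (b x) (Sig x) <= growth * W x.
Proof.
move=> xR; apply: le_trans (size2_le _ _ xR) _.
by apply: ler_wpM2l; [exact: growth_ge0|rewrite lerDl].
Qed.

Lemma core_bounds x : core x ->
  `|b x| <= 1 + growth * B /\ forall m, `|scol (Sig x) m| <= 1 + growth * B.
Proof.
move=> [xR xB]; have le : size2 (b x) (Sig x) <= growth * B.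
  by apply: le_trans (size2_growth xR) _; apply: ler_wpM2l => //; exact: growth_ge0.
have s0 : 0 <= \sum_m `|scol (Sig x) m| ^+ 2 by apply: sumr_ge0 => m _; exact: exprn_ge0.
move: le; rewrite /size2 => le; have nb := normr_ge0 (b x); split; first by lra.
move=> m; have : `|scol (Sig x) m| ^+ 2 <= growth * B.
  apply: le_trans _ le; rewrite (bigD1 m) //= addrCA lerDl addr_ge0 //.
  by apply: sumr_ge0 => j _; exact: exprn_ge0.
by move: (normr_ge0 (scol (Sig x) m)); move: `|_| => t t0; nra.
Qed.

Variables (J : finType) (cell : T -> J) (rep : J -> V) (tau : R).
Hypothesis tau0 : 0 <= tau.
Hypothesis mcell : forall j, measurable [set x | cell x = j].
Hypothesis repK : forall x, cell (rep (cell x)) = cell x.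
Hypothesis cell_core : forall x y, cell x = cell y -> core x -> core y.
Hypothesis osc : forall x y, cell x = cell y -> core x -> core y ->
  [/\ `|x - y| <= tau, `|b x - b y| <= tau & forall m, `|scol (Sig x) m - scol (Sig y) m| <= tau].

(** Cells outside the core do not move; the error goes into the tail of the weight. *)
Definition drift_at (j : J) : V := if `[< core (rep j) >] then b (rep j) else 0.
Definition noise_at (j : J) : 'M[R]_(d, d1) := if `[< core (rep j) >] then Sig (rep j) else 0.

Lemma scol0 m : scol (0 : 'M[R]_(d, d1)) m = 0.
Proof. by apply/rowP => i; rewrite !mxE. Qed.

Lemma size2_0 : size2 (0 : V) (0 : 'M[R]_(d, d1)) = 0.
Proof.
by rewrite /size2 normr0 add0r big1 // => m _; rewrite scol0 normr0 expr0n.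
Qed.

Lemma size2_at j : size2 (drift_at j) (noise_at j) <= growth * (if `[< core (rep j) >] then W (rep j) else 0).
Proof.
rewrite /drift_at /noise_at; case: asboolP => [[xR _]|_]; first exact: size2_growth.
by rewrite size2_0 mulr0.
Qed.

Variable mu : probability T R.
Hypothesis sol : prob_solution Sig b mu.
Hypothesis sW : has_mean mu (W : T -> R).

Variables (dl : R) (G : nat -> R -> R).
Hypothesis dl0 : 0 < dl.
Hypothesis Gd : forall n (s : R), is_derive s 1 (G n) (G n.+1 s).
Hypothesis G_le0 : forall s, s <= 0 -> G 0%N s = 0.
Hypothesis G_ge1 : forall s, dl <= s -> G 0%N s = 1.
Hypothesis G_supp : forall n s, s <= 0 \/ dl <= s -> G n.+1 s = 0.
Variable K' : R.
Hypothesis K'0 : 0 <= K'.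
Hypothesis jets : forall (h : R) (N n : nat)
  (phi : {ffun 'I_d -> 'I_n} -> R), 0 < h -> (forall k, `|phi k| <= 1) ->
  jet_bounds K' (tfun G h N phi (fun=> 0%N)) (tf1 G h N phi) (tf2 G h N phi).
Hypothesis dl4 : dl <= 1 / 4.

Lemma tfun_far (h : R) N n (phi : {ffun 'I_d -> 'I_n} -> R) a (x : V) : 0 < h -> h <= 1 / 4 ->
  (forall k, Rad <= `|lpoint h N k| -> phi k = 0) -> Rad + 1 < `|x| -> tfun G h N phi a x = 0.
Proof.
move=> h0 h4 phiR xR; rewrite /tfun big1 // => k _.
have [/phiR ->|kR] := leP Rad `|lpoint h N k|; first by rewrite mul0r.
apply/eqP; rewrite mulf_eq0; apply/orP; right; apply/negPn/negP => /prodf_neq0 wk.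
have : `|x - lpoint h N k| <= h + dl.
  apply: rv_norm_le; first by rewrite addr_ge0 // ltW.
  move=> i; rewrite !mxE; have /andP[u1 u2] := bspl_supp G_le0 G_ge1 G_supp h0 (wk i isT).
  by rewrite ler_norml; apply/andP; split; move: u1 u2 h0 dl0; rewrite /node; lra.
have := ler_normB x (lpoint h N k); have := ler_normD (x - lpoint h N k) (lpoint h N k).
rewrite subrK; move: h4 dl4 kR xR; lra.
Qed.

(** On the core, passing to the representative changes the generator by a multiple of [tau]. Off the
    core it is replaced by 0, and within radius [Rad + 1] it was at most [K' * growth] times the
    weight, which exceeds [B] there. These are the two terms of the error. *)
Lemma cells_stationary :
  approx_stat Rad G rep drift_at noise_at
    (K' * tau * ((1 + growth * B) + 1 + d1%:R * ((1 + growth * B) ^+ 2 + 2 * (1 + growth * B)))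
      + K' * growth * mean mu (excess (W : T -> R) B))
    (fun j => pr mu [set x | cell x = j]).
Proof.
move=> h N n phi h0 h4 phi01 phiR.
have JB : jet_bounds K' (tfun G h N phi (fun=> 0%N)) (tf1 G h N phi) (tf2 G h N phi).
  by apply: jets => // k; have /andP[p0 p1] := phi01 k; rewrite ger0_norm.
set E := K' * tau * _.
pose g (x : V) := \sum_m tf2 G h N phi x (scol (Sig x) m) + tf1 G h N phi x (b x).
pose L j := \sum_m tf2 G h N phi (rep j) (scol (noise_at j) m) + tf1 G h N phi (rep j) (drift_at j).
have far x : Rad + 1 < `|x| -> g x = 0.
  move=> xR; have z a : tfun G h N phi a x = 0 by exact: tfun_far.
  rewrite /g big1 ?add0r.
    by rewrite /tf1 big1 // => i _; rewrite z mulr0.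
  by move=> m _; rewrite /tf2 big1 // => i _; rewrite big1 ?mulr0 // => j _; rewrite z mulr0.
have gW x : `|g x| <= K' * growth * W x.
  have [xR|xR] := leP `|x| (Rad + 1).
    apply: le_trans (jet_size2 _ _ _ JB) _; rewrite -mulrA; apply: ler_wpM2l => //.
    exact: size2_growth.
  by rewrite far // normr0 mulr_ge0 // mulr_ge0 // growth_ge0.
have sg : has_mean mu (g : T -> R).
  apply: (has_mean_le _ (has_meanZ (K' * growth) sW)); last exact: gW.
  exact: (jets_meas mSig mb h N phi dl0 Gd).
(* The equation satisfied by [mu] enters here, tested on the lattice function. *)
have mg0 : mean mu (g : T -> R) = 0.
  have := sol.2 _ (tfun_test dl0 Gd G_le0 G_ge1 G_supp N h0 phi).
  rewrite /mean /Rintegral => e.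
  rewrite (_ : (\int[mu]_x (g x)%:E)%E = 0%E) // -e.
  by apply: eq_integral => x _; rewrite (tf_Lop Gd).
have sE := excess_has_mean B sW W0.
have sKE := has_meanZ (K' * growth) sE.
have sKE' := has_meanD (has_mean_cst mu E) sKE.
rewrite -(mean_cell mu mcell L).
apply: (@le_trans _ _ (mean mu (fun x => g x + (E + K' * growth * excess (W : T -> R) B x)))); last first.
  by rewrite meanD // mg0 add0r meanD // ?mean_cst ?meanZ //; exact: has_mean_cst.
apply: le_mean.
- exact: (has_mean_cell mu mcell L).
- exact: has_meanD.
move=> x; have KG : 0 <= K' * growth by rewrite mulr_ge0 // growth_ge0.
have Ex0 : 0 <= excess (W : T -> R) B x by rewrite excessE; case: ifP.
have B10 : 0 <= 1 + growth * B by rewrite addr_ge0 // mulr_ge0 // growth_ge0.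
have E0 : 0 <= E.
  apply: mulr_ge0; first exact: mulr_ge0.
  apply: addr_ge0; first exact: addr_ge0.
  by apply: mulr_ge0 => //; apply: addr_ge0; [exact: exprn_ge0|exact: mulr_ge0].
have [Dx|nDx] := pselect (core x).
  have Dr : core (rep (cell x)) by apply: cell_core Dx; rewrite repK.
  have [w1 w2 w3] := osc (repK x) Dr Dx.
  have [b1 s1] := core_bounds Dx; have [b2 s2] := core_bounds Dr.
  rewrite /L /drift_at /noise_at; case: asboolP => // _.
  have := jet_dif JB K'0 tau0 B10 w1 w2 w3 b1 s1 s2.
  rewrite -/E -/(g x) => /(le_trans (ler_norm _)); rewrite lerBlDl => /le_trans; apply.
  by rewrite lerD2l lerDl mulr_ge0.
have nr : ~ core (rep (cell x)) by move=> /cell_core h'; apply: nDx; apply: h'; rewrite repK.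
have -> : L (cell x) = 0.
  rewrite /L /drift_at /noise_at; case: asboolP => // _.
  by apply/eqP; rewrite -normr_le0; apply: le_trans (jet_size2 _ _ _ JB) _; rewrite size2_0 mulr0.
have [xR|xR] := leP `|x| (Rad + 1); last by rewrite far // add0r addr_ge0 // mulr_ge0.
rewrite excessE ifT; last first.
  by rewrite ltNge; apply/negP => WB; apply: nDx; split.
by have := gW x; rewrite ler_norml => /andP[+ _]; move: E0; lra.
Qed.

End ApproxStationarity.

(** * Coupling two solutions *)

Section CoupledCells.
Variables (R : realType) (d d1 : nat).
Local Notation V := 'rV[R]_d.
Local Notation T := (Rd R d).
Local Notation Z := (V * V)%type.

Lemma gen_size2 (Rad K : R) (C : Z -> R) C1 C2 z (b b' : V) (S S' : 'M[R]_(d, d1)) :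
  cost_bounds Rad K C C1 C2 -> 0 <= K ->
  `|gen C1 C2 z b b' S S'| <= K * (size2 b S + size2 b' S').
Proof.
move=> HC K0; rewrite /gen /size2 addrACA mulrDr; apply: le_trans (ler_normD _ _) _; apply: lerD.
  apply: le_trans (cost1_le HC _ _) _; apply: ler_wpM2l => //; exact: scol_pair_norm.
rewrite -big_split mulr_sumr /=; apply: le_trans (ler_norm_sum _ _ _) _; apply: ler_sum => m _.
apply: le_trans (cost2_le HC _ _) _; apply: ler_wpM2l => //.
by rewrite prod_normE /=; case: (leP `|scol S m|); rewrite ?lerDl ?lerDr exprn_ge0.
Qed.

Variables (Sig : V -> 'M[R]_(d, d1)) (b : V -> V) (Lam : V -> R).
Hypothesis mSig : forall i m, measurable_fun (setT : set T) (fun x => Sig x i m).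
Hypothesis mb : forall i, measurable_fun (setT : set T) (fun x => b x 0 i).
Hypothesis mLam : measurable_fun (setT : set T) Lam.
Hypothesis Lam0 : forall x, 0 <= Lam x.

Definition weight_sum (x : V) : R := ga x (b x) (Sig x) + Lam x.
Local Notation W := (weight_sum : T -> R).

Lemma weight_sum_ge0 x : 0 <= weight_sum x. Proof. by rewrite addr_ge0 // ga_ge0. Qed.

(** A quantity constant on cells and dominated by the tail of the weight. It pays for pairs with one
    frozen point, whose generator is at most a multiple of [B] by the size of the other point. *)
Definition spill (B : R) (x : V) : R := if B < weight_sum x then B else 0.

Definition core_total Rad B (J : finType) (rep : J -> V) (j : J) : R :=
  if `[< core Sig b Lam Rad B (rep j) >] then weight_sum (rep j) else 0.

Definition core_gen Rad B C1 C2 (J : finType) (rep : J -> V) (j j' : J) : R :=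
  if `[< core Sig b Lam Rad B (rep j) >] && `[< core Sig b Lam Rad B (rep j') >]
  then gen C1 C2 (rep j, rep j') (b (rep j)) (b (rep j')) (Sig (rep j)) (Sig (rep j')) else 0.

Lemma gen_core Rad K C C1 C2 B (J : finType) (rep : J -> V) j j' :
  cost_bounds Rad K C C1 C2 -> 0 <= K -> 0 <= Rad -> 0 <= B ->
  gen C1 C2 (rep j, rep j') (drift_at Sig b Lam Rad B rep j) (drift_at Sig b Lam Rad B rep j')
    (noise_at Sig b Lam Rad B rep j) (noise_at Sig b Lam Rad B rep j') <=
  core_gen Rad B C1 C2 rep j j' +
  K * growth d Rad * (spill B (rep j) + spill B (rep j')).
Proof.
move=> HC K0 Rad0 B0.
have KG : 0 <= K * growth d Rad by rewrite mulr_ge0 // growth_ge0.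
have e0 x : 0 <= spill B x by rewrite /spill; case: ifP.
have E0 : 0 <= K * growth d Rad * (spill B (rep j) + spill B (rep j')).
  by rewrite mulr_ge0 // addr_ge0.
have bnd x : core Sig b Lam Rad B x -> size2 (b x) (Sig x) <= growth d Rad * B.
  move=> [xR xB]; apply: le_trans (size2_growth Sig b Lam0 Rad0 xR) _.
  by rewrite ler_wpM2l // growth_ge0.
have out x : ~ core Sig b Lam Rad B x -> `|x| < Rad -> B <= spill B x.
  move=> nx xR; rewrite /spill; case: ltP => // WB.
  by exfalso; apply: nx; split=> //; move: xR; lra.
have mix x y z bb bb' (S S' : 'M[R]_(d, d1)) s : ~ core Sig b Lam Rad B y -> core Sig b Lam Rad B x ->
   (Rad <= `|y| -> Rad <= `|z.1| \/ Rad <= `|z.2|) ->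
   size2 bb S + size2 bb' S' <= growth d Rad * B -> spill B y <= s ->
   gen C1 C2 z bb bb' S S' <= K * growth d Rad * s.
  move=> ny cx zs sz es; have s0 : 0 <= s by apply: le_trans es.
  have [yR|yR] := leP Rad `|y|.
    have [_ z1 z2] := cost_supp HC (zs yR).
    by rewrite /gen z1 big1 ?addr0 ?mulr_ge0 // growth_ge0.
  have le := gen_size2 z bb bb' S S' HC K0; apply: le_trans (le_trans (ler_norm _) le) _.
  rewrite -mulrA ler_wpM2l //; apply: le_trans sz _; rewrite ler_wpM2l ?growth_ge0 //.
  exact: le_trans (out _ ny yR) es.
rewrite /core_gen /drift_at /noise_at.
case: asboolP => cj; case: asboolP => cj' /=; rewrite ?add0r.
- by rewrite lerDl.
- apply: (mix (rep j) (rep j')) => //; first by right.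
    by rewrite size2_0 addr0; exact: bnd.
  by rewrite lerDr.
- apply: (mix (rep j') (rep j)) => //; first by left.
    by rewrite size2_0 add0r; exact: bnd.
  by rewrite lerDl.
- apply: le_trans (le_trans (ler_norm _) (gen_size2 _ _ _ _ _ HC K0)) _.
  by rewrite size2_0 addr0 mulr0.
Qed.

Lemma pick_cells (I : finType) (A : I -> set T) Rad B tau : 0 <= Rad -> 0 <= B -> 0 < tau ->
  (forall i, measurable (A i)) ->
  exists (J : finType) (cell : T -> J) (rep : J -> V),
  [/\ forall j, measurable [set x | cell x = j],
      forall x, cell (rep (cell x)) = cell x,
      forall x y, cell x = cell y -> forall i, A i x -> A i y,
      forall x y, cell x = cell y -> core Sig b Lam Rad B x -> core Sig b Lam Rad B y &
      forall x y, cell x = cell y -> core Sig b Lam Rad B x -> core Sig b Lam Rad B y ->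
        [/\ `|x - y| <= tau, `|b x - b y| <= tau,
            forall m, `|scol (Sig x) m - scol (Sig y) m| <= tau &
            `|weight_sum x - weight_sum y| <= tau]] /\
      forall x y, cell x = cell y -> B < weight_sum x -> B < weight_sum y.
Proof.
move=> Rad0 B0 t0 mA.
have mtot : measurable_fun (setT : set T) W by exact: total_meas.
have mcore : measurable (core Sig b Lam Rad B : set T).
  rewrite (_ : (core Sig b Lam Rad B : set T) = [set x : V | `|x| <= Rad + 1] `&` ~` [set x | B < weight_sum x]).
    apply: measurableI; last by apply: measurableC; exact: gt_meas.
    apply: closed_meas; apply: (@closed_comp _ _ (fun x : V => `|x|) [set r | r <= Rad + 1]).
      by move=> x _; exact: norm_continuous.
    exact: closed_le.
  apply/seteqP; split=> x /= [xR WB]; split=> //.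
    by apply/negP; rewrite -leNgt.
  by rewrite leNgt; apply/negP.
pose A' (i : I + bool) : set T :=
  match i with inl i => A i | inr true => core Sig b Lam Rad B | inr false => [set x | B < weight_sum x] end.
pose g (i : 'I_d + ('I_d + ('I_d * 'I_d1 + unit))) (x : V) : R := match i with
  | inl i => x 0 i | inr (inl i) => b x 0 i | inr (inr (inl (i, m))) => Sig x i m
  | inr (inr (inr _)) => weight_sum x end.
have GB : 0 <= growth d Rad * B by rewrite mulr_ge0 // growth_ge0.
have [||i x Dx||J [cell [mc cA cosc]]] :=
  @fine_cells _ T R _ _ A' g (core Sig b Lam Rad B) (Rad + 1 + (1 + growth d Rad * B) + B) tau.
- by case=> [i|[]] //=; exact: gt_meas.
- case=> [i|[i|[[i m]|u]]]; [|exact: mb|exact: mSig|exact: mtot].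
  by apply: continuous_meas => x; exact: coord_continuous.
- have [xR xB] := Dx; have [bx sx] := core_bounds Lam0 Rad0 Dx.
  case: i => [i|[i|[[i m]|u]]] /=.
  + by apply: le_trans (coord_le x i) _; lra.
  + by apply: le_trans (coord_le (b x) i) _; lra.
  + have := coord_le (scol (Sig x) m) i; rewrite mxE => le.
    by apply: le_trans le _; have := sx m; lra.
  + by rewrite ger0_norm ?weight_sum_ge0 //; move: xB; rewrite -/(weight_sum x); lra.
- exact: t0.
(* On an empty cell [get] returns an arbitrary point; properties of representatives are only claimed
   for cells of the form [cell x]. *)
exists J, cell, (fun j => get [set x | cell x = j]); split; last by move=> x y e; exact: (cA _ _ e (inr false)).
split=> //.
- by move=> x; exact: (@getPex _ [set y | cell y = cell x] (ex_intro _ x erefl)).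
- by move=> x y e i; exact: (cA _ _ e (inl i)).
- by move=> x y e; exact: (cA _ _ e (inr true)).
move=> x y e Dx Dy; have oc := cosc _ _ e Dx Dy; split.
- by apply: rv_norm_le; [exact: ltW|move=> i; rewrite !mxE; exact: (oc (inl i))].
- by apply: rv_norm_le; [exact: ltW|move=> i; rewrite !mxE; exact: (oc (inr (inl i)))].
- by move=> m; apply: rv_norm_le; [exact: ltW|move=> i; rewrite !mxE; exact: (oc (inr (inr (inl (i, m)))))].
- exact: (oc (inr (inr (inr tt)))).
Qed.

End CoupledCells.

Section CellMeans.
Variables (R : realType) (d d1 : nat).
Local Notation V := 'rV[R]_d.
Local Notation T := (Rd R d).
Local Notation Z := (V * V)%type.
Variables (Sig : V -> 'M[R]_(d, d1)) (b : V -> V) (Lam : V -> R).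
Hypothesis Lam0 : forall x, 0 <= Lam x.
Local Notation W := (weight_sum Sig b Lam : T -> R).

Lemma le_div_mul (a c u : R) : 0 <= u -> 0 <= c -> a <= c / (u + 1) -> a * u <= c.
Proof.
move=> u0 c0 ac; apply: (@le_trans _ _ (c / (u + 1) * u)); first exact: ler_wpM2r.
by rewrite mulrAC ler_pdivrMr ?ltr_wpDl // ler_wpM2l // lerDl.
Qed.

Lemma coupling_sum_le (J : finType) (mu nu : J -> R) pi (f f' : J -> R) : coupling mu nu pi ->
  \sum_j \sum_j' pi j j' * (f j + f' j') = \sum_j mu j * f j + \sum_j nu j * f' j.
Proof.
move=> [_ rows cols]; under eq_bigr do under eq_bigr do rewrite mulrDr.
under eq_bigr do rewrite big_split /=; rewrite big_split /=; congr (_ + _).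
  by apply: eq_bigr => j _; rewrite -mulr_suml rows.
by rewrite exchange_big /=; apply: eq_bigr => j _; rewrite -mulr_suml cols.
Qed.

Section OneSolution.
Variables (Rad B : R) (J : finType) (cell : T -> J) (rep : J -> V) (tau : R).
Hypothesis tau0 : 0 <= tau.
Hypothesis mcell : forall j, measurable [set x | cell x = j].
Hypothesis repK : forall x, cell (rep (cell x)) = cell x.
Hypothesis cell_core : forall x y, cell x = cell y -> core Sig b Lam Rad B x -> core Sig b Lam Rad B y.
Hypothesis cell_osc : forall x y, cell x = cell y -> core Sig b Lam Rad B x -> core Sig b Lam Rad B y ->
  `|weight_sum Sig b Lam x - weight_sum Sig b Lam y| <= tau.
Hypothesis cell_gt : forall x y, cell x = cell y -> B < weight_sum Sig b Lam x -> B < weight_sum Sig b Lam y.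
Variable mu : probability T R.
Hypothesis sW : has_mean mu W.
Local Notation w j := (pr mu [set x | cell x = j]).

Lemma core_total_mean : \sum_j w j * core_total Sig b Lam Rad B rep j <= mean mu W + tau.
Proof.
rewrite -(mean_cell mu mcell (core_total Sig b Lam Rad B rep)) -[X in _ + X](mean_cst mu) -meanD //;
  last exact: has_mean_cst.
apply: le_mean; first exact: has_mean_cell.
  by apply: has_meanD => //; exact: has_mean_cst.
move=> x; have W0 := weight_sum_ge0 Sig b Lam0 x; rewrite /core_total; case: asboolP => [c|_]; last exact: addr_ge0.
have cx : core Sig b Lam Rad B x by apply: cell_core c; rewrite repK.
by have := cell_osc (repK x) c cx; rewrite ler_norml => /andP[_]; rewrite lerBlDl.
Qed.

Lemma spill_mean : \sum_j w j * spill Sig b Lam B (rep j) <= mean mu (excess W B).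
Proof.
rewrite -(mean_cell mu mcell (fun j => spill Sig b Lam B (rep j))).
have W0 x := weight_sum_ge0 Sig b Lam0 x.
apply: le_mean; first exact: (has_mean_cell mu mcell (fun j => spill Sig b Lam B (rep j))).
  exact: excess_has_mean.
move=> x; rewrite excessE /spill; case: ifPn => [h|_].
  by have h' := cell_gt (repK x) h; rewrite h' ltW.
by case: ifP.
Qed.

End OneSolution.
End CellMeans.

Section CellCoupling.
Variables (R : realType) (d d1 : nat).
Local Notation V := 'rV[R]_d.
Local Notation T := (Rd R d).
Local Notation Z := (V * V)%type.
Variables (Sig : V -> 'M[R]_(d, d1)) (b : V -> V) (Lam : V -> R).
Hypothesis mSig : forall i m, measurable_fun (setT : set T) (fun x => Sig x i m).
Hypothesis mb : forall i, measurable_fun (setT : set T) (fun x => b x 0 i).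
Hypothesis mLam : measurable_fun (setT : set T) Lam.
Hypothesis Lam0 : forall x, 0 <= Lam x.
Local Notation W := (weight_sum Sig b Lam : T -> R).
Variables mu nu : probability T R.
Hypotheses (smu : prob_solution Sig b mu) (snu : prob_solution Sig b nu).
Hypotheses (imu : has_mean mu W) (inu : has_mean nu W).

Lemma cost_bounds_mono (Rad Rad' K : R) (C : Z -> R) C1 C2 : Rad <= Rad' ->
  cost_bounds Rad K C C1 C2 -> cost_bounds Rad' K C C1 C2.
Proof.
move=> RR [h1 h2 h3 h4 h5 h6 h7 h8 h9]; split=> // z zR; apply: h2.
by case: zR => zR; [left|right]; exact: le_trans zR.
Qed.

(** The difficulty is the order of the choices: the cost and [Rad], then [th] with its radius [r],
    then [dl] and with it [K'], the tail size [t] and [B], and finally the oscillation [tau]. The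
    errors from [th], [t] and [tau] each take at most a quarter of [e]. *)
Lemma coupled_cells (eps L0 kap M MS e : R) (I : finType) (A : I -> set T) :
  0 < eps -> 0 < L0 -> 0 < kap -> 0 < M -> 0 < e -> (forall i, measurable (A i)) ->
  exists (Rad B : R) (J : finType) (cell : T -> J) (rep : J -> V) (pi : J -> J -> R),
  [/\ [/\ MS <= Rad + 1, 1 <= B, mean mu (excess W B) <= e & mean nu (excess W B) <= e],
      [/\ forall j, measurable [set x | cell x = j],
          forall x, cell (rep (cell x)) = cell x,
          forall x y, cell x = cell y -> forall i, A i x -> A i y &
          forall x y, cell x = cell y -> core Sig b Lam Rad B x -> core Sig b Lam Rad B y],
      coupling (fun j => pr mu [set x | cell x = j]) (fun j => pr nu [set x | cell x = j]) pi,
      \sum_j pr mu [set x | cell x = j] * core_total Sig b Lam Rad B rep j <= mean mu W + 1 /\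
      \sum_j pr nu [set x | cell x = j] * core_total Sig b Lam Rad B rep j <= mean nu W + 1 &
      - e <= \sum_j \sum_j' pi j j' *
        core_gen Sig b Lam Rad B (cost1 eps L0 kap M) (cost2 eps L0 kap M) rep j j'].
Proof.
move=> eps0 L00 kap0 M0 e0 mA.
have [Rad1 [K [Rad10 K0 HC1]]] := cost_pack d eps0 L00 kap0 M0.
(* Enlarged so that the ball of radius [MS] lies within the radius of the core. *)
pose Rad := Rad1 + `|MS|.
have Rad0 : 0 <= Rad by rewrite addr_ge0.
have HC : cost_bounds Rad K (cost eps L0 kap M) (cost1 eps L0 kap M) (cost2 eps L0 kap M : Z -> Z -> R).
  by apply: cost_bounds_mono HC1; rewrite lerDl.
have W0 x := weight_sum_ge0 Sig b Lam0 x.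
have Wm : 0 <= mean mu W by exact: mean_ge0.
have Wn : 0 <= mean nu W by exact: mean_ge0.
set GR := growth d Rad; have GR0 : 0 <= GR by exact: growth_ge0.
pose Q := GR * (mean mu W + mean nu W + 1).
have Q0 : 0 <= Q by rewrite mulr_ge0 // !addr_ge0.
have e40 : 0 < e / 4 by rewrite divr_gt0.
have u0 : 0 <= 6 + 12 * Q by rewrite addr_ge0 // mulr_ge0.
pose th := e / 4 / (6 + 12 * Q + 1).
have th0 : 0 < th by rewrite divr_gt0 // ltr_wpDl.
have thQ : th * (6 + 12 * Q) <= e / 4 by apply: le_div_mul => //; exact: ltW.
have [r r0 Hmod] := cost_mod HC th0.
have [|dl dl0 dll] := @small_real R [:: 1 / 4; r / 2].
  by move=> a; rewrite !inE => /orP[] /eqP->; rewrite divr_gt0.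
have dl4 : dl <= 1 / 4 by apply: dll; rewrite !inE eqxx.
have dlr : dl <= r / 2 by apply: dll; rewrite !inE eqxx orbT.
have [G [Gd G_le0 G_ge1 G_supp G_pos]] := smooth_step dl0.
have [K' K'0 jets] := lattice_jet d dl0 Gd G_le0 G_ge1 G_supp.
have KK0 : 0 <= 2 * ((K' + K) * GR) by rewrite !mulr_ge0 // addr_ge0.
(* [t] bounds the tail of the weight, which enters through stationarity with factor [K'] and through
   the spill with factor [K], once for each measure. *)
have [|t t0 tl] := @small_real R [:: e / 4 / (2 * ((K' + K) * GR) + 1); e].
  by move=> a; rewrite !inE => /orP[] /eqP->; rewrite ?divr_gt0 // ltr_wpDl.
have tK : t * (2 * ((K' + K) * GR)) <= e / 4.
  by apply: le_div_mul => //; [exact: ltW|apply: tl; rewrite !inE eqxx].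
have te : t <= e by apply: tl; rewrite !inE eqxx orbT.
have [Bm BmP] := excess_small imu W0 t0; have [Bn BnP] := excess_small inu W0 t0.
pose B := 1 + `|Bm| + `|Bn|.
have B1 : 1 <= B by rewrite /B -addrA lerDl addr_ge0.
have B0 : 0 <= B by exact: le_trans B1.
have em : mean mu (excess W B) <= t.
  apply: BmP; apply: le_trans (ler_norm _) _; rewrite /B.
  by have := normr_ge0 Bn; lra.
have en : mean nu (excess W B) <= t.
  apply: BnP; apply: le_trans (ler_norm _) _; rewrite /B.
  by have := normr_ge0 Bm; lra.
pose X := (1 + GR * B) + 1 + d1%:R * ((1 + GR * B) ^+ 2 + 2 * (1 + GR * B)).
have GB0 : 0 <= 1 + GR * B by rewrite addr_ge0 // mulr_ge0.
have X0 : 0 <= X.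
  apply: addr_ge0; first exact: addr_ge0.
  by apply: mulr_ge0 => //; apply: addr_ge0; [exact: exprn_ge0|exact: mulr_ge0].
have KX0 : 0 <= 2 * (K' * X) by rewrite !mulr_ge0.
(* [X] grows with [B], so [tau] is chosen after it. *)
have [|tau tau0 taul] := @small_real R [:: e / 4 / (2 * (K' * X) + 1); 1].
  by move=> a; rewrite !inE => /orP[] /eqP->; rewrite ?divr_gt0 // ltr_wpDl.
have tauX : tau * (2 * (K' * X)) <= e / 4.
  by apply: le_div_mul => //; [exact: ltW|apply: taul; rewrite !inE eqxx].
have tau1 : tau <= 1 by apply: taul; rewrite !inE eqxx orbT.
have [J [cell [rep [[mc repK cA cc cosc] cgt]]]] := pick_cells mSig mb mLam Lam0 Rad0 B0 tau0 mA.
have osc x y (cxy : cell x = cell y) (cx : core Sig b Lam Rad B x) (cy : core Sig b Lam Rad B y) :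
    [/\ `|x - y| <= tau, `|b x - b y| <= tau & forall m, `|scol (Sig x) m - scol (Sig y) m| <= tau].
  by have [] := cosc x y cxy cx cy.
have oscW x y (cxy : cell x = cell y) (cx : core Sig b Lam Rad B x) (cy : core Sig b Lam Rad B y) :
    `|weight_sum Sig b Lam x - weight_sum Sig b Lam y| <= tau.
  by have [] := cosc x y cxy cx cy.
pose e1 := K' * tau * X + K' * GR * t.
have stat (la : probability T R) : prob_solution Sig b la -> has_mean la W ->
    mean la (excess W B) <= t -> approx_stat Rad G rep (drift_at Sig b Lam Rad B rep)
      (noise_at Sig b Lam Rad B rep) e1 (fun j => pr la [set x | cell x = j]).
  move=> sla ila tla h N n phi h0 h4 p1 p2.
  have := cells_stationary mSig mb Lam0 Rad0 B0 (ltW tau0) mc repK cc osc sla ila dl0 Gd G_le0 G_ge1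
     G_supp K'0 jets dl4 h0 h4 p1 p2.
  by move/le_trans; apply; rewrite lerD2l ler_wpM2l // mulr_ge0.
have tot (la : probability T R) : has_mean la W ->
    \sum_j pr la [set x | cell x = j] * core_total Sig b Lam Rad B rep j <= mean la W + 1.
  move=> ila; apply: le_trans (core_total_mean Lam0 (ltW tau0) mc repK cc oscW ila) _.
  by rewrite lerD2l.
have spl (la : probability T R) : has_mean la W -> mean la (excess W B) <= t ->
    \sum_j pr la [set x | cell x = j] * spill Sig b Lam B (rep j) <= t.
  by move=> ila tla; apply: le_trans (spill_mean Lam0 mc repK cgt ila) tla.
have siz (la : probability T R) : has_mean la W -> mean la W <= mean mu W + mean nu W ->
    \sum_j pr la [set x | cell x = j] *
      size2 (drift_at Sig b Lam Rad B rep j) (noise_at Sig b Lam Rad B rep j) <= Q.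
  move=> ila lla; apply: (@le_trans _ _ (GR * (mean la W + 1))); last by rewrite ler_wpM2l // lerD2r.
  apply: le_trans (ler_wpM2l GR0 (tot _ ila)); rewrite mulr_sumr; apply: ler_sum => j _.
  by rewrite mulrCA ler_wpM2l ?pr_ge0 //; exact: size2_at.
have bB j : `|drift_at Sig b Lam Rad B rep j| <= 1 + GR * B.
  rewrite /drift_at; case: asboolP => [c|_]; last by rewrite normr0.
  by have [] := core_bounds Lam0 Rad0 c.
have SB j m : `|scol (noise_at Sig b Lam Rad B rep j) m| <= 1 + GR * B.
  rewrite /noise_at; case: asboolP => [c|_]; last by rewrite scol0 normr0.
  by have [_] := core_bounds Lam0 Rad0 c.
have [pi cpi low] := discrete_coupling HC K0 dl0 Gd G_le0 G_ge1 G_supp G_pos K'0 jets bB SB GB0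
  th0 r0 Hmod dl4 dlr (cell_prob mu mc) (cell_prob nu mc) (stat mu smu imu em) (stat nu snu inu en)
  (siz mu imu (ler_wpDr Wn (lexx _))) (siz nu inu (ler_wpDl Wm (lexx _))).
exists Rad, B, J, cell, rep, pi; split=> //.
- split=> //; [|exact: le_trans em te|exact: le_trans en te].
  rewrite /Rad; have := ler_norm MS; have := Rad10; lra.
- by split; exact: tot.
have [pi0 _ _] := cpi.
have up : \sum_j \sum_j' pi j j' * gen (cost1 eps L0 kap M) (cost2 eps L0 kap M) (rep j, rep j')
    (drift_at Sig b Lam Rad B rep j) (drift_at Sig b Lam Rad B rep j')
    (noise_at Sig b Lam Rad B rep j) (noise_at Sig b Lam Rad B rep j') <=
  \sum_j \sum_j' pi j j' * core_gen Sig b Lam Rad B (cost1 eps L0 kap M) (cost2 eps L0 kap M) rep j j'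
  + K * GR * (\sum_j pr mu [set x | cell x = j] * spill Sig b Lam B (rep j) +
              \sum_j pr nu [set x | cell x = j] * spill Sig b Lam B (rep j)).
  rewrite -(coupling_sum_le _ _ cpi) mulr_sumr -big_split /=; apply: ler_sum => j _.
  rewrite mulr_sumr -big_split /=; apply: ler_sum => j' _.
  rewrite [X in _ <= _ + X]mulrCA -mulrDr ler_wpM2l //; exact: (gen_core Sig b Lam0 rep j j' HC K0 Rad0 B0).
have s2 := lerD (spl mu imu em) (spl nu inu en).
have KG0 : 0 <= K * GR by rewrite mulr_ge0.
have s3 := ler_wpM2l KG0 s2.
have := le_trans low up.
move: s3 tauX tK thQ e0; rewrite /e1; move: (\sum_j _) (\sum_j _) (\sum_j _) => x1 x2 x3; nra.
Qed.

End CellCoupling.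

(** * Comparing the mass of a set with that of its neighbourhood *)

Section Transport.
Variables (R : realType) (d d1 : nat).
Local Notation V := 'rV[R]_d.
Local Notation T := (Rd R d).
Variables (Sig : V -> 'M[R]_(d, d1)) (b : V -> V) (Lam : V -> R).
Hypothesis mSig : forall i m, measurable_fun (setT : set T) (fun x => Sig x i m).
Hypothesis mb : forall i, measurable_fun (setT : set T) (fun x => b x 0 i).
Hypothesis mLam : measurable_fun (setT : set T) Lam.
Hypothesis Lam0 : forall x, 0 <= Lam x.
Hypothesis qL : forall x y, qfun Sig b x y <= (Lam x + Lam y) * enorm (x - y) ^+ 2.
Hypothesis qr : forall x y, x != y -> qfun Sig b x y < 2 * rfun Sig x y.
Local Notation W := (weight_sum Sig b Lam : T -> R).

Lemma cell_mass (la : probability T R) (J : finType) (cell : T -> J) (rep : J -> V) (A : set T) :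
  (forall j, measurable [set x | cell x = j]) -> (forall x, cell (rep (cell x)) = cell x) ->
  (forall x y, cell x = cell y -> A x -> A y) -> measurable A ->
  \sum_j pr la [set x | cell x = j] * (`[< A (rep j) >])%:R = pr la A.
Proof.
move=> mc repK cA mA; rewrite -(mean_cell la mc (fun j => (`[< A (rep j) >])%:R)) -mean_indic //.
congr mean; apply/funext => x; rewrite indicE; congr (nat_of_bool _)%:R.
by apply/asboolP/idP => [h|/set_mem]; [apply: mem_set|]; apply: cA; rewrite ?repK.
Qed.

Lemma pr_gt_le (la : probability T R) B : has_mean la W -> 1 <= B ->
  pr la [set x : T | B < weight_sum Sig b Lam x] <= mean la (excess W B).
Proof.
move=> ila B1; have mg := gt_meas B (has_mean_meas ila).
rewrite -mean_indic //; apply: le_mean; first exact: has_mean_indic.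
  by apply: excess_has_mean => // x; exact: weight_sum_ge0.
move=> x; rewrite excessE indicE; case: ifPn => h.
  by rewrite mem_set // (le_trans B1) // ltW.
by rewrite memNset //=; exact/negP.
Qed.

Lemma cu_bounded (eps L0 kap rhoM MS : R) (x y : V) : 0 < eps -> 0 < L0 -> 0 < kap ->
  `|x| <= MS -> `|y| <= MS -> dotv (x - y) (x - y) <= rhoM ->
  cu eps L0 kap (x, y) <= (1 + lep eps rhoM) ^+ 2 / (2 * L0) + kap * (d%:R * MS ^+ 2 + d%:R * MS ^+ 2).
Proof.
move=> eps0 L00 kap0 xM yM xyM; have r0 := dotv_ge0 (x - y).
have rM0 : 0 <= rhoM by exact: le_trans xyM.
have l1 : 0 <= lep eps (dotv (x - y) (x - y)) by exact: lep_ge0.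
rewrite /cu /qd0 /cA /=; apply: lerD.
  rewrite ler_wpM2r ?invr_ge0 ?mulr_ge0 ?(ltW L00) //.
  rewrite lerXn2r ?nnegrE ?addr_ge0 ?lep_ge0 // lerD2l /lep ler_ln ?posrE; last 2 first.
  - by rewrite ltr_pwDl // divr_ge0 // ltW.
  - by rewrite ltr_pwDl // divr_ge0 // ltW.
  by rewrite lerD2l ler_wpM2r // invr_ge0 ltW.
have cB_le (z : V) : `|z| <= MS -> cB (dotv z z) <= d%:R * MS ^+ 2.
  move=> zM; have z0 := dotv_ge0 z; apply: le_trans (dotv_le zM).
  by apply: le_ln1Dx; rewrite (lt_le_trans (ltrN10 _)).
by apply: ler_wpM2l; [exact: ltW|apply: lerD; exact: cB_le].
Qed.

(** Taking [L0] large and [kap] small makes the upper bound for all core pairs a small multiple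
    [thv] of their weights, while pairs in [P] keep a fixed negative amount. *)
Lemma core_gen_le (eps L0 kap M m1 thv Rad B : R) (J : finType) (rep : J -> V) (P : V -> V -> Prop) j j' :
  0 < eps -> 0 < L0 -> 0 < kap -> 0 < M -> 0 < m1 -> 0 <= thv -> 4 / L0 <= thv -> 4 * kap <= thv ->
  (forall x y, P x y -> [/\ core Sig b Lam Rad B x, core Sig b Lam Rad B y, cu eps L0 kap (x, y) <= M / 2 &
     main_part eps L0 (dotv (x - y) (x - y)) (qfun Sig b x y) (rfun Sig x y) <= - m1]) ->
  core_gen Sig b Lam Rad B (cost1 eps L0 kap M) (cost2 eps L0 kap M) rep j j' <=
  3 / M * (thv * (core_total Sig b Lam Rad B rep j + core_total Sig b Lam Rad B rep j'))
  - 3 / M * (m1 / 4) * (`[< P (rep j) (rep j') >])%:R.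
Proof.
move=> eps0 L00 kap0 M0 m10 t0 tL tk PP.
have M3 : 0 <= 3 / M by rewrite divr_ge0 // ltW.
have w0 i : 0 <= core_total Sig b Lam Rad B rep i.
  by rewrite /core_total; case: ifP => // _; exact: weight_sum_ge0.
rewrite /core_gen; case: ifPn => [/andP[/asboolP c /asboolP c']|nc]; last first.
  case: asboolP => [/PP[c c' _ _]|_].
    by case/negP: nc; apply/andP; split; exact/asboolP.
  by rewrite mulr0 subr0 mulr_ge0 // mulr_ge0 // addr_ge0.
rewrite /core_total (asboolT c) (asboolT c') /weight_sum.
set x := rep j; set y := rep j'.
have g0 := addr_ge0 (ga_ge0 x (b x) (Sig x)) (ga_ge0 y (b y) (Sig y)).
have l0 := addr_ge0 (Lam0 x) (Lam0 y).
have h1 : 4 / L0 * (Lam x + Lam y) <= thv * (Lam x + Lam y) by rewrite ler_wpM2r.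
have h2 : 4 * kap * (ga x (b x) (Sig x) + ga y (b y) (Sig y)) <= thv * (ga x (b x) (Sig x) + ga y (b y) (Sig y)).
  by rewrite ler_wpM2r.
case: asboolP => [/PP[_ _ uM mp]|_].
  apply: le_trans (gen_strict L00 kap0 M0 (ltW m10) uM mp) _.
  rewrite mulr1 -mulrBr ler_wpM2l //.
  have h3 : 0 <= thv * (Lam x + Lam y) by rewrite mulr_ge0.
  by move: h2 h3; move: (ga _ _ _) (ga _ _ _) => g g'; lra.
apply: le_trans (gen_upper eps0 L00 kap0 M0 x y Lam0 qL qr) _.
rewrite mulr0 subr0 ler_wpM2l //.
by move: h1 h2; move: (ga _ _ _) (ga _ _ _) => g g'; lra.
Qed.

Variables mu nu : probability T R.
Hypotheses (smu : prob_solution Sig b mu) (snu : prob_solution Sig b nu).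
Hypotheses (imu : has_mean mu W) (inu : has_mean nu W).

(** The far pairs gain [3 / M * (m1 / 4)] per unit of mass. The weights and the error [e] can offset
    at most half of [k] times this gain each; [thv] and the bound on [e] are made for that. *)
Lemma mass_le (k e M m1 thv wm wn pf lo I0 : R) : 0 < M -> 0 < m1 -> 0 < I0 ->
  wm + wn <= I0 -> thv = k * m1 / (8 * I0) -> e <= 3 * m1 * k / (8 * M) -> 0 <= thv ->
  - e <= lo -> lo <= 3 / M * (thv * (wm + wn)) - 3 / M * (m1 / 4) * pf -> pf <= k.
Proof.
move=> M0 m10 I00 wI tE eE t0 elo lole.
have h1 : thv * (wm + wn) <= thv * I0 by rewrite ler_wpM2l.
have h2 : thv * I0 = k * m1 / 8 by rewrite tE; field; rewrite gt_eqF.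
have c0 : 0 < 3 / M by rewrite divr_gt0.
have h3 : 3 / M * (thv * (wm + wn)) <= 3 / M * (k * m1 / 8) by rewrite -h2 ler_wpM2l // ltW.
have h4 : 3 * m1 * k / (8 * M) = 3 / M * (k * m1 / 8) by field; rewrite gt_eqF.
have h5 : 3 / M * (m1 / 4) * pf <= 3 / M * (m1 / 4) * k.
  have -> : 3 / M * (m1 / 4) * k = 3 / M * (k * m1 / 8) + 3 / M * (k * m1 / 8) by field; rewrite gt_eqF.
  by move: elo lole h3; rewrite h4 in eE; lra.
by move: h5; rewrite ler_pM2l // mulr_gt0 // divr_gt0.
Qed.

(** Mass that starts in [F] and misses [U] travels at least [eta]: either one of its ends lies in a
    bad set of small measure, or it is carried by a good far pair, on which the generator is
    strictly negative. *)
Lemma transport_bound (F U : set V) (eta k0 : R) : measurable (F : set T) -> measurable (U : set T) ->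
  0 < eta -> 0 < k0 -> (forall x y, F x -> `|x - y| < eta -> U y) -> pr mu (F : set T) <= pr nu (U : set T) + k0.
Proof.
move=> mF mU eta0 k00 FU.
(* Five of these eighths are spent: [2 * k] on the bad set under each measure, and [k] on the far
   pairs. *)
pose k := k0 / 8; have kp : 0 < k by rewrite divr_gt0.
pose f (i : 'I_d * 'I_d1 + 'I_d) (x : V) : R := match i with inl (i, m) => Sig x i m | inr i => b x 0 i end.
have [|S [cS [MS0 bS] pS qS fc]] := @lusin _ _ mu nu _ f k _ kp; first by case=> [[i m]|i]; [exact: mSig|exact: mb].
pose MS := `|MS0|.
have bMS x : S x -> `|x| <= MS by move=> Sx; apply: le_trans (bS x Sx) _; exact: ler_norm.
have rho00 : 0 < eta ^+ 2 by rewrite exprn_gt0.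
have [m [Q0 [rhoM [m0 rM0 Hs]]]] := compact_strict cS (ex_intro _ MS0 bS)
  (fun i m => fc (inl (i, m))) (fun i => fc (inr i)) rho00 qr.
set rho0 := eta ^+ 2 in rho00 Hs.
pose Q := `|Q0|; pose m1 := m / (4 * rhoM); have m10 : 0 < m1 by rewrite divr_gt0 // mulr_gt0.
have W0 x := weight_sum_ge0 Sig b Lam0 x.
have Wm : 0 <= mean mu W by exact: mean_ge0.
have Wn : 0 <= mean nu W by exact: mean_ge0.
pose I0 := mean mu W + mean nu W + 2.
have I00 : 0 < I0 by rewrite ltr_wpDl // addr_ge0.
pose thv := k * m1 / (8 * I0).
have thv0 : 0 < thv by apply: divr_gt0; apply: mulr_gt0.
have Q00 : 0 <= Q by exact: normr_ge0.
(* Required size of [L0]: the first term is for strictness at far pairs, the second gives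
   [4 / L0 <= thv]. The third bound on [eps] below makes the logarithm reach [L]. *)
pose L := 8 * Q / m + 4 / thv.
have [|eps eps0 epsl] := @small_real R [:: rho0; rho0 * m / 4 / (Q + 1); rho0 / expR L].
  move=> a; rewrite !inE => /or3P[] /eqP-> //.
    by apply: divr_gt0; [apply: divr_gt0 => //; exact: mulr_gt0|by rewrite ltr_wpDl].
  by apply: divr_gt0 => //; exact: expR_gt0.
have eps1 : eps <= rho0 by apply: epsl; rewrite !inE eqxx.
have eps2 : eps * Q <= rho0 * m / 4.
  by apply: le_div_mul => //; [rewrite ltW // divr_gt0 // mulr_gt0|apply: epsl; rewrite !inE eqxx orbT].
have eps3 : eps <= rho0 / expR L by apply: epsl; rewrite !inE eqxx !orbT.
pose L0 := ln (1 + rho0 / eps).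
have LL : L <= L0.
  rewrite -ler_expR lnK ?posrE ?ltr_wpDr ?divr_ge0 ?(ltW rho00) ?(ltW eps0) //.
  apply: (@le_trans _ _ (rho0 / eps)); last by rewrite lerDr.
  by rewrite ler_pdivlMr // mulrC -ler_pdivlMr ?expR_gt0.
have Q8 : 0 <= 8 * Q / m by apply: divr_ge0; [exact: mulr_ge0|exact: ltW].
have t4 : 0 < 4 / thv by rewrite divr_gt0.
have L00 : 0 < L0 by apply: lt_le_trans LL; rewrite ltr_wpDl.
have tL : 4 / L0 <= thv.
  rewrite ler_pdivrMr // mulrC -ler_pdivrMr //; apply: le_trans LL.
  by rewrite lerDr.
pose kap := thv / 4; have kap0 : 0 < kap by rewrite divr_gt0.
have tk : 4 * kap <= thv by rewrite /kap mulrC divfK.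
(* Bounds [cu] on the pairs of [S], so that [M] keeps them below half of the truncation level. The
   bounds [m1] and [thv] do not involve [M], which may thus be large; only [e] is adapted to it. *)
pose Mu := (1 + lep eps rhoM) ^+ 2 / (2 * L0) + kap * (d%:R * MS ^+ 2 + d%:R * MS ^+ 2).
pose M := 2 * `|Mu| + 1; have M0 : 0 < M by rewrite ltr_wpDl // mulr_ge0.
have [|e e0 el] := @small_real R [:: 3 * m1 * k / (8 * M); k].
  by move=> a; rewrite !inE => /orP[] /eqP-> //; apply: divr_gt0; apply: mulr_gt0 => //; apply: mulr_gt0.
have eM : e <= 3 * m1 * k / (8 * M) by apply: el; rewrite !inE eqxx.
have ek : e <= k by apply: el; rewrite !inE eqxx orbT.
pose A (i : option bool) : set T := match i with None => S | Some true => F | Some false => U end.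
have mA i : measurable (A i) by case: i => [[]|] //; exact: closed_meas.
have [Rad [B [J [cell [rep [pi [[MSR B1 em en] [mc repK cA cc] cpi [tm tn] low]]]]]]] :=
  coupled_cells mSig mb mLam Lam0 smu snu imu inu MS eps0 L00 kap0 M0 e0 mA.
(* Bad points: off the Lusin set, or of weight above [B]. Every other point lies in the core. *)
pose N : set T := ~` S `|` [set x | B < weight_sum Sig b Lam x].
have coreN x : ~ N x -> S x /\ core Sig b Lam Rad B x.
  move=> /not_orP[/contrapT Sx /negP]; rewrite -leNgt => WB; split=> //; split=> //.
  exact: le_trans (bMS x Sx) MSR.
have Ncore x : S x -> core Sig b Lam Rad B x -> ~ N x.
  by move=> Sx [_ WB] [nS|]; [exact: nS|rewrite /= ltNge => /negP]; apply.
have mN : measurable N.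
  apply: measurableU; first by apply: measurableC; exact: closed_meas.
  by apply: gt_meas; exact: has_mean_meas imu.
have cN x y : cell x = cell y -> N x -> N y.
  move=> cxy Nx; apply: contrapT => /coreN[Sy coy].
  by apply: Ncore Nx; [exact: (cA y x (esym cxy) None)|exact: (cc y x (esym cxy))].
have prN (la : probability T R) : has_mean la W -> mean la (excess W B) <= e -> pr la (~` S : set T) <= k ->
    pr la N <= 2 * k.
  move=> ila ela Sk; rewrite mulr2n mulrDl mul1r; apply: le_trans (prU _ _ _) _.
  - by apply: measurableC; exact: closed_meas.
  - by apply: gt_meas; exact: has_mean_meas imu.
  apply: lerD => //; apply: le_trans (pr_gt_le ila B1) _; exact: le_trans ela ek.
pose P x y := [/\ rho0 <= dotv (x - y) (x - y), ~ N x & ~ N y].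
have PP x y : P x y -> [/\ core Sig b Lam Rad B x, core Sig b Lam Rad B y, cu eps L0 kap (x, y) <= M / 2 &
     main_part eps L0 (dotv (x - y) (x - y)) (qfun Sig b x y) (rfun Sig x y) <= - m1].
  move=> [rr /coreN[Sx cx] /coreN[Sy cy]]; have [mq qQ rM] := Hs x y Sx Sy rr.
  split=> //.
    apply: le_trans (cu_bounded eps0 L00 kap0 (bMS x Sx) (bMS y Sy) rM) _.
    rewrite -/Mu /M; have := ler_norm Mu; lra.
  apply: (main_strict eps0 L00 rho00 rr rM m0 _ mq eps1 eps2 erefl).
    exact: le_trans qQ (ler_norm _).
  by apply: le_trans LL; rewrite lerDl ltW.
have [pi0 _ _] := cpi.
pose pf := \sum_j \sum_j' pi j j' * (`[< P (rep j) (rep j') >])%:R.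
have pfk : pf <= k.
  apply: (@mass_le k e M m1 thv _ _ pf _ I0 M0 m10 I00 _ erefl eM (ltW thv0) low).
    apply: le_trans (lerD tm tn) _; rewrite /I0; lra.
  rewrite -(coupling_sum_le _ _ cpi).
  apply: (@le_trans _ _ (\sum_j \sum_j' pi j j' * (3 / M * (thv * (core_total Sig b Lam Rad B rep j
      + core_total Sig b Lam Rad B rep j')) - 3 / M * (m1 / 4) * (`[< P (rep j) (rep j') >])%:R))).
    apply: ler_sum => j _; apply: ler_sum => j' _; apply: ler_wpM2l => //.
    exact: (core_gen_le rep j j' eps0 L00 kap0 M0 m10 (ltW thv0) tL tk PP).
  rewrite le_eqVlt; apply/orP; left; apply/eqP.
  rewrite !mulr_sumr -sumrB; apply: eq_bigr => j _; rewrite !mulr_sumr -sumrB; apply: eq_bigr => j' _.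
  ring.
(* Integrates over the coupling the pointwise fact that x in [F] implies x in [N], y in [U], y in
   [N], or (x, y) in [P]. The cells refine all these sets, so their masses are exact. *)
have key : pr mu (F : set T) <= (pr mu N + (pr nu (U : set T) + pr nu N)) + pf.
  rewrite -(cell_mass mu mc repK cN mN) -(cell_mass nu mc repK cN mN).
  rewrite -(cell_mass mu mc repK (fun x y cxy => cA x y cxy (Some true)) mF).
  rewrite -(cell_mass nu mc repK (fun x y cxy => cA x y cxy (Some false)) mU).
  rewrite -big_split /=; under [X in _ + X + _]eq_bigr do rewrite -mulrDr.
  rewrite -(coupling_sum_le _ _ cpi) /pf -big_split /=.
  have [_ rows _] := cpi.
  apply: ler_sum => j _; rewrite -rows mulr_suml -big_split /=; apply: ler_sum => j' _.
  rewrite -mulrDr ler_wpM2l //.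
  case: (asboolP (F _)) => [Fj|_]; last by rewrite !addr_ge0.
  case: (asboolP (N _)) => [_|Nj]; first by rewrite -!addrA lerDl !addr_ge0.
  case: (asboolP (N _)) => [_|Nj']; first by rewrite !add0r addrAC lerDr addr_ge0.
  case: asboolP => [_|nU]; first by rewrite !add0r addr0 lerDl.
  rewrite (asboolT (_ : P (rep j) (rep j'))) ?add0r //; split=> //.
  apply: le_trans (sq_norm_le _); rewrite lerXn2r ?nnegrE ?(ltW eta0) //.
  by rewrite leNgt; apply/negP => lt; apply: nU; exact: FU lt.
have h1 := prN mu imu em pS; have h2 := prN nu inu en qS.
by move: key h1 h2 pfk; rewrite /k; move: k00; lra.
Qed.

End Transport.

(** For open [U] the closed inner part keeps a positive distance from the complement, so the
    transport estimate applies with that distance as [eta]; other sets are reached from outside by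
    open ones. *)
Lemma solution_le (R : realType) (d d1 : nat)
  (Sig : 'rV[R]_d -> 'M[R]_(d, d1)) (b : 'rV[R]_d -> 'rV[R]_d) (Lam : 'rV[R]_d -> R)
  (mu nu : probability (Rd R d) R) :
  (forall i j, measurable_fun (setT : set (Rd R d)) (fun x => Sig x i j)) ->
  (forall i, measurable_fun (setT : set (Rd R d)) (fun x => b x 0 i)) ->
  measurable_fun (setT : set (Rd R d)) Lam ->
  (forall x, 0 <= Lam x) ->
  (forall x y, qfun Sig b x y <= (Lam x + Lam y) * enorm (x - y) ^+ 2) ->
  (forall x y, x != y -> qfun Sig b x y < 2 * rfun Sig x y) ->
  prob_solution Sig b mu -> has_mean mu (weight_sum Sig b Lam : Rd R d -> R) ->
  prob_solution Sig b nu -> has_mean nu (weight_sum Sig b Lam : Rd R d -> R) ->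
  forall A : set (Rd R d), measurable A -> pr mu A <= pr nu A.
Proof.
move=> mSig mb mLam Lam0 qL qr smu imu snu inu.
have open_le (U : set 'rV[R]_d) : open U -> pr mu (U : set (Rd R d)) <= pr nu (U : set (Rd R d)).
  move=> oU; have mU := open_meas oU; apply/ler_addgt0Pr => k k0.
  have k20 : 0 < k / 2 by rewrite divr_gt0.
  have [n ne] := inner_part_approx mu oU k20.
  have mF : measurable (inner_part U n : set (Rd R d)).
    by apply: closed_meas; exact: inner_part_closed.
  have n0 : 0 < n.+1%:R^-1 :> R by rewrite invr_gt0.
  have := transport_bound mSig mb mLam Lam0 qL qr smu snu imu inu mF mU n0 k20
    (fun x y h => h y).
  have := prU mu mF (measurableD mU mF).
  rewrite setDUK; last exact: inner_part_sub.
  by move: ne; lra.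
move=> A mA; apply/ler_addgt0Pr => k k0.
(* Regularity is used for [nu], which has to control the difference between the open set and [A];
   for [mu] inclusion is enough. *)
have [F [U [cF oU FA AU UF]]] := regular_measurable nu mA k0.
have mU := open_meas oU; have mF := closed_meas cF.
apply: le_trans (pr_le mu mA mU AU) _; apply: le_trans (open_le U oU) _.
have := prU nu mF (measurableD mU mF).
rewrite setDUK; last exact: subset_trans AU.
by move: (pr_le nu mF mA FA) UF; lra.
Qed.

Theorem theorem2 (R : realType) (d d1 : nat)
  (Sig : 'rV[R]_d -> 'M[R]_(d, d1)) (b : 'rV[R]_d -> 'rV[R]_d)
  (Lam : 'rV[R]_d -> R) :
  (forall (i : 'I_d) (j : 'I_d1),
     measurable_fun (setT : set (Rd R d)) (fun x => Sig x i j)) ->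
  (forall i : 'I_d, measurable_fun (setT : set (Rd R d)) (fun x => b x 0 i)) ->
  measurable_fun (setT : set (Rd R d)) Lam ->
  (forall x, 0 <= Lam x) ->
  (forall x y, qfun Sig b x y <= (Lam x + Lam y) * enorm (x - y) ^+ 2) ->
  (forall x y, x != y -> qfun Sig b x y < 2 * rfun Sig x y) ->
  forall mu1 mu2 : probability (Rd R d) R,
    prob_solution Sig b mu1 ->
    (\int[mu1]_x ((hsnorm (Sig x) ^+ 2 / (1 + enorm x ^+ 2)
                   + enorm (b x) / (1 + enorm x) + Lam x)%:E) < +oo)%E ->
    prob_solution Sig b mu2 ->
    (\int[mu2]_x ((hsnorm (Sig x) ^+ 2 / (1 + enorm x ^+ 2)
                   + enorm (b x) / (1 + enorm x) + Lam x)%:E) < +oo)%E ->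
    forall A : set (Rd R d), measurable A -> mu1 A = mu2 A.
Proof.
move=> mSig mb mLam Lam0 qL qr mu nu smu imu snu inu A mA.
have mean_of la := has_mean_lt_pinfty (mu := la) (total_meas mSig mb mLam) (weight_sum_ge0 Sig b Lam0).
rewrite -!prE //; congr EFin; apply/eqP; rewrite eq_le; apply/andP; split.
  exact: (solution_le mSig mb mLam Lam0 qL qr smu (mean_of _ imu) snu (mean_of _ inu)).
exact: (solution_le mSig mb mLam Lam0 qL qr snu (mean_of _ inu) smu (mean_of _ imu)).
Qed.
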